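(* Let $G$ be a hyperbolic group, let $k$ be a finite field and let $i\ge 0$ be an integer. If $G$ has trivial $i$-th homology over $k$ at infinity, i.e. $H_i^{\infty}(P(G);k)=0$, then the Gromov boundary $\partial G$ has trivial $i$-th Steenrod homology over $k$, i.e. $H_i^{st}(\partial G;k)=0$.
   Context: Rips complex: fix a word metric $d$ on $G$ coming from a finite generating set. For $t>0$, $P_t(G)$ is the simplicial complex whose vertices are the elements of $G$ and in which a finite nonempty set of vertices spans a simplex if and only if all pairwise distances are $<t$. Set $P(G)=P_t(G)$ for a fixed $t$ large enough that $P_t(G)$ is contractible (such $t$ exists since $G$ is hyperbolic). $G$ acts geometrically on $P(G)$. Homology at infinity: let $e$ be the identity of $G$ and let $\overline{B}(n)$ be the full subcomplex of $P(G)$ on the vertices $v$ with $d(v,e)\le n$. The $i$-th homology at infinity of $G$ over $k$ is $H_i^{\infty}(P(G);k)=\varprojlim_n H_i(P(G)\setminus\overline{B}(n);k)$, with bonding maps induced by inclusions. Steenrod homology: let $X$ be a compact metric space ($\partial G$ is given a metric compatible with its topology). A regular map $f$ from a (countable, locally finite) simplicial complex $A$ to $X$ is a map from the vertices of $A$ to $X$ such that for every $\epsilon>0$ all but finitely many simplices of $A$ have their vertex sets sent onto sets of diameter $<\epsilon$. A regular $q$-chain is a triple $(A,f,s)$ where $A$ is such a complex, $f$ is a regular map from $A$ to $X$, and $s$ is a locally finite (possibly infinite) simplicial $q$-chain of $A$ with coefficients in $k$; it is a regular $q$-cycle if $\partial s=0$. Two regular $q$-cycles $(A_1,f_1,s_1)$,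 $(A_2,f_2,s_2)$ are homologous if there is a regular $(q+1)$-chain $(A,f,s)$ such that $A_1,A_2$ are closed subcomplexes of $A$, $f$ agrees with $f_1$ on $A_1$ and with $f_2$ on $A_2$, and $\partial s=s_1-s_2$. The homology classes of regular $q$-cycles form a group, with addition induced by disjoint union of complexes and sum of chains. The Steenrod homology is indexed in the standard (reduced) way: $H^{st}_i(X;k)$ is the group of homology classes of regular $(i+1)$-cycles in $X$. With this indexing $H^{st}_i(\partial G;k)\cong H^{LF}_{i+1}(P(G);k)$ (locally finite homology). *)

(* Defs.v *)
From HB Require Import structures.
From mathcomp Require Import all_boot all_order all_algebra all_fingroup.
From mathcomp Require Import finmap.
From mathcomp Require Import all_classical all_reals all_analysis.

Set Implicit Arguments.
Unset Strict Implicit.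
Unset Printing Implicit Defensive.

Import Order.TTheory GRing.Theory Num.Theory.
Import numFieldNormedType.Exports numFieldTopology.Exports.

Local Open Scope classical_set_scope.
Local Open Scope ring_scope.

Section WordMetric.
Context {G : groupType}.
Implicit Types (S : seq G) (g : G).

Definition is_word S g (n : nat) : Prop :=
  exists w : seq G,
    [/\ size w = n,
        all (fun x => (x \in S) || (x^-1%g \in S)) w &
        \big[*%g/1%g]_(x <- w) x = g].

Definition generates S : Prop := forall g, exists n, is_word S g n.

(* The value 0 on elements that are not products of letters is never used:
   [S] will always be a generating set. *)
Definition word_length S g : nat :=
  if pselect (exists n, `[< is_word S g n >]) is left gW then ex_minn gW
  else 0%N.

Definition word_dist (R : realType) S (x y : G) : R :=
  (word_length S (x^-1 * y)%g)%:R.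

Lemma word_distxx (R : realType) S x : word_dist R S x x = 0.
Proof.
rewrite /word_dist mulVg /word_length; case: pselect => // gW.
case: ex_minnP => n _ /(_ 0) n_le; suff /n_le : `[< is_word S 1%g 0 >].
  by rewrite leqn0 => /eqP ->.
by apply/asboolP; exists [::]; rewrite big_nil.
Qed.

End WordMetric.

Section Gromov.
Context {R : realType} {T : Type}.
Variable d : T -> T -> R.

Definition gromov_product (w x y : T) : R := (d x w + d y w - d x y) / 2.

Definition hyperbolic : Prop :=
  exists delta : R, forall w x y z : T,
    Num.min (gromov_product w x y) (gromov_product w y z) - delta
      <= gromov_product w x z.

Variable w : T.

Definition eventually_close (x y : nat -> T) (r : R) : Prop :=
  exists N : nat, forall m n : nat, (N <= m)%N -> (N <= n)%N ->
    r <= gromov_product w (x m) (y n).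

Definition asymptotic (x y : nat -> T) : Prop :=
  forall r : R, eventually_close x y r.

Definition to_infinity (x : nat -> T) : Prop := asymptotic x x.

(* Points are classes of sequences converging to infinity; a class is kept as
   the set of its members because [asymptotic] is transitive only when [d] is
   hyperbolic. *)
Record boundary := Boundary {
  bclass :> (nat -> T) -> Prop;
  bclassP : exists2 x, to_infinity x &
    bclass = [set y | to_infinity y /\ asymptotic x y] }.

(* The points [eta] such that liminf (x_m | y_n) >= r for some sequences x, y
   that represent xi, eta.  For a word metric Gromov products are half-integers,
   so the condition on the liminf is the same as "eventually >= r". *)
Definition boundary_nbhd (xi : boundary) (r : R) : set boundary :=
  [set eta : boundary |
    exists x y, [/\ xi x, eta y & eventually_close x y r]].

Definition boundary_open (U : set boundary) : Prop :=
  forall xi, U xi -> exists r, boundary_nbhd xi r `<=` U.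

Lemma boundary_nbhdS xi r s : r <= s -> boundary_nbhd xi s `<=` boundary_nbhd xi r.
Proof.
move=> rs eta [x [y [xix etay [N xyN]]]]; exists x, y; split=> //.
by exists N => m n Nm Nn; exact: le_trans (xyN m n Nm Nn).
Qed.

Lemma boundary_openT : boundary_open setT.
Proof. by move=> xi _; exists 0. Qed.

Lemma boundary_openI : setI_closed boundary_open.
Proof.
move=> A B oA oB xi [/oA[r rA] /oB[s sB]]; exists (Num.max r s) => eta etaV.
split; [apply: rA | apply: sB]; apply: boundary_nbhdS etaV.
  by rewrite le_max lexx.
by rewrite le_max lexx orbT.
Qed.

Lemma boundary_open_bigU (I : Type) (f : I -> set boundary) :
  (forall i, boundary_open (f i)) -> boundary_open (\bigcup_i f i).
Proof.
move=> fo xi [i _ /fo[r rf]]; exists r => eta /rf ?; by exists i.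
Qed.

HB.instance Definition _ := gen_eqMixin boundary.
HB.instance Definition _ := gen_choiceMixin boundary.
HB.instance Definition _ := isOpenTopological.Build boundary
  boundary_openT boundary_openI boundary_open_bigU.

End Gromov.

(* Every element of the type [V] is a vertex. *)
Record simplicial_complex (V : choiceType) := SimplicialComplex {
  simplex :> {fset V} -> Prop;
  simplex_neq0 : forall s, simplex s -> s != fset0;
  simplex1 : forall v, simplex [fset v]%fset;
  simplexS : forall s s' : {fset V},
    simplex s -> (s' `<=` s)%fset -> s' != fset0 -> simplex s' }.

Section Realization.
Context {R : realType} {V : choiceType}.
Variable K : simplicial_complex V.

(* A point is given by its barycentric coordinates. *)
Record realization := Point {
  coord :> {fsfun V -> R with 0};
  coord_ge0 : forall v, 0 <= coord v;
  coord_sum : \sum_(v <- finsupp coord) coord v = 1;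
  coord_supp : K (finsupp coord) }.

(* The weak topology: U is open iff its trace on each closed simplex is open for
   the Euclidean topology of that simplex. *)
Definition realization_open (U : set realization) : Prop :=
  forall (s : {fset V}) (a : realization),
    K s -> (finsupp a `<=` s)%fset -> U a ->
    exists2 e : R, 0 < e &
      forall b : realization, (finsupp b `<=` s)%fset ->
        (forall v, `|a v - b v| < e) -> U b.

Lemma realization_openT : realization_open setT.
Proof. by move=> s a _ _ _; exists 1. Qed.

Lemma realization_openI : setI_closed realization_open.
Proof.
move=> A B oA oB s a Ks sa [/(oA s a Ks sa)[e e0 eA] /(oB s a Ks sa)[f f0 fB]].
exists (Num.min e f); first by rewrite lt_min e0.
move=> b sb ab; split; [apply: eA | apply: fB] => // v.
  by have := ab v; rewrite lt_min => /andP[].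
by have := ab v; rewrite lt_min => /andP[].
Qed.

Lemma realization_open_bigU (I : Type) (f : I -> set realization) :
  (forall i, realization_open (f i)) -> realization_open (\bigcup_i f i).
Proof.
move=> fo s a Ks sa [i _ /(fo i s a Ks sa)[e e0 ef]].
by exists e => // b sb ab; exists i => //; exact: ef.
Qed.

HB.instance Definition _ := gen_eqMixin realization.
HB.instance Definition _ := gen_choiceMixin realization.
HB.instance Definition _ := isOpenTopological.Build realization
  realization_openT realization_openI realization_open_bigU.

(* The underlying space of the full subcomplex on the vertices in [W]. *)
Definition full_subcomplex (W : set V) : set realization :=
  [set a : realization | forall v, v \in finsupp a -> W v].

End Realization.
Arguments realization R {V} K.

Definition contractible (R : realType) (T : topologicalType) : Prop :=
  exists (x0 : T) (H : T * R -> T),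
    [/\ {within [set: T] `*` `[0%R, 1%R], continuous H},
        forall x, H (x, 0) = x &
        forall x, H (x, 1) = x0].

Definition homeomorphic (X Y : topologicalType) : Prop :=
  exists (f : X -> Y) (g : Y -> X),
    [/\ cancel f g, cancel g f, continuous f & continuous g].

Definition std_simplex (R : realType) (q : nat) : set 'rV[R]_q.+1 :=
  [set x | (forall i, 0 <= x 0 i) /\ \sum_i x 0 i = 1].

Section FaceMap.
Context {R : realType} {q : nat}.
Variable j : 'I_q.+2.

Definition face_row (x : 'rV[R]_q.+1) : 'rV[R]_q.+2 :=
  \row_i (if unlift j i is Some l then x 0 l else 0).

Lemma face_row_std (x : @std_simplex R q) :
  face_row (set_val x) \in @std_simplex R q.+1.
Proof.
have [x0 x1] := set_mem (valP x); apply/mem_set; split=> [i|].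
  by rewrite mxE; case: unliftP.
rewrite (bigD1_ord j)//= mxE unlift_none add0r -[RHS]x1.
by apply: eq_bigr => i _; rewrite mxE liftK.
Qed.

Definition face_map (x : @std_simplex R q) : @std_simplex R q.+1 :=
  exist (fun y => y \in @std_simplex R q.+1) _ (face_row_std x).

Lemma face_row_continuous : continuous face_row.
Proof.
move=> x; have xF : Filter (nbhs (x : 'rV[R]_q.+1)) by exact: nbhs_filter.
apply/(@cvg_ballP _ _ _ _ xF) => e e0.
apply: filterS (nbhsx_ballx (x : 'rV[R]_q.+1) e e0) => y [_ xy].
split=> // i l; rewrite !mxE.
by case: unliftP => [l' _|_]; [exact: xy|exact: ballxx].
Qed.

Lemma face_map_continuous : continuous face_map.
Proof.
apply: continuous_comp_initial => x.
apply: (@continuous_comp _ _ _ (set_val : @std_simplex R q -> _) face_row).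
  exact: initial_continuous.
exact: face_row_continuous.
Qed.

HB.instance Definition _ :=
  isContinuous.Build _ _ face_map face_map_continuous.

End FaceMap.

(* Homology of the subspaces [U] of a fixed space [X]: the singular simplices of
   [U] are those of [X] whose image lies in [U]. *)
Section SingularHomology.
Context {R : realType} {X : topologicalType} {k : nzRingType}.

Definition singular_simplex (q : nat) : Type :=
  continuousType (@std_simplex R q) X.

HB.instance Definition _ q := Choice.on (singular_simplex q).

Definition singular_chain (q : nat) (U : set X) : set (singular_simplex q -> k) :=
  [set c : singular_simplex q -> k |
    finite_set [set sigma | c sigma != 0] /\
    forall sigma : singular_simplex q, c sigma != 0 -> range sigma `<=` U].

Definition singular_face (q : nat) (j : 'I_q.+2) (sigma : singular_simplex q.+1) :
  singular_simplex q := sigma \o face_map j.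

Definition singular_bd (q : nat) (c : singular_simplex q.+1 -> k) :
    singular_simplex q -> k :=
  fun tau => \sum_(j < q.+2)
    (-1) ^+ j * \sum_(sigma \in singular_face j @^-1` [set tau]) c sigma.

(* There is no augmentation: H_0 is unreduced. *)
Definition singular_cycle (q : nat) (U : set X) : set (singular_simplex q -> k) :=
  match q return set (singular_simplex q -> k) with
  | 0 => singular_chain U
  | p.+1 => [set c | singular_chain U c /\ singular_bd c = \0]
  end.

Definition singular_boundary (q : nat) (U : set X) :
    set (singular_simplex q -> k) :=
  @singular_bd q @` singular_chain U.

Definition homology_class (q : nat) (U : set X) (z : singular_simplex q -> k) :
    set (singular_simplex q -> k) :=
  [set z' | singular_cycle U z' /\ singular_boundary U (z' \- z)].

(* H_q(U; k), whose elements are the cosets of the group of boundaries. *)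
Definition homology (q : nat) (U : set X) : set (set (singular_simplex q -> k)) :=
  homology_class U @` singular_cycle U.

(* The map H_q(U; k) -> H_q(W; k) induced by an inclusion of U in W. *)
Definition homology_incl (q : nat) (W : set X)
    (c : set (singular_simplex q -> k)) : set (singular_simplex q -> k) :=
  \bigcup_(z in c) homology_class W z.

Definition lim_homology (q : nat) (U : nat -> set X) :
    set (nat -> set (singular_simplex q -> k)) :=
  [set x | forall n,
     homology (U n) (x n) /\ homology_incl (U n) (x n.+1) = x n].

End SingularHomology.

Section Rips.
Context {R : realType} {G : groupType}.
Variables (S : seq G) (t : {posnum R}).

Definition rips_simplex (s : {fset G}) : Prop :=
  s != fset0 /\
  forall x y, x \in s -> y \in s -> word_dist R S x y < t%:num.

Lemma rips_simplex_neq0 s : rips_simplex s -> s != fset0.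
Proof. by case. Qed.

Lemma rips_simplex1 x : rips_simplex [fset x]%fset.
Proof.
split; first by apply/fset0Pn; exists x; rewrite inE.
by move=> y z /fset1P -> /fset1P ->; rewrite word_distxx.
Qed.

Lemma rips_simplexS (s s' : {fset G}) :
  rips_simplex s -> (s' `<=` s)%fset -> s' != fset0 -> rips_simplex s'.
Proof.
move=> [_ sP] /fsubsetP ss' s'0; split=> // x y /ss' xs /ss' ys; exact: sP.
Qed.

Definition rips : simplicial_complex G :=
  SimplicialComplex rips_simplex_neq0 rips_simplex1 rips_simplexS.

Definition rips_ball (n : nat) : set (realization R rips) :=
  full_subcomplex [set v : G | word_dist R S v 1%g <= n%:R].

Definition homology_at_infinity (k : nzRingType) (i : nat) :
    set (nat -> set (@singular_simplex R (realization R rips) i -> k)) :=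
  lim_homology (fun n => ~` rips_ball n).

(* The zero of the inverse limit is the thread of the classes of 0. *)
Definition trivial_homology_at_infinity (k : nzRingType) (i : nat) : Prop :=
  @homology_at_infinity k i =
    [set fun n => homology_class (~` rips_ball n) \0].

End Rips.

(* A q-chain, possibly infinite, with coefficients in [k] is an alternating
   function on (q+1)-tuples of vertices: its value at u is the coefficient of the
   oriented simplex [u_0, ..., u_q]. *)
Section SimplicialChains.
Context {V : choiceType} {k : nzRingType}.

Definition locally_finite (K : simplicial_complex V) : Prop :=
  forall v, finite_set [set s : {fset V} | K s /\ v \in s].

Definition is_chain (K : simplicial_complex V) (q : nat)
    (s : q.+1.-tuple V -> k) : Prop :=
  (forall u, s u != 0 -> uniq u /\ K [fset v in tval u]%fset) /\
  (forall (p : 'S_q.+1) (u : q.+1.-tuple V),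
     s [tuple tnth u (p i) | i < q.+1] = (-1) ^+ p * s u).

(* The simplices having [u_0, ..., u_q] as a face are the [w, u_0, ..., u_q], in
   whose boundary it has coefficient 1; the sum is finite when the complex is
   locally finite. *)
Definition chain_bd (q : nat) (s : q.+2.-tuple V -> k) : q.+1.-tuple V -> k :=
  fun u => \sum_(w \in [set: V]) s [tuple of w :: u].

End SimplicialChains.

Definition chain_image (V W : choiceType) (k : nzRingType) (q : nat) (j : V -> W)
    (s : q.+1.-tuple V -> k) : q.+1.-tuple W -> k :=
  fun u => \sum_(v \in [set v : q.+1.-tuple V | map_tuple j v = u]) s v.

Section Steenrod.
Context {R : realType}.

Record regular_chain (X : metricType R) (k : nzRingType) (q : nat) :=
  RegularChain {
    vert : countType;
    cplx : simplicial_complex vert;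
    cplx_lf : locally_finite cplx;
    vmap : vert -> X;
    vmap_regular : forall e : R, 0 < e ->
      finite_set [set s : {fset vert} | cplx s /\
        ~ (forall v w, v \in s -> w \in s -> mdist (vmap v) (vmap w) < e)];
    chn : q.+1.-tuple vert -> k;
    chnP : is_chain cplx chn }.

Definition regular_cycle (X : metricType R) (k : nzRingType) (q : nat)
    (z : regular_chain X k q.+1) : Prop :=
  chain_bd (@chn _ _ _ z) = \0.

(* [j] embeds the complex of [z] in the complex of [c] as a subcomplex on which
   the regular map of [c] restricts to that of [z]. *)
Definition subchain_embedding (X : metricType R) (k : nzRingType) (p q : nat)
    (z : regular_chain X k p) (c : regular_chain X k q)
    (j : vert z -> vert c) : Prop :=
  [/\ injective j,
      forall s : {fset vert z}, cplx z s -> cplx c (j @` s)%fset &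
      forall v, vmap (j v) = vmap v].

(* The complexes of the two cycles are abstract, so that they lie in the complex
   of the bounding chain only up to an embedding. *)
Definition regular_homologous (X : metricType R) (k : nzRingType) (q : nat)
    (z1 z2 : regular_chain X k q) : Prop :=
  exists (c : regular_chain X k q.+1)
         (j1 : vert z1 -> vert c) (j2 : vert z2 -> vert c),
    [/\ subchain_embedding j1, subchain_embedding j2 &
        chain_bd (@chn _ _ _ c) =
          chain_image j1 (@chn _ _ _ z1) \- chain_image j2 (@chn _ _ _ z2)].

(* H^st_i(X; k) = 0: all regular (i+1)-cycles have the same homology class. *)
Definition trivial_steenrod_homology (X : metricType R) (k : nzRingType)
    (i : nat) : Prop :=
  forall z1 z2 : regular_chain X k i.+1,
    regular_cycle z1 -> regular_cycle z2 -> regular_homologous z1 z2.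

End Steenrod.

(* Main.v *)
Require Import Defs.
From HB Require Import structures.
From mathcomp Require Import all_boot all_order all_algebra all_fingroup.
From mathcomp Require Import finmap.
From mathcomp Require Import all_classical all_reals all_analysis.
From mathcomp Require Import freeg ring lra zify.

(* Push a Steenrod cycle z on the boundary into the Rips complex P of G: a vertex
   of z goes to the point of a ray towards its image at a depth that varies
   slowly along the edges of z, so that the vertices of each simplex stay within
   bounded distance of each other.
   The vertices of z and of G together span a locally finite complex Y, pulled
   back from a Rips complex of large scale, which maps regularly to the boundary;
   it is enough to fill z there.

   Since P is contractible and G acts on it by translations, filling over
   skeleta gives a chain map phi of bounded displacement from Y to P, chain
   homotopic to the identity inside Y.  Let z_n be the part of z that meets the
   ball of radius n.  The cycles phi(bd z_n) lie outside larger and larger balls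
   and form an element of lim H_i(P - B(n)), which vanishes; so phi(bd z_n) bounds
   w_n far away, the finite cycle phi(z_n) - w_n bounds in P, and z agrees with a
   boundary on arbitrarily large balls.  As k is finite, a compactness argument
   turns these approximate fillings into a locally finite filling of z.

   Singular chains are compared with simplicial ones without barycentric
   subdivision: small ordered chains of points of a simplex form an acyclic
   complex (move along straight lines in small steps), and sending a point of P
   to a vertex where its barycentric coordinate is largest turns a small tuple of
   points into a simplex. *)

Set Implicit Arguments.
Unset Strict Implicit.
Unset Printing Implicit Defensive.

Import Order.TTheory GRing.Theory Num.Theory.
Import numFieldNormedType.Exports numFieldTopology.Exports.

Local Open Scope classical_set_scope.
Local Open Scope ring_scope.

(** * Ordered chains *)

(** The limit over balls hands out each w_n separately, with no relation between consecutive ones,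
    so the approximate fillings cannot simply be summed. What they share is a bound on the size of
    their simplices that does not depend on n. With local finiteness it leaves finitely many
    possible simplices near any given one, so that a cluster point of the coefficient functions is
    again a filling. The bound comes from finiteness: up to translation, cycles of given degree and
    bounded diameter in P have finitely many possible supports, and a finite field then allows
    finitely many such cycles, so that the filling radius is uniform. Bounded size is also all that
    the boundary sees: vertices at bounded distance from each other and far from the identity have
    close shadows in it, which makes the map from Y regular. The group itself is put among the
    vertices of Y so that the images of phi, and with them the homotopy from phi to the identity,
    lie in Y. Two cycles are compared through their difference, a single cycle in a common Y. *)

Section FreeModule.
Context {k : comNzRingType} {K : choiceType}.
Implicit Types (c d : {freeg K / k}) (P Q : K -> Prop).

Definition supp_in P c : Prop := forall x, coeff x c != 0 -> P x.

Lemma supp_in0 P : supp_in P 0.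
Proof. by move=> x; rewrite coeff0 eqxx. Qed.

Lemma supp_inP P a c d : supp_in P c -> supp_in P d -> supp_in P (a *: c + d).
Proof.
move=> Pc Pd x; rewrite coeffD coeffZ => xcd.
have [c0|/Pc//] := eqVneq (coeff x c) 0.
by apply: Pd; move: xcd; rewrite c0 mulr0 add0r.
Qed.

Lemma supp_inZ P a c : supp_in P c -> supp_in P (a *: c).
Proof. by move=> Pc; rewrite -[_ *: _]addr0; apply: supp_inP => //; exact: supp_in0. Qed.

Lemma supp_inD P c d : supp_in P c -> supp_in P d -> supp_in P (c + d).
Proof. by rewrite -{2}[c]scale1r; exact: supp_inP. Qed.

Lemma supp_inN P c : supp_in P c -> supp_in P (- c).
Proof. by rewrite -[- c]scaleN1r; exact: supp_inZ. Qed.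

Lemma supp_inB P c d : supp_in P c -> supp_in P d -> supp_in P (c - d).
Proof. by move=> Pc Pd; apply: supp_inD => //; exact: supp_inN. Qed.

Lemma supp_in_sum P (I : Type) (r : seq I) (F : I -> {freeg K / k}) :
  (forall i, supp_in P (F i)) -> supp_in P (\sum_(i <- r) F i).
Proof.
move=> PF; elim/big_rec: _ => [|i c _]; first exact: supp_in0.
by apply: supp_inD; exact: PF.
Qed.

Lemma supp_inU P x : P x -> supp_in P << x >>.
Proof.
by move=> Px y; rewrite coeffU mul1r; case: (eqVneq x y) => [<-//|_]; rewrite eqxx.
Qed.

Lemma supp_inW P Q c : (forall x, P x -> Q x) -> supp_in P c -> supp_in Q c.
Proof. by move=> PQ Pc x /Pc/PQ. Qed.

Lemma supp_in_dom c : supp_in (fun x => x \in dom c) c.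
Proof. by move=> x; rewrite mem_dom. Qed.

Lemma supp_ind P (A : {freeg K / k} -> Prop) :
  A 0 -> (forall a c d, A c -> A d -> A (a *: c + d)) ->
  (forall x, P x -> A << x >>) -> forall c, supp_in P c -> A c.
Proof.
move=> A0 AP AU c Pc; rewrite -(freeg_sumE c) big_seq.
elim/big_rec: _ => [//|x d]; rewrite mem_dom => /Pc Px Ad.
have -> : << coeff x c *g x >> = coeff x c *: << x >>.
  by apply/eqP/freeg_eqP => y; rewrite coeffZ !coeffU mul1r.
by apply: AP => //; exact: AU.
Qed.

Lemma freeg_ind (A : {freeg K / k} -> Prop) :
  A 0 -> (forall a c d, A c -> A d -> A (a *: c + d)) ->
  (forall x, A << x >>) -> forall c, A c.
Proof. by move=> A0 AP AU c; exact: (supp_ind (P := setT)). Qed.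

Section Lin.
Context {M : lmodType k}.
Variable F : K -> M.

Definition lin (c : {freeg K / k}) : M := fglift F c.

Lemma linE c : lin c = \sum_(x <- dom c) coeff x c *: F x.
Proof.
have lin_add : {morph lin : x y / x + y}.
  move=> x y; rewrite /lin -[y in LHS]opprK (lift_is_additive F x (- y)).
  have lN0 : fglift F 0 = 0.
    by have := lift_is_additive F 0 0; rewrite !subrr.
  by rewrite -(sub0r y) (lift_is_additive F 0 y) lN0 sub0r opprK.
rewrite -{1}(freeg_sumE c).
have lin0 : lin 0 = 0 by apply: (addrI (lin 0)); rewrite -lin_add !addr0.
rewrite (big_morph lin lin_add lin0).
by apply: eq_bigr => x _; rewrite /lin liftU.
Qed.

Lemma linE_uniq (r : seq K) c : uniq r -> {subset dom c <= r} ->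
  lin c = \sum_(x <- r) coeff x c *: F x.
Proof.
move=> ur cr; rewrite linE [RHS](bigID (mem (dom c)))/=.
rewrite [X in _ + X]big1 ?addr0; last first.
  by move=> x xc; rewrite coeff_outdom// scale0r.
rewrite -[RHS]big_filter; apply: perm_big; apply: uniq_perm.
- exact: uniq_dom.
- by rewrite filter_uniq.
- by move=> x; rewrite mem_filter; case: (boolP (x \in dom c)) => // /cr ->.
Qed.

Fact lin_is_linear : linear lin.
Proof.
move=> a c d; set r := undup (dom c ++ dom d ++ dom (a *: c + d)).
rewrite !(@linE_uniq r) ?undup_uniq//; try by move=> x xc;
  rewrite mem_undup !mem_cat xc ?orbT.
rewrite scaler_sumr -big_split; apply: eq_bigr => x _ /=.
by rewrite coeffD coeffZ scalerDl scalerA.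
Qed.

HB.instance Definition _ :=
  GRing.isLinear.Build k {freeg K / k} M _ lin lin_is_linear.

Lemma linU x : lin << x >> = F x.
Proof. by rewrite /lin liftU scale1r. Qed.

End Lin.

Lemma eq_lin (M : lmodType k) P (F F' : K -> M) c :
  (forall x, P x -> F x = F' x) -> supp_in P c -> lin F c = lin F' c.
Proof.
move=> FF'; move: c; refine (supp_ind _ _ _) => [|a c d|x Px].
- by rewrite !linear0.
- by rewrite !linearP /= => -> ->.
- by rewrite !linU; exact: FF'.
Qed.

Lemma lin_comp (M N : lmodType k) (f : {linear M -> N}) (F : K -> M) c :
  f (lin F c) = lin (fun x => f (F x)) c.
Proof.
elim/freeg_ind: c => [|a c d|x].
- by rewrite !linear0.
- by rewrite !linearP /= => -> ->.
- by rewrite !linU.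
Qed.

Lemma lin_id c : lin (fun x => << x >>) c = c.
Proof.
elim/freeg_ind: c => [|a c d|x].
- by rewrite !linear0.
- by rewrite !linearP /= => -> ->.
- by rewrite !linU.
Qed.

Lemma freeg_of_fun (f : K -> k) : finite_set [set x | f x != 0] ->
  exists c : {freeg K / k}, forall x, coeff x c = f x.
Proof.
move=> ff; exists (\sum_(x <- fset_set [set x | f x != 0]) f x *: << x >>) => y.
rewrite raddf_sum /=; have [fy|fy] := eqVneq (f y) 0.
  rewrite fy big1_seq// => x /andP[_]; rewrite in_fset_set// inE /= => fx.
  rewrite coeffZ coeffU; case: eqVneq => [xy|_]; last by rewrite !mulr0.
  by rewrite xy fy eqxx in fx.
rewrite (bigD1_seq y) ?fset_uniq//=; last by rewrite in_fset_set// inE.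
rewrite coeffZ coeffU eqxx !mulr1 big1 ?addr0// => x /negbTE xy.
by rewrite coeffZ coeffU xy !mulr0.
Qed.

End FreeModule.

Lemma supp_in_lin (k : comNzRingType) (K L : choiceType) (P : K -> Prop)
    (Q : L -> Prop) (F : K -> {freeg L / k}) c :
  (forall x, P x -> supp_in Q (F x)) -> supp_in P c -> supp_in Q (lin F c).
Proof.
move=> PQ; move: c; refine (supp_ind _ _ _) => [|a c d|x Px].
- by rewrite linear0; exact: supp_in0.
- by rewrite linearP; exact: supp_inP.
- by rewrite linU; exact: PQ.
Qed.

Section OrderedChains.
Context {k : comNzRingType}.
Local Notation Ch V := {freeg (seq V) / k}.

Definition cone (V : choiceType) (x : V) : Ch V -> Ch V :=
  lin (fun u => << x :: u >>).

HB.instance Definition _ V x :=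
  GRing.Linear.on (@cone V x).

Fixpoint bd_seq (V : choiceType) (u : seq V) : Ch V :=
  if u is x :: u' then << u' >> - cone x (bd_seq u') else 0.

(* The empty sequence is a simplex of dimension -1, so that [bd] includes the
   augmentation and [bd_cone] holds in all degrees. *)
Definition bd (V : choiceType) : Ch V -> Ch V := lin (@bd_seq V).

HB.instance Definition _ V := GRing.Linear.on (@bd V).

Definition mapc (V W : choiceType) (f : V -> W) : Ch V -> Ch W :=
  lin (fun u => << map f u >>).

HB.instance Definition _ V W f := GRing.Linear.on (@mapc V W f).

Lemma coneU (V : choiceType) (x : V) u : cone x << u >> = << x :: u >>.
Proof. exact: linU. Qed.

Lemma bdU (V : choiceType) (u : seq V) : bd << u >> = bd_seq u.
Proof. exact: linU. Qed.

Lemma mapcU (V W : choiceType) (f : V -> W) u : mapc f << u >> = << map f u >>.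
Proof. exact: linU. Qed.

Lemma bd_cone (V : choiceType) (x : V) c : bd (cone x c) = c - cone x (bd c).
Proof.
elim/(@freeg_ind k): c => [|a c d|u].
- by rewrite !linear0 ?addr0 ?subr0.
- rewrite !linearP /= => -> ->; apply/eqP/freeg_eqP => y.
  by rewrite !(coeffD, coeffZ, coeffN); ring.
- by rewrite coneU !bdU.
Qed.

Lemma bd_bd (V : choiceType) (c : Ch V) : bd (bd c) = 0.
Proof.
elim/(@freeg_ind k): c => [|a c d|u].
- by rewrite !linear0.
- by rewrite !linearP /= => -> ->; rewrite scaler0 addr0.
- rewrite bdU; elim: u => [|x u IHu] /=; first by rewrite linear0.
  by rewrite linearB /= bd_cone bdU IHu linear0 subr0 subrr.
Qed.

Lemma lin_bd (V : choiceType) (M : lmodType k)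
    (F : seq V -> M) c : lin (fun u => lin F (bd << u >>)) c = lin F (bd c).
Proof.
elim/(@freeg_ind k): c => [|a c d|u]; last by rewrite linU.
  by rewrite !linear0.
by rewrite !linearP /= => -> ->.
Qed.

Lemma mapc_cone (V W : choiceType) (f : V -> W) x c :
  mapc f (cone x c) = cone (f x) (mapc f c).
Proof.
elim/(@freeg_ind k): c => [|a c d|u].
- by rewrite !linear0.
- by rewrite !linearP /= => -> ->.
- by rewrite coneU !mapcU coneU.
Qed.

Lemma bd_mapc (V W : choiceType) (f : V -> W) c : bd (mapc f c) = mapc f (bd c).
Proof.
elim/(@freeg_ind k): c => [|a c d|u].
- by rewrite !linear0.
- by rewrite !linearP /= => -> ->.
- rewrite mapcU !bdU; elim: u => [|x u IHu] /=; first by rewrite linear0.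
  by rewrite linearB /= mapc_cone mapcU IHu.
Qed.

Lemma mapc_comp (V W Z : choiceType) (f : W -> Z) (g : V -> W) c :
  mapc f (mapc g c) = mapc (f \o g) c.
Proof.
elim/(@freeg_ind k): c => [|a c d|u].
- by rewrite !linear0.
- by rewrite !linearP /= => -> ->.
- by rewrite !mapcU map_comp.
Qed.

Lemma eq_mapc (V W : choiceType) (f g : V -> W) P c :
  (forall u, P u -> map f u = map g u) -> supp_in P c -> mapc f c = mapc g c.
Proof. by move=> fg; apply: eq_lin => u /fg ->. Qed.

Lemma mapc_id (V : choiceType) (c : Ch V) : mapc id c = c.
Proof.
rewrite -[RHS]lin_id; apply: (@eq_lin _ _ _ setT) => // u _.
by rewrite map_id.
Qed.

Lemma supp_cone (V : choiceType) (x : V) (P Q : seq V -> Prop) c :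
  (forall u, P u -> Q (x :: u)) -> supp_in P c -> supp_in Q (cone x c).
Proof. by move=> PQ; apply: supp_in_lin => u /PQ; exact: supp_inU. Qed.

Lemma supp_mapc (V W : choiceType) (f : V -> W) (P Q : seq _ -> Prop) c :
  (forall u, P u -> Q (map f u)) -> supp_in P c -> supp_in Q (mapc f c).
Proof. by move=> PQ; apply: supp_in_lin => u /PQ; exact: supp_inU. Qed.

Lemma supp_bd_seq (V : choiceType) (u : seq V) :
  supp_in (fun v => size u = (size v).+1 /\ subseq v u) (bd_seq u).
Proof.
elim: u => [|x u IHu] /=; first exact: supp_in0.
apply: supp_inB; first by apply: supp_inU; split=> //; exact: subseq_cons.
by apply: (supp_cone _ IHu) => v [-> vu]; rewrite eqxx.
Qed.

Lemma supp_bd (V : choiceType) (P Q : seq V -> Prop) c :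
  (forall u v, P u -> size u = (size v).+1 -> subseq v u -> Q v) ->
  supp_in P c -> supp_in Q (bd c).
Proof.
move=> PQ; apply: supp_in_lin => u Pu.
by apply: (supp_inW _ (supp_bd_seq (u := u))) => v [uv vu]; exact: PQ uv vu.
Qed.

(** Unfolded, this is the classical alternating sum of the tuples f x_0, ..., f x_i, g x_i, ..., g
    x_n, degenerate ones included. *)
Fixpoint prism_seq (V W : choiceType) (f g : V -> W) (u : seq V) : Ch W :=
  if u is x :: u' then
    << f x :: g x :: map g u' >> - cone (f x) (prism_seq f g u')
  else 0.

Definition prism (V W : choiceType) (f g : V -> W) : Ch V -> Ch W :=
  lin (prism_seq f g).

HB.instance Definition _ V W f g := GRing.Linear.on (@prism V W f g).

Lemma prism_cone (V W : choiceType) (f g : V -> W) x c :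
  prism f g (cone x c) =
  cone (f x) (cone (g x) (mapc g c)) - cone (f x) (prism f g c).
Proof.
elim/(@freeg_ind k): c => [|a c d|u].
- by rewrite !linear0 ?addr0 ?subr0.
- rewrite !linearP /= => -> ->; apply/eqP/freeg_eqP => y.
  by rewrite !(coeffD, coeffZ, coeffN); ring.
- by rewrite coneU mapcU !coneU /prism !linU.
Qed.

Lemma bd_prism (V W : choiceType) (f g : V -> W) c :
  bd (prism f g c) = mapc g c - mapc f c - prism f g (bd c).
Proof.
elim/(@freeg_ind k): c => [|a c d|u].
- by rewrite !linear0 ?addr0 ?subr0.
- rewrite !linearP /= => -> ->; apply/eqP/freeg_eqP => y.
  by rewrite !(coeffD, coeffZ, coeffN); ring.
- elim: u => [|x u IHu]; first by rewrite
    /prism linU bdU !mapcU /= !linear0 subrr ?addr0 ?subr0.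
  rewrite -coneU prism_cone !mapc_cone linearB /= !bd_cone IHu !linearB /=.
  rewrite prism_cone bd_mapc; apply/eqP/freeg_eqP => y.
  by rewrite !(coeffD, coeffN); ring.
Qed.

End OrderedChains.

(** * Chain homotopies to the identity by cones *)

Section Homotopy.
Context {k : comNzRingType} {V : choiceType}.
Local Notation Ch := {freeg (seq V) / k}.
Variable a : seq V -> Ch.

(** The recursion runs over the faces of [u], which are not subterms of it; [n] is fuel. *)
Fixpoint homot_rec (n : nat) (u : seq V) : Ch :=
  if (n, u) is (n'.+1, x :: _) then
    cone x (<< u >> - a u - lin (homot_rec n') (bd_seq u))
  else 0.

(* The cone construction of a chain homotopy from the identity to [lin a]. *)
Definition homot (u : seq V) : Ch := homot_rec (size u) u.

Lemma homot_cons x u :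
  homot (x :: u) =
  cone x (<< x :: u >> - a (x :: u) - lin homot (bd << x :: u >>)).
Proof.
rewrite [LHS]/homot [LHS]/= bdU; congr (cone x (_ - _)).
by refine (eq_lin _ (supp_bd_seq (u := x :: u))) => v [[->] _].
Qed.

Variable P : seq V -> Prop.
Hypothesis P_sub : forall u v, P u -> subseq v u -> P v.
Hypothesis a_nil : a [::] = << [::] >>.
Hypothesis bd_a : forall u, P u -> bd (a u) = lin a (bd << u >>).

(** A cone fills a chain as soon as the chain is a cycle. By induction on the faces, the boundary of
    [lin homot (bd << u >>)] is [bd << u >> - lin a (bd << u >>)], which cancels the boundary of
    [<< u >> - a u]. No complex occurs here; where the homotopy lives is the matter of
    [supp_homot]. *)
Lemma bd_homot c : supp_in P c ->
  bd (lin homot c) = c - lin a c - lin homot (bd c).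
Proof.
move: c; refine (supp_ind _ _ _) => [|b c d|u].
- by rewrite !linear0 ?addr0 ?subr0.
- rewrite !linearP /= => -> ->; apply/eqP/freeg_eqP => y.
  by rewrite !(coeffD, coeffZ, coeffN); ring.
have [n] := ubnP (size u); elim: n u => [//|n IHn] [_ _|x u].
  by rewrite !linU /homot /= a_nil bdU /= !linear0 subrr ?addr0 ?subr0.
move=> un Pu; rewrite !linU homot_cons bd_cone.
suff -> : bd (<< x :: u >> - a (x :: u) - lin homot (bd << x :: u >>)) = 0.
  by rewrite linear0 subr0.
have bdbd : bd (lin homot (bd << x :: u >>)) =
    bd << x :: u >> - lin a (bd << x :: u >>).
  have Q : supp_in (fun v => P v /\ (size v < n)%N) (bd << x :: u >> : Ch).
    rewrite bdU; apply: (supp_inW _ (supp_bd_seq (u := x :: u))) => v [[us] vu].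
    by split; [exact: P_sub Pu vu|rewrite -us].
  rewrite lin_comp (@eq_lin _ _ _ _ _
    (fun v => << v >> - a v - lin homot (bd << v >>)) _ _ Q); last first.
    by move=> v [Pv vn]; have := IHn _ vn Pv; rewrite !linU.
  have -> (e : Ch) : lin (fun v => << v >> - a v - lin homot (bd << v >>)) e =
      e - lin a e - lin homot (bd e).
    elim/(@freeg_ind k): e => [|b c d|v]; last by rewrite !linU.
      by rewrite !linear0 ?addr0 ?subr0.
    rewrite !linearP /= => -> ->; apply/eqP/freeg_eqP => y.
    by rewrite !(coeffD, coeffZ, coeffN); ring.
  by rewrite bd_bd linear0 subr0.
by rewrite !linearB /= bdbd bd_a// subrr.
Qed.

(** [L u] is a carrier, the set of vertices allowed over [u]: the entries of [u] for the
    subdivision, a bounded neighbourhood of [u] for the push into the Rips complex. *)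
Variable L : seq V -> V -> Prop.
Hypothesis L_self : forall u x, P u -> x \in u -> L u x.
Hypothesis L_sub : forall u v x, P u -> subseq v u -> L v x -> L u x.
Hypothesis a_supp : forall u, P u ->
  supp_in (fun v => size v = size u /\ forall x, x \in v -> L u x) (a u).

Lemma supp_homot u : P u ->
  supp_in (fun v => size v = (size u).+1 /\ forall x, x \in v -> L u x)
    (homot u).
Proof.
have [n] := ubnP (size u); elim: n u => [//|n IHn] [_ _|x u].
  exact: supp_in0.
move=> un Pu; rewrite homot_cons.
apply: (@supp_cone _ _ _
  (fun v => size v = size (x :: u) /\ forall y, y \in v -> L (x :: u) y)).
  move=> v [vu vL]; split; first by rewrite /= vu.
  move=> y; rewrite inE => /orP[/eqP ->|/vL//].
  by apply: L_self => //; exact: mem_head.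
apply: supp_inB; first apply: supp_inB.
- by apply: supp_inU; split=> // y; exact: L_self.
- exact: a_supp.
rewrite bdU; refine (supp_in_lin _ (supp_bd_seq (u := x :: u))) => v [[us] vu].
have Pv : P v by exact: P_sub Pu vu.
have vn : (size v < n)%N by rewrite -us.
apply: (supp_inW _ (IHn _ vn Pv)) => w [-> wL]; split; first by rewrite /= us.
by move=> y /wL; exact: L_sub.
Qed.

End Homotopy.

Section Support.
Context {k : comNzRingType}.

Lemma supp_prism (V W : choiceType) (f g : V -> W) (P Q : seq _ -> Prop)
    (c : {freeg (seq V) / k}) :
  (forall u v, P u -> size v = (size u).+1 ->
    {subset v <= map f u ++ map g u} -> Q v) ->
  supp_in P c -> supp_in Q (prism f g c).
Proof.
move=> PQ; apply: supp_in_lin => u Pu.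
suff : supp_in (fun v => size v = (size u).+1 /\
    {subset v <= map f u ++ map g u}) (prism_seq (k := k) f g u).
  by apply: supp_inW => v [vu vfg]; exact: PQ vu vfg.
elim: u {Pu} => [|x u IHu] /=; first exact: supp_in0.
apply: supp_inB.
  apply: supp_inU; split; first by rewrite /= size_map.
  move=> y; rewrite !(inE, mem_cat).
  by case: (y == f x); case: (y == g x); case: (y \in map g u); rewrite ?orbT.
apply: (supp_cone _ IHu) => v [vu vfg]; split; first by rewrite /= vu.
move=> y; rewrite inE.
case/orP=> [/eqP -> |/vfg]; first by rewrite mem_head.
by rewrite !(inE, mem_cat) => /orP[] ->; rewrite !orbT.
Qed.

Definition del (T : Type) (j : nat) (u : seq T) := take j u ++ drop j.+1 u.

Lemma size_del (T : Type) j (u : seq T) : (j < size u)%N ->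
  size (del j u) = (size u).-1.
Proof.
move=> ju; rewrite size_cat size_drop size_take ju.
by case: (size u) ju => // n jn; rewrite subSS subnKC.
Qed.

Lemma nth_del (T : Type) x0 j (u : seq T) i : (j < size u)%N ->
  nth x0 (del j u) i = nth x0 u (bump j i).
Proof.
move=> ju; rewrite nth_cat size_take ju /bump.
have [ij|ji] := ltnP i j; first by rewrite nth_take.
by rewrite nth_drop addSn subnKC.
Qed.

Lemma bd_seqE (V : choiceType) (u : seq V) :
  bd_seq u = \sum_(j < size u) (-1) ^+ j *: << del j u >> :> {freeg (seq V) / k}.
Proof.
elim: u => [|x u IHu] /=; first by rewrite big_ord0.
rewrite big_ord_recl scale1r /del /= drop0; congr (_ + _).
rewrite IHu linear_sum /= -sumrN; apply: eq_bigr => j _.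
by rewrite linearZ /= coneU exprS mulN1r scaleNr.
Qed.

(** * Alternating functions of ordered chains *)

Variable V : choiceType.

Definition alt_seq n (v : n.-tuple V) (u : seq V) : k :=
  if size u == n then
    \det (\matrix_(a < n, b < n) (tnth v a == nth (tnth v a) u b)%:R)
  else 0.

(* The alternating function of an ordered chain: the value at [v] of the
   oriented simplex [u] is the determinant of the matrix [v_a = u_b]. *)
Definition altc n (c : {freeg (seq V) / k}) (v : n.-tuple V) : k :=
  lin (alt_seq v : seq V -> k^o) c.

Lemma altcU n u (v : n.-tuple V) : altc << u >> v = alt_seq v u.
Proof. by rewrite /altc linU. Qed.

Lemma altc_is_linear n (v : n.-tuple V) a c d :
  altc (a *: c + d) v = a * altc c v + altc d v.
Proof. by rewrite /altc linearP. Qed.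

Lemma altc0 n (v : n.-tuple V) : altc 0 v = 0.
Proof. by rewrite /altc linear0. Qed.

Lemma altcB n (v : n.-tuple V) c d : altc (c - d) v = altc c v - altc d v.
Proof. by rewrite /altc linearB. Qed.

Lemma altc_perm n (p : 'S_n) c (v : n.-tuple V) :
  altc c [tuple tnth v (p i) | i < n] = (-1) ^+ p * altc c v.
Proof.
elim/(@freeg_ind k): c => [|a c d|u]; first by rewrite !altc0 mulr0.
  by rewrite !altc_is_linear => -> ->; rewrite mulrDr mulrCA.
rewrite !altcU /alt_seq; case: eqP => [un|_]; last by rewrite mulr0.
rewrite -det_perm -det_mulmx -row_permE; congr (\det _).
by apply/matrixP=> i j; rewrite !mxE tnth_mktuple.
Qed.

(** A repeated entry of [v] makes two rows of the determinant equal; an entry of one tuple missing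
    from the other makes a row or a column zero. *)
Lemma alt_seq_neq0 n (v : n.-tuple V) u : alt_seq v u != 0 ->
  [/\ size u = n, uniq v & u =i v].
Proof.
rewrite /alt_seq; case: (size u =P n) => [un|_]; last by rewrite eqxx.
have row0 (M : 'M[k]_n) i : (forall j, M i j = 0) -> \det M = 0.
  move=> Mi; rewrite (expand_det_row _ i) big1// => j _.
  by rewrite Mi mul0r.
have col0 (M : 'M[k]_n) j : (forall i, M i j = 0) -> \det M = 0.
  by move=> Mj; rewrite -det_tr; apply: (row0 _ j) => i; rewrite mxE.
move=> D0; split=> //.
- apply/tuple_uniqP => i j vij; apply: contra_neq_eq D0 => ij.
  by apply: (determinant_alternate ij) => b; rewrite !mxE vij.
- move=> x; apply/idP/idP => [xu|/tnthP[i ->]].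
    apply: contra_neqT D0 => xv.
    have ux : (index x u < n)%N by rewrite -un index_mem.
    apply: (col0 _ (Ordinal ux)) => i; rewrite mxE /= (set_nth_default x) ?un//.
    by rewrite nth_index//; case: eqP => // vx; rewrite -vx mem_tnth in xv.
  apply: contra_neqT D0 => vu; apply: (row0 _ i) => j; rewrite mxE.
  by case: eqP => // vj; move: vu; rewrite vj mem_nth// un.
Qed.

Lemma altc_neq0 n (P : seq V -> Prop) c (v : n.-tuple V) :
  supp_in P c -> altc c v != 0 ->
  uniq v /\ exists u, [/\ P u, size u = n & u =i v].
Proof.
move=> Pc; apply: contra_neqP => nv.
rewrite /altc (eq_lin (M := k^o) (F' := fun=> 0) _ Pc).
  by rewrite linE; apply: big1 => u _; rewrite scaler0.
move=> u Pu; apply/eqP; apply: contra_notT nv => uv0.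
by have [un uniqv uv] := alt_seq_neq0 uv0; split=> //; exists u.
Qed.

(** Laplace expansion along the row of [w]: the cofactor of column j is the signed value of the face
    [del j u], and the sum over [w] keeps only w = u_j. *)
Lemma alt_bd_seq n (v : n.-tuple V) (r : seq V) u :
  uniq r -> {subset u <= r} ->
  \sum_(w <- r) alt_seq [tuple of w :: v] u = altc (bd << u >>) v.
Proof.
move=> ur usr; have [un|un] := eqVneq (size u) n.+1; last first.
  rewrite big1 => [|w _]; last by rewrite /alt_seq (negbTE un).
  rewrite bdU bd_seqE /altc linear_sum big1// => j _.
  rewrite linearZ /= linU /alt_seq size_del//.
  case: eqP => [uj|_]; last by rewrite scaler0.
  by case/eqP: un; rewrite -uj prednK//; case: (size u) j => // -[].
case: u un usr => [//|x0 u0] un; set u := x0 :: u0 => usr.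
have bump_u (j : 'I_n.+1) (b : 'I_n) : (bump j b < size u)%N.
  rewrite un ltnS /bump; case: (j <= b)%N; rewrite ?add1n ?add0n//.
  exact: ltnW.
pose A (j : 'I_n.+1) : k :=
  \det (\matrix_(a < n, b < n) (tnth v a == nth x0 u (bump j b))%:R).
transitivity (\sum_(w <- r) \sum_(j < n.+1)
    (w == nth x0 u j)%:R * ((-1) ^+ j * A j)).
  apply: eq_bigr => w _; rewrite /alt_seq un eqxx (expand_det_row _ ord0).
  apply: eq_bigr => j _; rewrite mxE (tnth_nth x0) /=.
  rewrite (set_nth_default x0) ?un//; congr (_ * _).
  rewrite /cofactor add0n; congr (_ * \det _); apply/matrixP => a b.
  rewrite !mxE (tnth_nth x0) /= -(tnth_nth x0).
  by congr (_ == _)%:R; apply: set_nth_default; exact: bump_u.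
rewrite exchange_big /= bdU bd_seqE /altc linear_sum.
rewrite -(big_mkord xpredT (fun j => altc ((-1) ^+ j *: << del j u >>) v)).
rewrite un big_mkord; apply: eq_bigr => j _.
have ju : (j < size u)%N by rewrite un.
rewrite (bigD1_seq (nth x0 u j))//=; last exact/usr/mem_nth.
rewrite eqxx mul1r big1 ?addr0 => [|w /negbTE ->]; last by rewrite mul0r.
rewrite /altc linearZ /= linU /alt_seq size_del// un eqxx; congr (_ * \det _).
apply/matrixP => a b; rewrite !mxE nth_del//; congr (_ == _)%:R.
by apply: set_nth_default; exact: bump_u.
Qed.

Lemma sum_altc n (v : n.-tuple V) (r : seq V) (c : {freeg (seq V) / k}) :
  uniq r -> (forall u : seq V, u \in dom c -> {subset u <= r}) ->
  \sum_(w <- r) altc c [tuple of w :: v] = altc (bd c) v.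
Proof.
move=> ur usr; have: supp_in (fun u : seq V => {subset u <= r}) c.
  by move=> u; rewrite -mem_dom => /usr.
move: c {usr}; refine (supp_ind _ _ _) => [|a c d|u usr].
- by rewrite linear0 altc0 big1// => w _; rewrite altc0.
- move=> IHc IHd; rewrite linearP altc_is_linear -IHc -IHd mulr_sumr.
  rewrite -big_split /=.
  by apply: eq_bigr => w _; rewrite altc_is_linear.
by rewrite -(alt_bd_seq _ ur usr); apply: eq_bigr => w _; rewrite altcU.
Qed.

Lemma chain_bd_altc q (c : {freeg (seq V) / k}) :
  chain_bd (@altc q.+2 c) = altc (bd c).
Proof.
apply/funext => v; pose r := undup (flatten (dom c)).
rewrite -(@sum_altc _ v r) ?undup_uniq//; last first.
  by move=> u uc x xu; rewrite mem_undup; apply/flattenP; exists u.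
rewrite /chain_bd (fsbigTE [fset w in r]%fset); last first.
  move=> w; rewrite !inE mem_undup => wr; apply: contraNeq wr => cw.
  have [_ [u [uc _ uv]]] := altc_neq0 (@supp_in_dom _ _ c) cw.
  by apply/flattenP; exists u => //; rewrite uv mem_head.
apply: perm_big; apply: uniq_perm; rewrite ?undup_uniq ?fset_uniq//.
by move=> w; rewrite !inE.
Qed.

(** A sorted tuple is determined by its set of entries, so the only sorted [u] with a nonzero
    determinant is [v] itself, with the identity matrix. *)
Lemma altc_sorted n (lt : rel V) (c : {freeg (seq V) / k}) (v : n.-tuple V) :
  transitive lt -> irreflexive lt -> supp_in (sorted lt) c -> sorted lt v ->
  altc c v = coeff (tval v) c.
Proof.
move=> ltT ltI sc sv; move: c sc; refine (supp_ind _ _ _) => [|a c d|u su].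
- by rewrite altc0 coeff0.
- by rewrite altc_is_linear coeffD coeffZ => -> ->.
rewrite altcU coeffU mul1r; case: eqP => [->|uv]; last first.
  apply/eqP; apply: contra_notT uv => /alt_seq_neq0[_ _ uv].
  exact: (irr_sorted_eq ltT ltI su sv uv).
rewrite /alt_seq size_tuple eqxx (_ : \matrix_(a, b) _ = 1%:M) ?det1//.
apply/matrixP => a b; rewrite !mxE -tnth_nth; congr (_%:R).
have /tuple_uniqP vI : uniq v by exact: (sorted_uniq ltT ltI sv).
by rewrite (inj_eq vI).
Qed.

End Support.

(** * Small chains in the standard simplex *)

Section Steps.
Context {k : comNzRingType}.

(** Each prism joins two consecutive stages only, so its tuples can be kept small however far the
    whole homotopy moves. *)
Lemma prism_steps (V W : choiceType) (h : nat -> V -> W) (N : nat)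
    (Q : seq W -> Prop) (c : {freeg (seq V) / k}) :
  bd c = 0 ->
  (forall j, (j < N)%N -> supp_in Q (prism (h j) (h j.+1) c)) ->
  exists2 d, supp_in Q d & bd d = mapc (h N) c - mapc (h 0%N) c.
Proof.
move=> bc; elim: N => [|N IHN] hQ.
  by exists 0; [exact: supp_in0|rewrite linear0 subrr].
have [j jN|d dQ bd_d] := IHN; first by apply: hQ; exact: ltnW.
exists (d + prism (h N) (h N.+1) c); first by apply: supp_inD => //; exact: hQ.
rewrite linearD /= bd_d bd_prism bc linear0 subr0.
by rewrite [LHS]addrC addrA subrK.
Qed.

(** Carries [bd_bd] from the tuple 0, ..., q+1 to any family that depends only on which two entries
    are deleted; it stands in for the simplicial identities. *)
Lemma sum_del_del q (M : lmodType k) (F : 'I_q.+2 -> 'I_q.+1 -> M) :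
  (forall (j j' : 'I_q.+2) (l l' : 'I_q.+1), del l (del j (iota 0 q.+2)) =
     del l' (del j' (iota 0 q.+2)) -> F j l = F j' l') ->
  \sum_(j < q.+2) \sum_(l < q.+1) (-1) ^+ (j + l) *: F j l = 0.
Proof.
move=> Fdel; pose key (jl : 'I_q.+2 * 'I_q.+1) :=
  del jl.2 (del jl.1 (iota 0 q.+2)).
pose H (w : seq nat) : M :=
  if [pick jl | key jl == w] is Some jl then F jl.1 jl.2 else 0.
have HF j l : H (key (j, l)) = F j l.
  rewrite /H; case: pickP => [[j' l'] /eqP /Fdel //|/(_ (j, l))].
  by rewrite eqxx.
have := bd_bd (<< iota 0 q.+2 >> : {freeg (seq nat) / k}).
rewrite bdU bd_seqE linear_sum => /(congr1 (lin H)).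
rewrite linear0 => {}H0; rewrite -[RHS]H0 linear_sum size_iota.
apply: eq_bigr => j _; rewrite linearZ /= bdU bd_seqE linearZ /=.
have sd : size (del j (iota 0 q.+2)) = q.+1 by rewrite size_del size_iota.
rewrite linear_sum scaler_sumr sd.
by apply: eq_bigr => l _; rewrite linearZ /= linU scalerA -exprD -HF.
Qed.

End Steps.

Section StdSimplex.
Context {R : realType} {k : comNzRingType}.
Local Notation D q := (@std_simplex R q).

Lemma slack (r : seq R) e : (forall x, x \in r -> x < e) ->
  exists2 e', e' < e & forall x, x \in r -> x < e'.
Proof.
elim: r => [|x r IHr] re; first by exists (e - 1) => //; lra.
have [y yr|e' e'e re'] := IHr; first by apply: re; rewrite inE yr orbT.
have xe : x < e by apply: re; exact: mem_head.
exists (Num.max e' ((x + e) / 2)); first by rewrite gt_max e'e; lra.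
move=> y; rewrite inE lt_max => /orP[/eqP ->|/re' -> //].
by apply/orP; right; lra.
Qed.

Definition close q (e : R) (x y : D q) : Prop :=
  forall i, `|\val x 0 i - \val y 0 i| < e.

Definition small q (e : R) (u : seq (D q)) : Prop :=
  forall x y, x \in u -> y \in u -> close e x y.

Lemma closexx q e (x : D q) : 0 < e -> close e x x.
Proof. by move=> e0 i; rewrite subrr normr0. Qed.

Lemma std_ge0 q (x : D q) i : 0 <= \val x 0 i.
Proof. by have [] := set_mem (valP x). Qed.

Lemma std_sum q (x : D q) : \sum_i \val x 0 i = 1.
Proof. by have [] := set_mem (valP x). Qed.

Lemma std_le1 q (x : D q) i : \val x 0 i <= 1.
Proof.
rewrite -(std_sum x) (bigD1 i)//= lerDl; apply: sumr_ge0 => j _.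
exact: std_ge0.
Qed.

Definition line q (p : D q) (s : R) (x : D q) : D q :=
  insubd x ((1 - s) *: \val x + s *: \val p).

Lemma val_line q (p : D q) s x : 0 <= s <= 1 ->
  \val (line p s x) = (1 - s) *: \val x + s *: \val p.
Proof.
move=> /andP[s0 s1]; rewrite /line val_insubd ifT//; apply/mem_set; split.
  move=> i; rewrite !mxE addr_ge0// mulr_ge0 ?std_ge0//; lra.
under eq_bigr do rewrite !mxE.
by rewrite big_split /= -!mulr_sumr !std_sum; lra.
Qed.

Lemma line0 q (p x : D q) : line p 0 x = x.
Proof.
apply: val_inj; rewrite val_line; last by rewrite lexx ler01.
by rewrite subr0 scale1r scale0r addr0.
Qed.

Lemma line1 q (p x : D q) : line p 1 x = p.
Proof.
apply: val_inj; rewrite val_line; last by rewrite lexx ler01.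
by rewrite subrr scale1r scale0r add0r.
Qed.

Lemma line_close q (p x y : D q) s s' e e' : 0 <= s <= 1 -> 0 <= s' <= 1 ->
  `|s - s'| <= e' -> close e x y -> close (e + e') (line p s x) (line p s' y).
Proof.
move=> s01 s'01 ss' xy i; rewrite !val_line// !mxE.
have -> : (1 - s) * \val x 0 i + s * \val p 0 i -
    ((1 - s') * \val y 0 i + s' * \val p 0 i) =
  (1 - s) * (\val x 0 i - \val y 0 i) + (s - s') * (\val p 0 i - \val y 0 i).
  by ring.
apply: (le_lt_trans (ler_normD _ _)); rewrite !normrM ltr_leD//.
  apply: le_lt_trans (xy i); rewrite ler_piMl//.
  by case/andP: s01 => ? ?; rewrite ger0_norm; lra.
rewrite -[e']mulr1 ler_pM// ler_norml.
have := std_ge0 p i; have := std_le1 p i; have := std_ge0 y i.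
have := std_le1 y i; lra.
Qed.

(* The straight line contraction to a vertex, cut into steps so short that no
   prism is larger than [e]. *)
Lemma small_acyclic q e n (c : {freeg (seq (D q)) / k}) : 0 < e ->
  supp_in (fun u => small e u /\ size u = n) c -> bd c = 0 ->
  exists2 d : {freeg (seq (D q)) / k},
    supp_in (fun u => small e u /\ size u = n.+1) d & bd d = c.
Proof.
move=> e0 cs bc.
have p0 : (delta_mx 0 0 : 'rV[R]_q.+1) \in @std_simplex R q.
  apply/mem_set; split; first by move=> i; rewrite mxE ler0n.
  rewrite (bigD1 0)//= mxE eqxx big1 ?addr0// => i /negbTE i0.
  by rewrite mxE i0 andbF.
pose p : D q := exist (fun y => y \in @std_simplex R q) _ p0.
pose dst (t : (D q * D q) * 'I_q.+1) : R :=
  `|\val t.1.1 0 t.2 - \val t.1.2 0 t.2|.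
pose r := [seq dst t | t <- 
  flatten [seq [seq (xy, i) | xy <- [seq (x, y) | x <- u, y <- u],
                              i <- enum 'I_q.+1] | u <- dom c]].
have rP (u : seq (D q)) x y i : u \in dom c -> x \in u -> y \in u ->
    `|\val x 0 i - \val y 0 i| \in r.
  move=> uc xu yu; apply/mapP; exists ((x, y), i) => //.
  apply/flattenP; exists [seq (xy, i) | xy <- [seq (x, y) | x <- u, y <- u],
    i <- enum 'I_q.+1]; first exact: map_f.
  apply/allpairsP; exists ((x, y), i); split=> //=; last by rewrite mem_enum.
  by apply/allpairsP; exists (x, y).
have re z : z \in r -> z < e.
  move=> /mapP[[[x y] i] /flattenP[l /mapP[u uc ->]]].
  move=> /allpairsP[[[x' y'] i'] /= [/allpairsP[[x2 y2] /= [xu yu [-> ->]]] _]].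
  move=> [-> -> ->] ->; rewrite mem_dom in uc.
  by have [us _] := cs _ uc; exact: us.
have [e' e'e re'] := slack re.
(* By [slack] the tuples of [c] are smaller than some e' < e; steps of length 1/N below e - e' use
   up only the margin. *)
pose N := (Num.truncn (1 / (e - e'))).+1.
have N0 : 0 < N%:R :> R by rewrite ltr0n.
have N1 : N%:R^-1 < e - e'.
  rewrite -[X in X < _]div1r ltr_pdivrMr// mulrC -ltr_pdivrMr ?subr_gt0//.
  exact: truncnS_gt.
pose h j := line p (j%:R / N%:R).
have h01 j : (j <= N)%N -> 0 <= (j%:R / N%:R : R) <= 1.
  by move=> jN; rewrite divr_ge0//= ler_pdivrMr// mul1r ler_nat.
have step j : (j < N)%N ->
    supp_in (fun u => small e u /\ size u = n.+1) (prism (h j) (h j.+1) c).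
  move=> jN; 
  apply: (@supp_prism _ _ _ _ _ (fun u : seq (D q) => u \in dom c /\ size u = n)).
    move=> u v [uc un] -> vhh; split; last by rewrite un.
    have hh x : x \in v -> exists2 j', (j <= j' <= j.+1)%N &
        exists2 y, y \in u & x = h j' y.
      move/vhh; rewrite mem_cat => /orP[] /mapP[y yu ->].
        by exists j; rewrite ?leqnSn ?leqnn//; exists y.
      by exists j.+1; rewrite ?leqnSn ?leqnn//; exists y.
    move=> x y /hh[a /andP[ja aj] [x' xu ->]] /hh[b /andP[jb bj] [y' yu ->]].
    rewrite (_ : e = e' + (e - e')); last by ring.
    apply: line_close.
    - by apply: h01; apply: leq_trans aj _.
    - by apply: h01; apply: leq_trans bj _.
    - rewrite -mulrBl normrM (ger0_norm (_ : 0 <= N%:R^-1)) ?invr_ge0//.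
      apply: le_trans (ltW N1); rewrite ler_piMl ?invr_ge0//.
      rewrite ler_norml; move: ja aj jb bj; rewrite -!(ler_nat R) -natr1; lra.
    - by move=> i; apply: re'; exact: (rP u).
  by move=> u uc; rewrite mem_dom uc; have [] := cs _ uc.
have [d ds bd_d] := prism_steps bc step.
(* At the last stage all points equal [p], so the cone from [p] is small; [d] connects this stage
   with [c] at stage 0. *)
exists (cone p (mapc (h N) c) - d); last first.
  rewrite linearB /= bd_cone bd_mapc bc !linear0 ?addr0 ?subr0 bd_d.
  rewrite (@eq_mapc _ _ _ (h 0%N) id setT) ?mapc_id; last 2 first.
  - by move=> u _; apply: eq_map => x; rewrite /h mul0r line0.
  - by [].
  by rewrite opprB addrC subrK.
apply: supp_inB => //.
apply: (@supp_cone _ _ _ (fun u => size u = n /\ forall x, x \in u -> x = p)).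
  move=> u [un up]; split=> [x y|]; last by rewrite /= un.
  have pp z : z \in p :: u -> z = p by rewrite inE => /orP[/eqP|/up].
  by move=> /pp -> /pp ->; exact: closexx.
apply: (@supp_mapc _ _ _ _ (fun u => size u = n)).
  move=> u un; split=> [|x /mapP[y _ ->]]; first by rewrite size_map.
  by rewrite /h divff ?line1// gt_eqF.
by apply: supp_inW cs => u [].
Qed.

Lemma small_face q (j : 'I_q.+2) e (u : seq (D q)) : 0 < e ->
  small e u -> small e (map (face_map j) u).
Proof.
move=> e0 us x y /mapP[x' xu ->] /mapP[y' yu ->] i /=; rewrite !mxE.
case: unliftP => [l _|_]; last by rewrite subrr normr0.
exact: us.
Qed.

Section Bary.
Context {V : choiceType}.

(* The coordinates of the point with barycentric coordinates [x] in the
   (possibly degenerate) simplex with vertices [u]. *)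
Definition bary q (u : seq V) (x : D q) (v : V) : R :=
  \sum_(b < q.+1) (onth u b == Some v)%:R * \val x 0 b.

Lemma bary_face q (u : seq V) (j : 'I_q.+2) (x : D q) v : size u = q.+2 ->
  bary u (face_map j x) v = bary (del j u) x v.
Proof.
move=> uq; rewrite /bary (bigD1_ord j)//= mxE unlift_none mulr0 add0r.
apply: eq_bigr => b _; rewrite mxE liftK.
rewrite !onthE -(nth_del _ (u := map Some u)) ?size_map ?uq//.
by rewrite /del map_cat map_take map_drop.
Qed.

End Bary.

Lemma bary_iota q (x : D q) (i : 'I_q.+1) :
  bary (iota 0 q.+1) x (i : nat) = \val x 0 i.
Proof.
rewrite /bary (bigD1 i)// big1 ?addr0 => [|j ji].
  by rewrite onthE (nth_map 0%N) ?size_iota// nth_iota// add0n eqxx mul1r /= addr0.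
rewrite onthE (nth_map 0%N) ?size_iota// nth_iota// add0n.
by case: eqP => [[/val_inj/eqP]|_]; [rewrite (negbTE ji)|rewrite mul0r].
Qed.

Lemma face_face q (j j' : 'I_q.+3) (l l' : 'I_q.+2) :
  del l (del j (iota 0 q.+3)) = del l' (del j' (iota 0 q.+3)) ->
  face_map j \o face_map l = face_map j' \o face_map l' :> (D q -> D q.+2).
Proof.
move=> del_eq; apply/funext => x; apply: val_inj; apply/rowP => i.
rewrite -[LHS]bary_iota -[RHS]bary_iota !bary_face ?del_eq//;
  by rewrite ?size_del size_iota.
Qed.

Variable e : R.
Hypothesis e0 : 0 < e.

(** The second clause is what the next dimension asks for: the assembled faces must form a cycle to
    be filled. *)
Definition fund_good q (c : {freeg (seq (D q)) / k}) : Prop :=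
  supp_in (fun u => small e u /\ size u = q.+1) c /\
  bd (\sum_(j < q.+2) (-1) ^+ j *: mapc (face_map j) c) = 0.

Lemma supp_faces q (c : {freeg (seq (D q)) / k}) n :
  supp_in (fun u => small e u /\ size u = n) c ->
  supp_in (fun u => small e u /\ size u = n)
    (\sum_(j < q.+2) (-1) ^+ j *: mapc (face_map j) c).
Proof.
move=> cs; apply: supp_in_sum => j; apply: supp_inZ; apply: supp_mapc cs.
by move=> u [us un]; split; [exact: small_face|rewrite size_map].
Qed.

Lemma fund_step q (c : {freeg (seq (D q)) / k}) : fund_good c ->
  exists c' : {freeg (seq (D q.+1)) / k}, fund_good c' /\
    bd c' = \sum_(j < q.+2) (-1) ^+ j *: mapc (face_map j) c.
Proof.
move=> [cs bc]; have [c' c's bc'] := small_acyclic e0 (supp_faces cs) bc.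
exists c'; split=> //; split=> //; rewrite linear_sum /=.
pose F (j : 'I_q.+3) (l : 'I_q.+2) := mapc (face_map j \o face_map l) c.
rewrite -[RHS](@sum_del_del k q.+1 _ F); last first.
  by move=> j l j' l' /face_face; rewrite /F => ->.
apply: eq_bigr => j _; rewrite linearZ /= bd_mapc bc' linear_sum /= scaler_sumr.
by apply: eq_bigr => l _; rewrite linearZ /= scalerA -exprD mapc_comp.
Qed.

Lemma fund_base : exists c : {freeg (seq (D 0)) / k}, fund_good c /\
  bd c = << [::] >>.
Proof.
have p0 : (const_mx 1 : 'rV[R]_1) \in @std_simplex R 0.
  apply/mem_set; split; first by move=> i; rewrite mxE ler01.
  by rewrite big_ord1 mxE.
pose p : D 0 := exist (fun y => y \in @std_simplex R 0) _ p0.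
exists << [:: p] >>; have bp : bd << [:: p] >> = << [::] >> :> {freeg (seq (D 0)) / k}.
  by rewrite bdU /= linear0 subr0.
split=> //; split.
  apply: supp_inU; split=> // x y; rewrite !inE => /eqP -> /eqP ->.
  exact: closexx.
rewrite linear_sum /= big_ord_recl big_ord1 !linearZ /= !bd_mapc bp !mapcU /=.
by rewrite scale1r expr1 scaleN1r subrr.
Qed.

Fixpoint fund_sig q : {c : {freeg (seq (D q)) / k} | fund_good c} :=
  match q with
  | 0 => let: exist c cP := cid fund_base in exist _ c cP.1
  | p.+1 => let: exist c cP := fund_sig p in
            let: exist c' c'P := cid (fund_step cP) in exist _ c' c'P.1
  end.

(* A subdivision of the standard simplex into small simplices, compatible with
   its faces. *)
Definition fund q := sval (fund_sig q).

Lemma supp_fund q : supp_in (fun u => small e u /\ size u = q.+1) (fund q).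
Proof. by have [] := svalP (fund_sig q). Qed.

Lemma bd_fund0 : bd (fund 0) = << [::] >>.
Proof. by rewrite /fund /=; case: (cid _) => c []. Qed.

Lemma bd_fundS q :
  bd (fund q.+1) = \sum_(j < q.+2) (-1) ^+ j *: mapc (face_map j) (fund q).
Proof. by rewrite /fund /=; case: (fund_sig q) => c cP; case: (cid _) => c' []. Qed.

End StdSimplex.

(** * The realization of a simplicial complex *)

Section StdSimplexTopology.
Context {R : realType}.
Local Notation D q := (@std_simplex R q).

Lemma box_nbhs q (x : D q) (B : set (D q)) :
  nbhs x B <-> exists2 e : R, 0 < e & forall y, close e x y -> B y.
Proof.
have xF : Filter (nbhs (\val x : 'rV[R]_q.+1)) by exact: nbhs_filter.
split=> [|[e e0 eB]].
  rewrite nbhsE => -[U [[W oW WU] Ux] UB]; rewrite -WU in Ux.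
  have /(@nbhs_ballP R)[e e0 eW] : nbhs (\val x : 'rV[R]_q.+1) W.
    by apply: open_nbhs_nbhs; split.
  exists e => // y xy; apply: UB; rewrite -WU; apply: eW.
  by split=> // i j; rewrite ord1; exact: xy.
have vc : set_val @ x --> (\val x : 'rV[R]_q.+1) by exact: initial_continuous.
have xb := vc _ (nbhsx_ballx (\val x : 'rV[R]_q.+1) e e0).
have {}xb : nbhs x (set_val @^-1` ball (\val x : 'rV[R]_q.+1) e) by exact: xb.
by move: xb; apply: filterS => y [_ xy]; apply: eB => i; exact: xy.
Qed.

Lemma near_close q (x : D q) e : 0 < e -> \forall y \near x, close e x y.
Proof. by move=> e0; apply/box_nbhs; exists e. Qed.

Lemma std_simplex_closed q : closed (@std_simplex R q).
Proof.
rewrite (_ : @std_simplex R q =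
    (\bigcap_(i in [set: 'I_q.+1]) [set x | 0 <= x 0 i]) `&`
    [set x | \sum_i x 0 i = 1]); last first.
  apply/seteqP; split=> x [x0 x1]; split=> // i; last exact: (x0 i I).
  by move=> _; exact: x0.
apply: closedI.
  apply: closed_bigI => i _.
  apply: (@preimage_closed _ _ (fun x : 'rV[R]_q.+1 => x 0 i) [set y | 0 <= y]).
    by move=> x _; exact: coord_continuous.
  exact: closed_ge.
apply: (@preimage_closed _ _ (fun x : 'rV[R]_q.+1 => \sum_i x 0 i) [set y | y = 1]).
  have sc := @continuous_big R 'I_q.+1 +%R 0 xpredT (@add_continuous R) _
    (index_enum _) (fun i (x : 'rV[R]_q.+1) => x 0 i)
    (fun i _ => @coord_continuous _ _ _ 0 i).
  by move=> x _; exact: sc.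
exact: closed_eq.
Qed.

Lemma std_simplex_compact q : compact (@std_simplex R q).
Proof.
have box := @rV_compact R q.+1 (fun=> `[0, 1]%classic) (fun=> @segment_compact R 0 1).
apply: subclosed_compact (@std_simplex_closed q) box _ => x Dx i /=.
rewrite in_itv /=.
have := std_ge0 (exist (fun y => y \in @std_simplex R q) x (mem_set Dx)) i.
by have /= -> := std_le1 (exist (fun y => y \in @std_simplex R q) x (mem_set Dx)) i => ->.
Qed.

Lemma std_type_compact q : compact [set: D q].
Proof.
move=> F FF _.
have [|p [Dp pF]] := @std_simplex_compact q (fmap (set_val : D q -> _) F) _.
  have FDq : F (set_val @^-1` @std_simplex R q).
    by apply: filterE => x; exact: set_mem (valP x).
  exact: FDq.
pose x : D q := exist (fun y => y \in @std_simplex R q) p (mem_set Dp).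
exists x; split=> // A B FA /box_nbhs[e e0 eB].
have [||y [[a Aa <-] pa]] := pF (set_val @` A) (ball p e).
- have FA' : F (set_val @^-1` (set_val @` A)).
    by apply: filterS FA => a Aa; exists a.
  exact: FA'.
- exact: nbhsx_ballx.
by exists a; split=> //; apply: eB => i; case: pa => _; apply.
Qed.

End StdSimplexTopology.

Section Realization.
Context {R : realType} {V : choiceType} (K : simplicial_complex V).
Local Notation D q := (@std_simplex R q).
Local Notation X := (realization R K).

(** Entries may repeat: degenerate tuples appear as soon as a chain is contracted to a vertex or
    rounded by [nu]. *)
Definition spx (u : seq V) : Prop := K [fset x in u]%fset.

Lemma spx_sub (u v : seq V) : spx u -> {subset v <= u} -> v != [::] -> spx v.
Proof.
move=> Ku vu v0; apply: simplexS Ku _ _.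
  by apply/fsubsetP => x; rewrite !inE => /vu.
by case: v v0 {vu} => // x v _; apply/fset0Pn; exists x; rewrite !inE eqxx.
Qed.

Lemma realizationP (a b : X) : (forall v, a v = b v) -> a = b.
Proof.
case: a b => [a a0 a1 aK] [b b0 b1 bK] /= ab.
have {}ab : a = b by apply/fsfunP.
by case: _ / ab b0 b1 bK => *; congr Point; exact: Prop_irrelevance.
Qed.

Lemma bary_ge0 q u (x : D q) (v : V) : 0 <= bary u x v.
Proof. by apply: sumr_ge0 => b _; rewrite mulr_ge0 ?ler0n ?std_ge0. Qed.

Lemma bary_out q u (x : D q) (v : V) : v \notin u -> bary u x v = 0.
Proof.
move=> vu; rewrite /bary big1// => b _.
by have /onthPn/(_ b)/negbTE -> := vu; rewrite mul0r.
Qed.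

Lemma bary_sum q u (x : D q) (r : seq V) : size u = q.+1 -> uniq r ->
  {subset u <= r} -> \sum_(v <- r) bary u x v = 1.
Proof.
move=> uq ur usr; rewrite -(std_sum x) /bary exchange_big /=.
apply: eq_bigr => b _; have bu : (b < size u)%N by rewrite uq.
case: u {uq} bu usr => [//|v0 u'] bu usr; set u := v0 :: u' in bu usr *.
have ub : onth u b = Some (nth v0 u b) by rewrite onthE (nth_map v0).
rewrite (bigD1_seq (nth v0 u b))//= ?usr ?mem_nth// ub eqxx mul1r big1 ?addr0//.
by move=> v /negbTE vb; case: eqP => [[/eqP]|]; rewrite ?mul0r// eq_sym vb.
Qed.

Section Aff.
Variables (q : nat) (u : seq V).
Hypotheses (uq : size u = q.+1) (uK : spx u).

Definition aff_coord (x : D q) : {fsfun V -> R with 0} :=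
  [fsfun v in [fset y in u]%fset => bary u x v].

Lemma aff_coordE x v : aff_coord x v = bary u x v.
Proof.
rewrite fsfunE !inE; case: ifPn => // vu.
by rewrite bary_out.
Qed.

Lemma aff_finsupp x : {subset finsupp (aff_coord x) <= u}.
Proof.
move=> v; rewrite mem_finsupp aff_coordE.
by apply: contra_neqT => vu; rewrite bary_out.
Qed.

Lemma aff_ge0 x v : 0 <= aff_coord x v.
Proof. by rewrite aff_coordE bary_ge0. Qed.

Lemma aff_sum x : \sum_(v <- finsupp (aff_coord x)) aff_coord x v = 1.
Proof.
rewrite -(@bary_sum q u x (undup u)) ?undup_uniq// => [|v]; last first.
  by rewrite mem_undup.
rewrite [RHS](bigID (mem (finsupp (aff_coord x))))/= [X in _ + X]big1 ?addr0.
  rewrite -[RHS]big_filter; under eq_bigr do rewrite aff_coordE.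
  apply: perm_big; apply: uniq_perm; rewrite ?fset_uniq ?filter_uniq ?undup_uniq//.
  move=> v; rewrite mem_filter mem_undup.
  by case: (boolP (v \in finsupp _)) => // /aff_finsupp ->.
by move=> v; rewrite memNfinsupp aff_coordE => /eqP.
Qed.

Lemma aff_supp x : K (finsupp (aff_coord x)).
Proof.
apply: simplexS uK _ _.
  by apply/fsubsetP => v /aff_finsupp; rewrite !inE.
apply/eqP => s0; have := aff_sum x; rewrite s0 big_seq_fset0.
by move=> /esym/eqP; rewrite oner_eq0.
Qed.

Definition aff (x : D q) : X := Point (@aff_ge0 x) (@aff_sum x) (@aff_supp x).

Lemma affE x v : aff x v = bary u x v.
Proof. exact: aff_coordE. Qed.

End Aff.

Section Continuity.

(** On one closed simplex only finitely many coordinates matter, and [slack] leaves a common margin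
    there, which is what the weak topology asks. *)
Lemma sup_near (a : X) (e : R) : 0 < e ->
  nbhs a [set b : X | forall v, `|a v - b v| < e].
Proof.
move=> e0; pose U : set X := [set b : X | forall v, `|a v - b v| < e].
suff oU : open U by apply: (@open_nbhs_nbhs _ a U); split=> // v; rewrite subrr normr0.
move=> s b Ks sb Ub.
pose r := [seq `|a v - b v| | v <- finsupp a ++ s].
have [x /mapP[v _ ->]//|e' e'e re'] := @slack R r e.
exists (e - e') => [|c sc bc v]; first by rewrite subr_gt0.
have [vs|] := boolP (v \in finsupp a ++ s).
  rewrite -(subrK (b v) (a v)) -addrA; apply: (le_lt_trans (ler_normD _ _)).
  rewrite (_ : e = e' + (e - e')); last by ring.
  by rewrite ltrD ?bc//; apply: re'; apply/mapP; exists v.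
rewrite mem_cat negb_or => /andP[/fsfun_dflt -> vs].
by rewrite fsfun_dflt ?subrr ?normr0//; apply: contra vs => /(fsubsetP sc).
Qed.

Lemma aff_continuous q u uq uK : continuous (@aff q u uq uK).
Proof.
apply/continuousP => A oA; rewrite openE => x Ax /=; apply/box_nbhs.
have [|e e0 eA] := oA _ (aff uq uK x) uK _ Ax.
  by apply/fsubsetP => v /aff_finsupp; rewrite !inE.
exists (e / q.+1%:R) => [|y xy]; first by rewrite divr_gt0.
apply: eA => [|v]; first by apply/fsubsetP => v /aff_finsupp; rewrite !inE.
rewrite !affE /bary -sumrB; apply: (le_lt_trans (ler_norm_sum _ _ _)).
have -> : e = \sum_(b < q.+1) e / q.+1%:R.
  by rewrite sumr_const card_ord -[RHS]mulr_natr divfK.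
apply: ltr_sum => [|b _]; first by apply/hasP; exists ord0; rewrite ?mem_index_enum.
rewrite -mulrBr normrM; apply: le_lt_trans (xy b); rewrite ler_piMl//.
by case: (_ == _); rewrite ?normr1 ?normr0.
Qed.

(** Heine's argument by a near covering of the compact domain. The realization carries no metric
    here; by [sup_near] its topology controls the sup distance of coordinates. *)
Lemma unif_continuous q (F : D q * R -> X) (e : R) : 0 < e ->
  {within [set: D q] `*` `[0, 1], continuous F} ->
  exists2 d : R, 0 < d & forall (x y : D q) (s t : R),
    0 <= s <= 1 -> 0 <= t <= 1 -> close d x y -> `|s - t| < d ->
    forall v, `|F (x, s) v - F (y, t) v| < e.
Proof.
move=> e0 Fc; set A : set (D q * R) := [set: D q] `*` `[0, 1].
have cA : compact A.
  by apply: compact_setX; [exact: std_type_compact|exact: segment_compact].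
pose P (d : R) (p : D q * R) := A p -> forall p', A p' ->
  close d p.1 p'.1 -> `|p.2 - p'.2| < d -> forall v, `|F p v - F p' v| < e.
have e20 : 0 < e / 2 by rewrite divr_gt0.
have /compact_near_coveringP/(_ R 0^'+ P _) near_P : compact A by [].
have : \forall d \near 0^'+, A `<=` P d.
  apply: near_P => -[x s] Axs.
  have := sup_near (F (x, s)) e20.
  have /subspace_continuousP/(_ _ Axs) Fxs := Fc.
  move=> /Fxs[[B C] /= [xB sC] BC].
  have /box_nbhs[d1 d10 d1B] := xB; have /nbhs_ballP[d2 d20 d2C] := sC.
  (* Halved, so that a point within d of a point within d of the centre still lies in the
     neighbourhood. *)
  pose d := Num.min d1 d2 / 2.
  have d0 : 0 < d by rewrite divr_gt0// lt_min d10.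
  have dd1 : d + d <= d1 by rewrite -splitr ge_min lexx.
  have dd2 : d + d <= d2 by rewrite -splitr ge_min lexx orbT.
  have near_xs : forall y t, A (y, t) -> close (d + d) x y -> `|s - t| < d + d ->
      forall v, `|F (x, s) v - F (y, t) v| < e / 2.
    move=> y t Ayt xy st; apply: (BC (y, t)) => //; split=> /=.
      by apply: d1B => i; apply: lt_le_trans (xy i) _.
    by apply: d2C; apply: lt_le_trans st _.
  exists ([set yt | close d x yt.1 /\ `|s - yt.2| < d], [set d' | d' < d]).
    split=> /=; last exact: nbhs_right_lt.
    exists ([set y | close d x y], [set t | `|s - t| < d]) => //=.
    by split; [exact: near_close|apply/nbhs_ballP; exists d].
  move=> [[y t] d'] /= [[xy st] d'd] Ayt [z r] Azr /= yz tr v.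
  rewrite -(subrK (F (x, s) v) (F (y, t) v)) -addrA.
  apply: (le_lt_trans (ler_normD _ _)); rewrite [ltRHS]splitr ltrD//.
    rewrite distrC; apply: near_xs => //.
      by move=> i; apply: lt_trans (xy i) _; rewrite ltrDl.
    by apply: lt_trans st _; rewrite ltrDl.
  apply: near_xs => //.
    move=> i; rewrite -(subrK (\val y 0 i) (\val x 0 i)) -addrA.
    apply: (le_lt_trans (ler_normD _ _)); apply: ltrD => //.
    exact: lt_trans (yz i) d'd.
  rewrite -(subrK t s) -addrA; apply: (le_lt_trans (ler_normD _ _)).
  by apply: ltrD => //; exact: lt_trans tr d'd.
move=> /(filterI (nbhs_right_gt (0 : R)))/filter_ex[d /= [d0 AP]].
exists d => // x y s t s01 t01 xy st v.
by apply: (AP (x, s) _ _ (y, t)) => //; split=> //=; rewrite in_itv.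
Qed.

End Continuity.

Lemma nu_subproof (a : X) : exists v, v \in finsupp a /\ forall w, a w <= a v.
Proof.
have : finsupp a != fset0 by apply: simplex_neq0; exact: coord_supp.
have : forall r : seq V, r != [::] -> exists2 v, v \in r &
    forall w, w \in r -> a w <= a v.
  elim=> // v [_ _|w r IHr _].
    by exists v; rewrite ?mem_head// => w; rewrite inE => /eqP ->.
  have [//|z zr zmax] := IHr; have [vz|zv] := leP (a v) (a z).
    exists z; first by rewrite inE zr orbT.
    by move=> y; rewrite inE => /orP[/eqP -> //|/zmax].
  exists v; first exact: mem_head.
  move=> y; rewrite inE => /orP[/eqP -> //|/zmax yz].
  exact: le_trans yz (ltW zv).
move=> maxP a0; have [|v va vmax] := maxP (finsupp a).
  case/fset0Pn: a0 => z za; apply/eqP => fa; move: za.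
  by rewrite -[_ \in _]/(z \in (finsupp a : seq V)) fa.
exists v; split=> // w; have [wa|wa] := boolP (w \in finsupp a).
  exact: vmax.
by rewrite fsfun_dflt// coord_ge0.
Qed.

Definition nu (a : X) : V := sval (cid (nu_subproof a)).

Lemma nu_supp (a : X) : nu a \in finsupp a.
Proof. by rewrite /nu; case: cid => v []. Qed.

Lemma nu_max (a : X) v : a v <= a (nu a).
Proof. by rewrite /nu; case: cid => w []. Qed.

Variable n : nat.
Hypothesis K_dim : forall s : {fset V}, K s -> (#|` s| <= n)%N.

Lemma nu_ge (a : X) : n%:R^-1 <= a (nu a).
Proof.
have Ka := K_dim (coord_supp a).
have n0 : (0 < n)%N.
  by apply: leq_trans Ka; rewrite cardfs_gt0; apply: simplex_neq0; exact: coord_supp.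
rewrite -[leLHS]div1r ler_pdivrMr ?ltr0n// -[leLHS](coord_sum a).
apply: (@le_trans _ _ (\sum_(v <- finsupp a) a (nu a))).
  by apply: ler_sum => v _; exact: nu_max.
rewrite big_const_seq count_predT iter_addr_0 -[leLHS]mulr_natr.
by apply: ler_wpM2l; [exact: coord_ge0|rewrite ler_nat].
Qed.

(* Points that are close compared with the dimension of [K] have their largest
   barycentric coordinates at vertices of a common simplex. *)
Lemma nu_close (a b : X) : (forall v, `|a v - b v| < n%:R^-1) -> nu b \in finsupp a.
Proof.
move=> /(_ (nu b)) ab; apply: contraLR ab => /fsfun_dflt ->.
by rewrite sub0r normrN -leNgt (le_trans (nu_ge b))// ler_norm.
Qed.

(** The support of any single point [a] of [w] will do: by [nu_close] it contains [nu b] for all [b]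
    in [w]. *)
Lemma spx_nu (w : seq X) : w != [::] ->
  (forall a b, a \in w -> b \in w -> forall v, `|a v - b v| < n%:R^-1) ->
  spx (map nu w).
Proof.
case: w => // a w _ aw; apply: simplexS (coord_supp a) _ _; last first.
  by apply/fset0Pn; exists (nu a); rewrite !inE eqxx.
apply/fsubsetP => v vF.
have /mapP[b bw ->] : v \in map nu (a :: w) by move: vF; rewrite !inE.
by apply: nu_close; exact: aw (mem_head _ _) bw.
Qed.

End Realization.

(** * Subdivision followed by rounding to vertices *)

Section Subdivision.
Context {R : realType} {k : comNzRingType} {V : choiceType}.
Variable K : simplicial_complex V.
Local Notation D q := (@std_simplex R q).
Local Notation X := (realization R K).
Variables (e : R) (e0 : 0 < e).
Local Notation fund q := (fund (k := k) e0 q).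

Definition spx_or_nil (u : seq V) : Prop := u = [::] \/ spx K u.

Lemma spx_or_nil_sub u v : spx_or_nil u -> subseq v u -> spx_or_nil v.
Proof.
case: v => [|x v] [->|uK] vu; [by left|by left|by []|right].
by apply: spx_sub uK _ _ => //; exact: mem_subseq.
Qed.

Lemma subseq_del (T : eqType) j (u : seq T) : subseq (del j u) u.
Proof.
rewrite -[X in subseq _ X](cat_take_drop j u) /del cat_subseq//.
by rewrite -addn1 addnC -drop_drop drop_subseq.
Qed.

Lemma aff_face q u uq uK j uq' uK' :
  @aff R V K q.+1 u uq uK \o face_map j = @aff R V K q (del j u) uq' uK'.
Proof.
apply/funext => x; apply: realizationP => v.
by rewrite -[LHS]/(aff uq uK (face_map j x) v) !affE bary_face.
Qed.

(* The small points subdividing the simplex [u]. *)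
Definition pts (u : seq V) : {freeg (seq X) / k} :=
  if u is [::] then << [::] >> else
  if pselect (size u = (size u).-1.+1 /\ spx K u) is left uP then
    mapc (aff uP.1 uP.2) (fund (size u).-1)
  else 0.

Lemma ptsE q u (uq : size u = q.+1) (uK : spx K u) :
  pts u = mapc (aff uq uK) (fund q).
Proof.
have qE : q = (size u).-1 by rewrite uq.
subst q; rewrite /pts; case: u uq uK => // x u uq uK.
case: pselect => [uP|]; last by case; split.
by rewrite (Prop_irrelevance uP.1 uq) (Prop_irrelevance uP.2 uK).
Qed.

Lemma bd_pts u : spx_or_nil u -> bd (pts u) = lin pts (bd << u >>).
Proof.
case=> [->|uK]; first by rewrite /pts !bdU /= linear0.
case uq : (size u) => [|[|q]].
- by case: u uq {uK} => // _; rewrite /pts !bdU /= linear0.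
- rewrite (ptsE uq uK) bd_mapc bd_fund0 mapcU /=.
  case: u uq {uK} => [//|x [|//] _].
  by rewrite bdU /= linear0 subr0 linU.
rewrite (ptsE uq uK) bd_mapc bd_fundS bdU bd_seqE !linear_sum /= uq.
apply: eq_bigr => j _; rewrite !linearZ /= linU; congr (_ *: _).
have ju : (j < size u)%N by rewrite uq.
have uq' : size (del j u) = q.+1 by rewrite size_del// uq.
have uK' : spx K (del j u).
  apply: spx_sub uK _ _; first exact/mem_subseq/subseq_del.
  by rewrite -size_eq0 uq'.
by rewrite (ptsE uq' uK') mapc_comp (@aff_face q u uq uK j uq' uK').
Qed.

Lemma supp_pts u : spx_or_nil u ->
  supp_in (fun w : seq X => size w = size u /\ forall a : X, a \in w ->
    {subset finsupp a <= u}) (pts u).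
Proof.
case=> [->|uK]; first exact: supp_inU.
case uq : (size u) => [|q].
  by case: u uq {uK} => // _; exact: supp_inU.
rewrite (ptsE uq uK); apply: supp_mapc (@supp_fund _ _ _ _ _) => x [_ xq].
split=> [|a /mapP[y _ ->]]; first by rewrite size_map.
exact: aff_finsupp.
Qed.

(** The result uses only vertices of [u], so the cone homotopy from the identity to [sdv] stays
    inside each simplex. *)
Definition sdv (u : seq V) : {freeg (seq V) / k} := mapc (@nu R V K) (pts u).

Lemma bd_sdv u : spx_or_nil u -> bd (sdv u) = lin sdv (bd << u >>).
Proof. by move=> uK; rewrite /sdv bd_mapc bd_pts// lin_comp. Qed.

Lemma supp_sdv u : spx_or_nil u ->
  supp_in (fun v => size v = size u /\ {subset v <= u}) (sdv u).
Proof.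
move=> uK; apply: supp_mapc (supp_pts uK) => w [wu wsub].
split=> [|x /mapP[a aw ->]]; first by rewrite size_map.
exact: wsub (nu_supp a).
Qed.

Lemma bd_homot_sdv c : supp_in spx_or_nil c ->
  bd (lin (homot sdv) c) = c - lin sdv c - lin (homot sdv) (bd c).
Proof.
apply: bd_homot; [exact: spx_or_nil_sub|by rewrite /sdv mapcU|exact: bd_sdv].
Qed.

Lemma supp_homot_sdv q c : supp_in (fun u => size u = q.+1 /\ spx K u) c ->
  supp_in (fun v => size v = q.+2 /\ exists u, [/\ coeff u c != 0, spx K u &
    {subset v <= u}]) (lin (homot sdv) c).
Proof.
move=> cs; have cs' : supp_in (fun u => coeff u c != 0 /\
    (size u = q.+1 /\ spx K u)) c by move=> u uc; split=> //; exact: cs.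
apply: supp_in_lin cs' => u [uc [uq uK]].
have /= H := @supp_homot k V sdv spx_or_nil spx_or_nil_sub
  (fun u x => x \in u) (fun _ _ _ xu => xu)
  (fun u v x _ vu => @mem_subseq V v u vu x) supp_sdv u (or_intror uK).
by apply: supp_inW H => v [-> vu]; split; [rewrite uq|exists u].
Qed.

End Subdivision.

Lemma exists_pos (R : realType) (T : eqType) (r : seq T) (P : T -> R -> Prop) :
  (forall x, x \in r -> exists2 d, 0 < d & forall d', 0 < d' -> d' <= d -> P x d') ->
  exists2 d, 0 < d & forall x, x \in r -> P x d.
Proof.
move=> rP; suff [d d0 dP] : exists2 d, 0 < d &
    forall x, x \in r -> forall d', 0 < d' -> d' <= d -> P x d'.
  by exists d => // x /dP; apply.
elim: r rP => [_|x r IHr rP]; first by exists 1.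
have [y yr|d d0 dP] := IHr; first by apply: rP; rewrite inE yr orbT.
have [d' d'0 d'P] := rP x (mem_head _ _).
exists (Num.min d d') => [|y]; first by rewrite lt_min d0.
rewrite inE => /orP[/eqP ->|yr] d'' d''0; rewrite le_min => /andP[? ?].
  exact: d'P.
exact: (dP y yr).
Qed.

(** * Acyclicity of contractible complexes *)

Section Acyclic.
Context {R : realType} {k : comNzRingType} {V : choiceType}.
Variable K : simplicial_complex V.
Local Notation D q := (@std_simplex R q).
Local Notation X := (realization R K).
Variable n : nat.
Hypothesis n_gt0 : (0 < n)%N.
Hypothesis K_dim : forall s : {fset V}, K s -> (#|` s| <= n)%N.

(** The contraction is followed in N stages on a fine subdivision of [c]. Points of two consecutive
    stages that come from one small tuple differ by less than 1/n in each coordinate, so rounding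
    them gives a simplex by [spx_nu]. Stage 0 is [sdv] of [c], and the last stage is constant. *)
Lemma contractible_acyclic q (c : {freeg (seq V) / k}) :
  contractible R X -> supp_in (fun u => size u = q.+1 /\ spx K u) c ->
  bd c = 0 ->
  exists2 d : {freeg (seq V) / k},
    supp_in (fun u => size u = q.+2 /\ spx K u) d & bd d = c.
Proof.
move=> [x0 [H [Hc H0 H1]]] cs bc.
have n1 : 0 < n%:R^-1 :> R by rewrite invr_gt0 ltr0n.
have [e e0 eP] : exists2 e : R, 0 < e & forall u, u \in dom c ->
    forall (uq : size u = q.+1) (uK : spx K u) x y s t,
    0 <= s <= 1 -> 0 <= t <= 1 -> close e x y -> `|s - t| < e ->
    forall v, `|H (aff uq uK x, s) v - H (aff uq uK y, t) v| < n%:R^-1.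
  apply: exists_pos => u; rewrite mem_dom => /cs[uq uK].
  have Fc : {within [set: D q] `*` `[0, 1],
      continuous (fun xs : D q * R => H (aff uq uK xs.1, xs.2))}.
    apply/subspace_continuousP => -[x s] xs B nB.
    have /subspace_continuousP/(_ (aff uq uK x, s) xs B nB) := Hc.
    move=> [[B1 B2] [xB1 sB2] BB].
    exists (aff uq uK @^-1` B1, B2).
      by split=> //; exact: aff_continuous.
    by move=> [y t] [yB1 tB2] yt; apply: (BB (aff uq uK y, t)).
  have [d d0 dP] := unif_continuous n1 Fc.
  exists d => // d' d'0 d'd uq' uK' x y s t s01 t01 xy st v.
  rewrite (Prop_irrelevance uq' uq) (Prop_irrelevance uK' uK).
  apply: (dP x y s t) => //; last exact: lt_le_trans st _.
  by move=> i; apply: lt_le_trans (xy i) _.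
pose N := (Num.truncn (1 / e)).+1.
have N0 : 0 < N%:R :> R by rewrite ltr0n.
have N1 : N%:R^-1 < e.
  rewrite -[X in X < _]div1r ltr_pdivrMr// mulrC -ltr_pdivrMr//.
  exact: truncnS_gt.
have h01 j : (j <= N)%N -> 0 <= (j%:R / N%:R : R) <= 1.
  by move=> jN; rewrite divr_ge0//= ler_pdivrMr// mul1r ler_nat.
pose h j (a : X) := nu (H (a, j%:R / N%:R)).
pose c' := lin (pts (k := k) K e0) c.
have cs' : supp_in (spx_or_nil K) c by apply: supp_inW cs => u []; right.
have bc' : bd c' = 0.
  rewrite /c' lin_comp (eq_lin (F' := fun u => lin (pts K e0) (bd << u >>)) _ cs').
    by rewrite lin_bd bc linear0.
  by move=> u uK; exact: bd_pts.
pose Pw (w : seq X) := size w = q.+1 /\ exists u (uq : size u = q.+1)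
  (uK : spx K u) x, [/\ u \in dom c, small e x & w = map (aff uq uK) x].
have c'P : supp_in Pw c'.
  have cs2 : supp_in (fun u => u \in dom c /\ (size u = q.+1 /\ spx K u)) c.
    by move=> u uc; split; [rewrite mem_dom|exact: cs].
  apply: supp_in_lin cs2 => u [uc [uq uK]]; rewrite (ptsE _ uq uK).
  apply: supp_mapc (@supp_fund _ _ _ _ _) => x [xe xq].
  by split; [rewrite size_map|exists u, uq, uK, x].
have step j : (j < N)%N -> supp_in (fun u => size u = q.+2 /\ spx K u)
    (prism (h j) (h j.+1) c').
  move=> jN; apply: supp_prism c'P => w v [wq [u [uq [uK [x [uc xe wE]]]]]].
  rewrite wq => vq vw; split=> //.
  pose w' := map (fun a => H (a, j%:R / N%:R)) w ++
    map (fun a => H (a, j.+1%:R / N%:R)) w.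
  have : spx K (map (@nu R V K) w').
    apply: (spx_nu K_dim); first by rewrite /w'; case: (w) wq.
    have w'P a : a \in w' -> exists y (i : nat), [/\ y \in x, (j <= i <= j.+1)%N &
        a = H (aff uq uK y, i%:R / N%:R)].
      rewrite mem_cat wE => /orP[] /mapP[b /mapP[y yx ->] ->].
        by exists y, j; rewrite leqnn leqnSn.
      by exists y, j.+1; rewrite leqnn leqnSn.
    move=> a b /w'P[y [i [yx /andP[ji ij] ->]]] /w'P[y' [i' [yx' /andP[ji' ij'] ->]]].
    apply: eP => //.
    - by apply: h01; apply: leq_trans ij _.
    - by apply: h01; apply: leq_trans ij' _.
    - exact: xe.
    - apply: le_lt_trans N1.
      rewrite -mulrBl normrM (ger0_norm (_ : 0 <= N%:R^-1)) ?invr_ge0//.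
      rewrite ler_piMl ?invr_ge0//.
      rewrite ler_norml; move: ji ij ji' ij'; rewrite -!(ler_nat R) -natr1; lra.
  move=> w'K; apply: spx_sub w'K _ _; last by case: (v) vq.
  by move=> y /vw; rewrite /w' map_cat -!map_comp.
have [d ds bd_d] := prism_steps bc' step.
have hN : supp_in (fun u => size u = q.+1 /\ forall y, y \in u -> y = nu x0)
    (mapc (h N) c').
  apply: supp_mapc c'P => w [wq _]; split=> [|y /mapP[a _ ->]].
    by rewrite size_map.
  by rewrite /h divff ?gt_eqF// H1.
(* The homotopy leads from [c] to its subdivision, [d] from there to the last stage, and the cone
   fills the constant tuples. *)
exists (lin (homot (sdv (k := k) K e0)) c +
  (cone (nu x0) (mapc (h N) c') - d)).
  apply: supp_inD.
    have := @supp_homot_sdv R k V K e e0 q c cs.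
    apply: supp_inW => v [vq [u [_ uK vu]]]; split=> //.
    by apply: spx_sub uK vu _; case: (v) vq.
  apply: supp_inB => //; apply: supp_cone hN => u [uq up].
  split; first by rewrite /= uq.
  apply: (@spx_sub _ _ [:: nu x0]) => //.
    rewrite /spx; suff -> : [fset z in [:: nu x0]]%fset = [fset nu x0]%fset.
      exact: simplex1.
    by apply/fsetP => y; rewrite !inE orbF.
  by move=> y; rewrite [y \in _ :: _]inE => /orP[/eqP ->|/up ->]; exact: mem_head.
rewrite linearD /= bd_homot_sdv// bc linear0 subr0 linearB /= bd_cone bd_mapc.
rewrite bc' !linear0 addr0 bd_d.
have -> : lin (sdv K e0) c = mapc (h 0%N) c'.
  rewrite /c' lin_comp; apply: (eq_lin _ cs) => u _; rewrite /sdv.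
  by apply: eq_lin => // w _; congr << _ >>; apply: eq_map => a; rewrite /h mul0r H0.
by rewrite opprB [X in _ + X]addrC !subrK.
Qed.

End Acyclic.

(** * Threads of singular classes *)

Section FormalSingular.
Context {R : realType} {X : topologicalType} {k : comNzRingType}.
Local Notation S q := (@singular_simplex R X q).
Local Notation Sg q := {freeg (S q) / k}.

Definition chain_fun q (C : Sg q) : S q -> k := fun sigma => coeff sigma C.

Definition in_set (U : set X) q (C : Sg q) : Prop :=
  supp_in (fun sigma : S q => range sigma `<=` U) C.

Lemma singular_chainP q (U : set X) (c : S q -> k) :
  singular_chain U c <-> exists2 C, in_set U C & c = chain_fun C.
Proof.
split=> [[cf cU]|[C CU ->]]; last first.
  split=> [|sigma]; last exact: CU.
  apply: (@sub_finite_set _ _ [set` dom C]); last exact: finite_seq.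
  by move=> sigma; rewrite /= mem_dom.
have [C CE] := freeg_of_fun cf; have cC : c = chain_fun C.
  by apply/funext => sigma; rewrite /chain_fun CE.
by exists C => // sigma sC; apply: cU; rewrite -CE.
Qed.

Definition sbd q : Sg q.+1 -> Sg q :=
  lin (fun sigma => \sum_(j < q.+2) (-1) ^+ j *: << singular_face j sigma >>).

HB.instance Definition _ q := GRing.Linear.on (@sbd q).

Lemma singular_bdE q (C : Sg q.+1) :
  singular_bd (chain_fun C) = chain_fun (sbd C).
Proof.
apply/funext => tau; rewrite /singular_bd /chain_fun /sbd linE raddf_sum /=.
under [RHS]eq_bigr do rewrite coeffZ raddf_sum mulr_sumr /=.
rewrite exchange_big /=; apply: eq_bigr => j _.
rewrite fsbig_mkcond (fsbigTE [fset sigma in dom C]%fset); last first.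
  move=> sigma; rewrite !inE /patch => sC.
  by case: ifP => // _; exact: coeff_outdom.
rewrite (perm_big (dom C)) /=; last first.
  apply: uniq_perm; rewrite ?fset_uniq ?uniq_dom// => sigma.
  by rewrite !inE.
rewrite mulr_sumr; apply: eq_bigr => sigma _.
rewrite coeffZ coeffU /patch mul1r mulrCA.
case: eqVneq => [st|st]; first by rewrite mem_set// mulr1.
by rewrite memNset ?mulr0//= => fs; rewrite -fs eqxx in st.
Qed.

Definition bnd q (U : set X) (f : S q -> k) : Prop :=
  exists2 C : Sg q.+1, in_set U C & f = chain_fun (sbd C).

Lemma bndP q (U : set X) (f : S q -> k) : singular_boundary U f <-> bnd U f.
Proof.
split=> [[c /singular_chainP[C CU ->] <-]|[C CU ->]].
  by exists C => //; rewrite singular_bdE.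
by exists (chain_fun C); [apply/singular_chainP; exists C|exact: singular_bdE].
Qed.

Lemma bnd0 q (U : set X) : bnd U (\0 : S q -> k).
Proof.
exists 0; first exact: supp_in0.
by apply/funext => s; rewrite linear0 /chain_fun coeff0.
Qed.

Lemma bndD q (U : set X) (f g h : S q -> k) : bnd U f -> bnd U g ->
  (forall s, h s = f s + g s) -> bnd U h.
Proof.
move=> [C CU ->] [E EU ->] hE; exists (C + E); first exact: supp_inD.
by apply/funext => s; rewrite hE linearD /chain_fun coeffD.
Qed.

Lemma bndB q (U : set X) (f g h : S q -> k) : bnd U f -> bnd U g ->
  (forall s, h s = f s - g s) -> bnd U h.
Proof.
move=> [C CU ->] [E EU ->] hE; exists (C - E); first exact: supp_inB.
by apply/funext => s; rewrite hE linearB /chain_fun coeffB.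
Qed.

Lemma in_setW q (U W : set X) (C : Sg q) : U `<=` W -> in_set U C -> in_set W C.
Proof. by move=> UW; apply: supp_inW => s sU; exact: subset_trans UW. Qed.

Lemma bndW q (U W : set X) (f : S q -> k) : U `<=` W -> bnd U f -> bnd W f.
Proof. by move=> UW [C CU ->]; exists C => //; exact: in_setW CU. Qed.

(** The classes of the [b n] form a thread because consecutive ones differ by a boundary in the
    larger set. Classes are sets, so equality with the class of 0 is read off at the member
    [b n]. *)
Lemma thread_bnd q (U : nat -> set X) (b : nat -> S q -> k) :
  (forall n, U n.+1 `<=` U n) ->
  (forall n, singular_cycle (U n) (b n)) ->
  (forall n, bnd (U n) (b n.+1 \- b n)) ->
  lim_homology U = [set fun n => homology_class (U n) (\0 : S q -> k)] ->
  forall n, bnd (U n) (b n).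
Proof.
move=> US bc bb lim0 n.
have : lim_homology U (fun n => homology_class (U n) (b n)).
  move=> m; split; first by exists (b m).
  apply/seteqP; split=> [z [y [yc /bndP yb] [zc /bndP zy]]|z [zc /bndP zb]].
    split=> //; apply/bndP; have zb : bnd (U m) (z \- b m.+1).
      by apply: bndD zy (bndW (US m) yb) _ => s /=; rewrite addrA subrK.
    by apply: bndD zb (bb m) _ => s /=; rewrite addrA subrK.
  exists (b m.+1).
    split; first exact: bc.
    apply/bndP; rewrite (_ : _ \- _ = \0); first exact: bnd0.
    by apply/funext => s /=; rewrite subrr.
  split=> //; apply/bndP; apply: bndB zb (bb m) _ => s /=.
  by rewrite opprB addrA subrK.
rewrite lim0 => /(congr1 (fun x => x n)) class0.
have : homology_class (U n) (b n) (b n).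
  split; first exact: bc.
  apply/bndP; rewrite (_ : _ \- _ = \0); first exact: bnd0.
  by apply/funext => s /=; rewrite subrr.
rewrite class0 => -[_ /bndP]; congr bnd.
by apply/funext => s /=; rewrite subr0.
Qed.

End FormalSingular.

Section Thread.
Context {R : realType} {k : comNzRingType} {V : choiceType}.
Variable K : simplicial_complex V.
Local Notation D q := (@std_simplex R q).
Local Notation X := (realization R K).
Local Notation S q := (@singular_simplex R X q).
Local Notation Sg q := {freeg (S q) / k}.

HB.instance Definition _ q u uq uK := isContinuous.Build _ _
  (@aff R V K q u uq uK) (@aff_continuous R V K q u uq uK).

Definition aff_simplex q u uq uK : S q := @aff R V K q u uq uK.

Definition to_sing q (u : seq V) : Sg q :=
  if pselect (size u = q.+1 /\ spx K u) is left uP then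
    << aff_simplex uP.1 uP.2 >>
  else 0.

Lemma to_singE q u (uq : size u = q.+1) (uK : spx K u) :
  to_sing q u = << aff_simplex uq uK >>.
Proof.
rewrite /to_sing; case: pselect => [uP|]; last by case; split.
by rewrite (Prop_irrelevance uP.1 uq) (Prop_irrelevance uP.2 uK).
Qed.

Lemma sbd_to_sing q (c : {freeg (seq V) / k}) :
  supp_in (fun u => size u = q.+2 /\ spx K u) c ->
  sbd (lin (to_sing q.+1) c) = lin (to_sing q) (bd c).
Proof.
move=> cs; rewrite lin_comp -lin_bd; apply: (eq_lin _ cs) => u [uq uK].
rewrite (to_singE uq uK) /= /sbd linU bdU bd_seqE linear_sum /= uq.
apply: eq_bigr => j _; rewrite linearZ /= linU; congr (_ *: _).
have uq' : size (del j u) = q.+1 by rewrite size_del uq.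
have uK' : spx K (del j u).
  apply: spx_sub uK _ _; first exact/mem_subseq/subseq_del.
  by rewrite -size_eq0 uq'.
rewrite (to_singE uq' uK'); congr << _ >>; apply/continuousEP => x.
by rewrite /= -[RHS]/(aff uq' uK' x) -(@aff_face R V K q u uq uK j uq' uK').
Qed.

Lemma in_set_to_sing q (c : {freeg (seq V) / k}) (W : set V) :
  supp_in (fun u => [/\ size u = q.+1, spx K u & forall x, x \in u -> ~ W x]) c ->
  in_set (~` full_subcomplex W) (lin (to_sing q) c).
Proof.
move=> cs; apply: supp_in_lin cs => u [uq uK uW]; rewrite (to_singE uq uK).
apply: supp_inU => a [x _ <-] aW.
have [y yx] : exists y, y \in finsupp (aff uq uK x).
  by apply/fset0Pn; apply: simplex_neq0; exact: coord_supp.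
exact: uW (aff_finsupp yx) (aW y yx).
Qed.

Section Phi.
Variables (e : R) (e0 : 0 < e).

(** The singular simplex is sampled at the points of the subdivision and the samples are rounded.
    This commutes with boundaries for every [e]; an [e] small compared with [sigma] ensures that the
    tuples are simplices. *)
Definition of_sing q (sigma : S q) : {freeg (seq V) / k} :=
  mapc (@nu R V K \o sigma) (fund (k := k) e0 q).

Lemma bd_of_sing q (C : Sg q.+1) :
  bd (lin (@of_sing q.+1) C) = lin (@of_sing q) (sbd C).
Proof.
elim/(@freeg_ind k): C => [|a c d|sigma]; first by rewrite !linear0.
  by rewrite !linearP /= => -> ->.
rewrite /sbd !linU /of_sing bd_mapc bd_fundS !linear_sum /=.
apply: eq_bigr => j _; rewrite !linearZ /= linU; congr (_ *: _).
by rewrite mapc_comp.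
Qed.

Lemma of_sing_to_sing q (c : {freeg (seq V) / k}) :
  supp_in (fun u => size u = q.+1 /\ spx K u) c ->
  lin (@of_sing q) (lin (to_sing q) c) = lin (sdv K e0) c.
Proof.
move=> cs; rewrite lin_comp; apply: (eq_lin _ cs) => u [uq uK].
by rewrite (to_singE uq uK) /= linU /of_sing /sdv (ptsE _ uq uK) mapc_comp.
Qed.

End Phi.

Variable n : nat.
Hypothesis n_gt0 : (0 < n)%N.
Hypothesis K_dim : forall s : {fset V}, K s -> (#|` s| <= n)%N.

(** A point outside the full subcomplex on [W] has some support vertex outside [W], but [nu] may
    select another vertex of the support. Hence the conclusion only places the vertices one simplex
    away from the complement of [W]. *)
Lemma supp_of_sing q (C : Sg q) (W : set V) : in_set (~` full_subcomplex W) C ->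
  exists (e : R) (e0 : 0 < e),
    supp_in (fun u => [/\ size u = q.+1, spx K u & forall x, x \in u ->
      exists s, [/\ K s, x \in s & exists2 y, y \in s & ~ W y]])
    (lin (@of_sing e e0 q) C).
Proof.
move=> CW; have n1 : 0 < n%:R^-1 :> R by rewrite invr_gt0 ltr0n.
have [e e0 eP] : exists2 e : R, 0 < e & forall sigma : S q, sigma \in dom C ->
    forall x y, close e x y ->
    forall v, `|sigma x v - sigma y v| < n%:R^-1.
  apply: exists_pos => sigma _.
  have Fc : {within [set: D q] `*` `[0, 1],
      continuous (fun xs : D q * R => sigma xs.1)}.
    apply: continuous_subspaceT => -[x s].
    apply: (@continuous_comp _ _ _ fst sigma); first exact: cvg_fst.
    exact: cts_fun.
  have [d d0 dP] := unif_continuous n1 Fc.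
  exists d => // d' d'0 d'd x y xy v.
  apply: (dP x y 0 0); rewrite ?lexx ?ler01 ?subrr ?normr0//.
  by move=> i; apply: lt_le_trans (xy i) _.
exists e, e0; have CW' : supp_in (fun sigma : S q => sigma \in dom C /\
    range sigma `<=` ~` full_subcomplex W) C.
  by move=> sigma sC; split; [rewrite mem_dom|exact: CW].
apply: supp_in_lin CW' => sigma [sC sW].
apply: supp_mapc (@supp_fund _ _ _ _ _) => x [xe xq]; split.
- by rewrite size_map.
- rewrite map_comp; apply: (spx_nu K_dim); first by case: (x) xq.
  move=> a b /mapP[y yx ->] /mapP[z zx ->]; apply: eP => //; exact: xe.
- move=> v /mapP[y yx ->]; exists (finsupp (sigma y)); split.
  + exact: coord_supp.
  + exact: nu_supp.
  + have := sW (sigma y) (ex_intro2 _ _ y I erefl).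
    by move=> /existsNP[v' /not_implyP[v'y v'W]]; exists v'.
Qed.

(** A singular filling of [b m] is brought back by [of_sing]. On affine simplices this gives [sdv]
    rather than the identity, which the homotopy term of the witness corrects. *)
Lemma thread_acyclic q (W : nat -> set V) (b h : nat -> {freeg (seq V) / k}) :
  (forall m, W m `<=` W m.+1) ->
  lim_homology (fun m => ~` full_subcomplex (W m)) =
    [set fun m => homology_class (~` full_subcomplex (W m)) (\0 : S q -> k)] ->
  (forall m, supp_in (fun u =>
    [/\ size u = q.+1, spx K u & forall x, x \in u -> ~ W m x]) (b m)) ->
  (forall m, bd (b m) = 0) ->
  (forall m, supp_in (fun u =>
    [/\ size u = q.+2, spx K u & forall x, x \in u -> ~ W m x]) (h m)) ->
  (forall m, b m.+1 - b m = bd (h m)) ->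
  forall m, exists2 w : {freeg (seq V) / k},
    supp_in (fun u => [/\ size u = q.+2, spx K u & forall x, x \in u ->
      exists s, [/\ K s, x \in s & exists2 y, y \in s & ~ W m y]]) w &
    bd w = b m.
Proof.
move=> WS lim0 bs bb hs hb m.
have US m' : ~` full_subcomplex (W m'.+1) `<=` ~` @full_subcomplex R V K (W m').
  by apply: subsetC => a aW v /aW; exact: WS.
have bs' m' : supp_in (fun u => size u = q.+1 /\ spx K u) (b m').
  by apply: supp_inW (bs m') => u [].
have hs' m' : supp_in (fun u => size u = q.+2 /\ spx K u) (h m').
  by apply: supp_inW (hs m') => u [].
have [||C CW bC] := thread_bnd US
  (b := fun m' => chain_fun (lin (to_sing q) (b m'))) _ _ lim0 m.
- move=> m'; have ch : singular_chain (~` full_subcomplex (W m'))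
      (chain_fun (lin (to_sing q) (b m'))).
    apply/singular_chainP; exists (lin (to_sing q) (b m')) => //.
    exact: in_set_to_sing.
  (* [singular_cycle] has no boundary condition in degree 0, so the degree must be split. *)
  case: q b h bs bb hs hb bs' hs' lim0 ch => [|p] b' h' bs bb hs hb bs' hs' lim0 ch //=.
  split=> //; rewrite singular_bdE sbd_to_sing// bb linear0.
  by apply/funext => s; rewrite /chain_fun coeff0.
- move=> m'; exists (lin (to_sing q.+1) (h m')); first exact: in_set_to_sing.
  by apply/funext => s /=; rewrite sbd_to_sing// -hb linearB /chain_fun coeffB.
have [e [e0 sC]] := supp_of_sing CW.
have {}bC : sbd C = lin (to_sing q) (b m).
  by apply/eqP/freeg_eqP => s; have /(congr1 (fun f => f s)) := bC.
exists (lin (@of_sing e e0 q.+1) C + lin (homot (sdv K e0)) (b m)).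
  apply: supp_inD => //.
  have bm : supp_in (fun u => size u = q.+1 /\ spx K u) (b m) by [].
  have := @supp_homot_sdv R k V K e e0 q _ bm.
  apply: supp_inW => v [vq [u [/bs[_ _ uW] uK vu]]].
  split=> //; first by apply: spx_sub uK vu _; case: (v) vq.
  move=> x /vu xu; exists [fset y in u]%fset; split=> //; first by rewrite !inE.
  by exists x; [rewrite !inE|exact: uW].
rewrite linearD /= bd_of_sing bC of_sing_to_sing// bd_homot_sdv.
  by rewrite bb linear0 subr0 addrCA subrr addr0.
by apply: supp_inW (bs' m) => u []; right.
Qed.

End Thread.

(** * Word metrics and Rips complexes *)

Section WordMetricTheory.
Context {G : groupType} (S : seq G) (S_gen : generates S).
Implicit Types g x y z : G.
Local Notation len := (word_length S).

Lemma word_lengthP g : is_word S g (len g).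
Proof.
rewrite /word_length; case: pselect => [gW|].
  by case: ex_minnP => n /asboolP.
by case; have [n gn] := S_gen g; exists n; apply/asboolP.
Qed.

Lemma word_length_le g n : is_word S g n -> (len g <= n)%N.
Proof.
move=> gn; rewrite /word_length; case: pselect => // gW.
by case: ex_minnP => m _; apply; apply/asboolP.
Qed.

Lemma is_word_mul g h m n : is_word S g m -> is_word S h n ->
  is_word S (g * h)%g (m + n).
Proof.
move=> [w [<- wS <-]] [w' [<- w'S <-]]; exists (w ++ w').
by rewrite size_cat all_cat wS w'S big_cat.
Qed.

Lemma is_word_inv g n : is_word S g n -> is_word S g^-1%g n.
Proof.
move=> [w [<- wS <-]]; exists (rev (map (fun x => x^-1%g) w)); split.
- by rewrite size_rev size_map.
- rewrite all_rev all_map; apply: sub_all wS => x /=.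
  by rewrite invgK orbC.
elim: w {wS} => [|x w IHw] /=; first by rewrite !big_nil invg1.
by rewrite rev_cons -cats1 big_cat IHw big_seq1 big_cons invMg.
Qed.

Lemma len_mul g h : (len (g * h)%g <= len g + len h)%N.
Proof. by apply: word_length_le; apply: is_word_mul; exact: word_lengthP. Qed.

Lemma len_inv g : len g^-1%g = len g.
Proof.
have le x : (len x^-1%g <= len x)%N.
  by apply: word_length_le; apply: is_word_inv; exact: word_lengthP.
by apply/eqP; rewrite eqn_leq le -[X in (len X <= _)%N](invgK g) le.
Qed.

Lemma len1 : len 1%g = 0%N.
Proof.
by apply/eqP; rewrite -leqn0; apply: word_length_le; exists [::]; rewrite big_nil.
Qed.

Definition gd x y : nat := len (x^-1 * y)%g.

Lemma gdxx x : gd x x = 0%N. Proof. by rewrite /gd mulVg len1. Qed.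

Lemma gdC x y : gd x y = gd y x.
Proof. by rewrite /gd -len_inv invMg invgK. Qed.

Lemma gd_tri x y z : (gd x z <= gd x y + gd y z)%N.
Proof. by apply: leq_trans (len_mul _ _); rewrite -mulgA mulKVg. Qed.

Lemma gdM g x y : gd (g * x)%g (g * y)%g = gd x y.
Proof. by rewrite /gd invMg -mulgA mulKg. Qed.

Lemma gd_mull g x : gd g (g * x)%g = len x.
Proof. by rewrite /gd mulKg. Qed.

Lemma gd1 x : gd x 1%g = len x. Proof. by rewrite /gd mulg1 len_inv. Qed.

Lemma ball_finite n : finite_set [set g | (len g <= n)%N].
Proof.
elim: n => [|n IHn].
  refine (sub_finite_set _ (finite_set1 (1%g : G))) => g /=; rewrite leqn0 => /eqP g0.
  have [w [+ _ <-]] := word_lengthP g.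
  by rewrite g0 => /size0nil ->; rewrite big_nil.
pose A := S ++ map (fun x => x^-1%g) S.
have AB : finite_set [set (xg.1 * xg.2)%g | xg in [set` A] `*` [set g | (len g <= n)%N]].
  by apply: finite_image; apply: finite_setX => //; exact: finite_seq.
have := conj AB (finite_set1 (1%g : G)); rewrite -finite_setU.
apply: sub_finite_set => g /= gn.
have [[|x w] [gw + <-]] := word_lengthP g.
  by right; rewrite big_nil.
move=> /= /andP[xS wS]; left; exists (x, \big[*%g/1%g]_(y <- w) y).
  split=> /=.
    rewrite mem_cat; case/orP: xS => [->//|xS]; apply/orP; right.
    by apply/mapP; exists x^-1%g => //; rewrite invgK.
  apply: (@leq_trans (size w)); first by apply: word_length_le; exists w.
  by rewrite -ltnS; move: gn; rewrite -gw.
by rewrite big_cons.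
Qed.

(** A shortest word for [g] is cut after n letters; the triangle inequality makes both pieces
    shortest. *)
Lemma prefix_exists g n : (n <= len g)%N ->
  exists p, len p = n /\ gd p g = (len g - n)%N.
Proof.
move=> ng; have [w [wg wS gE]] := word_lengthP g.
pose p := (\big[*%g/1%g]_(x <- take n w) x)%g.
pose p' := (\big[*%g/1%g]_(x <- drop n w) x)%g.
have pp' : (p * p')%g = g by rewrite -big_cat cat_take_drop.
have [wS1 wS2] : all (fun x => (x \in S) || (x^-1%g \in S)) (take n w) /\
    all (fun x => (x \in S) || (x^-1%g \in S)) (drop n w).
  by apply/andP; rewrite -all_cat cat_take_drop.
have pn : (len p <= n)%N.
  by apply: word_length_le; exists (take n w); rewrite size_takel// wg.
have p'n : (len p' <= len g - n)%N.
  by apply: word_length_le; exists (drop n w); rewrite size_drop wg.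
have gpp : (len g <= len p + len p')%N by rewrite -pp'; exact: len_mul.
have gdp : gd p g = len p' by rewrite /gd -pp' mulKg.
by exists p; rewrite gdp; split; lia.
Qed.

End WordMetricTheory.

Lemma finite_bound (T : choiceType) (A : set T) (P : T -> nat -> Prop) :
  finite_set A -> (forall x, A x -> exists n, forall m, (n <= m)%N -> P x m) ->
  exists n, forall x, A x -> P x n.
Proof.
move=> /finite_seqP[r ->] rP.
suff [n nP] : exists n, forall x, x \in r -> forall m, (n <= m)%N -> P x m.
  by exists n => x xr; exact: nP xr n (leqnn n).
elim: r rP => [_|x r IHr rP]; first by exists 0%N.
have [y /= yr|n nP] := IHr; first by apply: rP; rewrite /= inE yr orbT.
have [n' n'P] := rP x (mem_head _ _).
exists (maxn n n') => y; rewrite inE => /orP[/eqP ->|yr] m; rewrite geq_max => /andP[? ?].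
  exact: n'P.
exact: (nP y yr).
Qed.

Lemma finite_letters (T : choiceType) (A : set T) q : finite_set A ->
  finite_set [set u : seq T | size u = q /\ forall x, x \in u -> A x].
Proof.
move=> Af; elim: q => [|q IHq].
  refine (sub_finite_set _ (finite_set1 ([::] : seq T))) => u [/size0nil -> _] //.
have := finite_image (fun xu : T * seq T => xu.1 :: xu.2) (finite_setX Af IHq).
apply: sub_finite_set => -[|x u] [] // [uq] uA; exists (x, u) => //; split=> /=.
  by apply: uA; exact: mem_head.
by split=> // y yu; apply: uA; rewrite inE yu orbT.
Qed.

Lemma finite_chains (k : finFieldType) (T : choiceType) (A : set T) :
  finite_set A -> finite_set [set c : {freeg T / k} | supp_in A c].
Proof.
move=> /finite_seqP[r0 ->]; pose r := undup r0.
pose F (f : {ffun 'I_(size r) -> k}) : {freeg T / k} :=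
  \sum_(i < size r) f i *: << tnth (in_tuple r) i >>.
have := finite_image F (finite_finset : finite_set [set: {ffun 'I_(size r) -> k}]).
apply: sub_finite_set => c /= cr.
exists [ffun i => coeff (tnth (in_tuple r) i) c] => //.
rewrite /F -[RHS]lin_id (@linE_uniq _ _ _ _ r) ?undup_uniq//; last first.
  by move=> x; rewrite mem_dom => /cr; rewrite /= mem_undup.
by rewrite [RHS]big_tnth; apply: eq_bigr => i _; rewrite ffunE.
Qed.

(** * Uniform fillings in the Rips complex *)

Section Filling.
Context {R : realType} {G : groupType} (S : seq G) (S_gen : generates S).
Context (t : {posnum R}).
Local Notation len := (word_length S).
Local Notation gd := (gd S).
Local Notation K := (rips S t).

Lemma spx_rips u : spx K u <-> u != [::] /\
  forall x y, x \in u -> y \in u -> (gd x y)%:R < t%:num :> R.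
Proof.
split=> [[u0 uP]|[u0 uP]]; split.
- case: u u0 {uP} => // /fset0Pn[x]; by rewrite !inE.
- by move=> x y xu yu; apply: uP; rewrite !inE.
- by case: u u0 {uP} => // x u _; apply/fset0Pn; exists x; rewrite !inE eqxx.
- by move=> x y; rewrite !inE => xu yu; exact: uP.
Qed.

Definition rips_scale : nat := (Num.truncn (t%:num : R)).+1.

Lemma rips_close u x y : spx K u -> x \in u -> y \in u ->
  (gd x y <= rips_scale)%N.
Proof.
move=> /spx_rips[_ uP] xu yu; rewrite -(ler_nat R) ltW//.
by apply: lt_trans (uP x y xu yu) _; exact: truncnS_gt.
Qed.

Lemma rips_dim : exists2 n, (0 < n)%N &
  forall s : {fset G}, K s -> (#|` s| <= n)%N.
Proof.
have /finite_seqP[B BE] := ball_finite S_gen rips_scale.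
exists (size B).+1 => // s Ks; have [x xs] := fset0Pn _ (simplex_neq0 Ks).
have xB y : y \in s -> (x^-1 * y)%g \in B.
  move=> ys; have : [set g | (len g <= rips_scale)%N] (x^-1 * y)%g.
    have Ks' : spx K (enum_fset s).
      rewrite /spx (_ : [fset _ in _]%fset = s)//.
      by apply/fsetP => z; rewrite !inE.
    exact: (rips_close Ks').
  by rewrite BE.
apply: leqW; rewrite -(size_map (fun y => (x^-1 * y)%g)).
apply: uniq_leq_size.
  by rewrite map_inj_uniq ?fset_uniq//; exact: mulgI.
by move=> z /mapP[y ys ->]; exact: xB.
Qed.

Context {k : finFieldType}.
Local Notation Ch V := {freeg (seq V) / k}.

Lemma spx_translate g u : spx K u -> spx K (map (fun x => (g * x)%g) u).
Proof.
move=> /spx_rips[u0 uP]; apply/spx_rips; split; first by case: (u) u0.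
by move=> x y /mapP[x' xu ->] /mapP[y' yu ->]; rewrite gdM; exact: uP.
Qed.

Hypothesis P_contr : contractible R (realization R K).

(** A ball carries finitely many tuples of given size and, [k] being finite, finitely many cycles on
    them. Each is filled by contractibility, and [rho] bounds the radii that occur. *)
Lemma fill_base q r : exists rho, forall c : Ch G,
  supp_in (fun u => [/\ size u = q.+1, spx K u &
    forall x, x \in u -> (len x <= r)%N]) c ->
  bd c = 0 ->
  exists2 d : Ch G, supp_in (fun u => [/\ size u = q.+2, spx K u &
    forall x, x \in u -> (len x <= rho)%N]) d & bd d = c.
Proof.
have [n n0 dimK] := rips_dim.
pose A := [set u : seq G | size u = q.+1 /\ forall x, x \in u -> (len x <= r)%N].
have Af : finite_set A by apply: finite_letters; exact: ball_finite.
pose P (c : Ch G) rho := supp_in (spx K) c -> bd c = 0 -> exists2 d : Ch G,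
  supp_in (fun u => [/\ size u = q.+2, spx K u &
    forall x, x \in u -> (len x <= rho)%N]) d & bd d = c.
have [c cA|rho rhoP] := @finite_bound _ _ P (finite_chains k Af); last first.
  exists rho => c cs bc; apply: rhoP => //.
    by move=> u /cs[].
  by apply: supp_inW cs => u [].
have [[cK bc]|nc] := pselect (supp_in (spx K) c /\ bd c = 0); last first.
  by exists 0%N => m _ cK bc; case: nc.
have cs : supp_in (fun u => size u = q.+1 /\ spx K u) c.
  by move=> u uc; split; [have [] := cA u uc|exact: cK].
have [d ds bd_d] := contractible_acyclic n0 dimK P_contr cs bc.
have [rho rhoP] := @finite_bound _ [set` flatten (dom d)]
  (fun x rho => (len x <= rho)%N) (finite_seq _)
  (fun x _ => ex_intro _ (len x) (fun m => id)).
exists rho => m rm _ _; exists d => // u ud; have [uq uK] := ds u ud.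
split=> // x xu; apply: leq_trans rm; apply: rhoP.
by apply/flattenP; exists u => //; rewrite mem_dom.
Qed.

(** Left translation moves the centre [g] to the identity, so one radius serves all centres. *)
Lemma fill q r : exists rho, forall (g : G) (c : Ch G),
  supp_in (fun u => [/\ size u = q, spx_or_nil K u &
    forall x, x \in u -> (gd g x <= r)%N]) c ->
  bd c = 0 ->
  exists2 d : Ch G, supp_in (fun u => [/\ size u = q.+1, spx K u &
    forall x, x \in u -> (gd g x <= rho)%N]) d & bd d = c.
Proof.
case: q => [|q].
  (* In size 0 the chain is a multiple of the empty simplex, filled by the vertex [g]; this starts
     the construction of [phi] on vertices. *)
  exists 0%N => g c cs bc; exists (cone g c); last by rewrite bd_cone bc linear0 subr0.
  apply: supp_cone cs => u [/size0nil -> _ _]; split=> //.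
    apply/spx_rips; split=> // x y; rewrite !mem_seq1 => /eqP -> /eqP ->.
    by rewrite gdxx// mulr0n.
  by move=> x; rewrite mem_seq1 => /eqP ->; rewrite gdxx.
have [rho rhoP] := fill_base q r; exists rho => g c cs bc.
have [||d ds bd_d] := rhoP (mapc (fun x => (g^-1 * x)%g) c).
- apply: supp_mapc cs => u [uq [u0|uK] ur]; first by rewrite u0 in uq.
  split; [by rewrite size_map|exact: spx_translate|].
  by move=> x /mapP[y yu ->]; exact: ur.
- by rewrite bd_mapc bc linear0.
exists (mapc (fun x => (g * x)%g) d).
  apply: supp_mapc ds => u [uq uK ur].
  split; [by rewrite size_map|exact: spx_translate|].
  by move=> x /mapP[y yu ->]; rewrite gd_mull; exact: ur.
rewrite bd_mapc bd_d mapc_comp -[RHS]mapc_id.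
by apply: (@eq_mapc _ _ _ _ _ setT) => // u _; apply: eq_map => x; rewrite /= mulKVg.
Qed.

Section Phi.
Context {V : choiceType} (h : V -> G) (C : nat).

Definition narrow (u : seq V) : Prop :=
  forall x y, x \in u -> y \in u -> (gd (h x) (h y) <= C)%N.

Lemma narrow_sub u v : narrow u -> {subset v <= u} -> narrow v.
Proof. by move=> uC vu x y /vu xu /vu yu; exact: uC. Qed.

(** Induction on skeleta: the image of the boundary of [u] is already a cycle, and [fill] extends
    the map over [u]. The size is bounded by [n] because the displacement grows with the
    dimension. *)
Lemma phi_exists n : exists rho (phi : seq V -> Ch G),
  phi [::] = << [::] >> /\ forall u, narrow u -> (size u <= n)%N ->
  bd (phi u) = lin phi (bd << u >>) /\
  supp_in (fun v => [/\ size v = size u, spx_or_nil K v &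
    forall x y, x \in v -> y \in u -> (gd (h y) x <= rho)%N]) (phi u).
Proof.
elim: n => [|n [rho [phi [phi0 phiP]]]].
  exists 0%N, (fun=> << [::] >>); split=> // u _; rewrite leqn0 => /nilP ->.
  split; first by rewrite !bdU /= linear0.
  by apply: supp_inU; split=> //; left.
(* The image of a face is within [rho] of its vertices, hence within [rho + C] of any vertex of [u].
   The filling is measured from the first vertex, and another [C] reaches the others. *)
have [rho' rho'P] := fill n (rho + C).
pose good u (d : Ch G) := narrow u /\ size u = n.+1 -> bd d = lin phi (bd << u >>) /\
  supp_in (fun v => [/\ size v = n.+1, spx_or_nil K v &
    forall x y, x \in v -> y \in u -> (gd (h y) x <= rho' + C)%N]) d.
have goodP u : exists d, good u d.
  have [[uC un]|nu] := pselect (narrow u /\ size u = n.+1); last by exists 0.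
  case: u uC un => [//|x u] uC [un].
  have faces : supp_in (fun v => narrow v /\ [/\ size v = n & {subset v <= x :: u}])
      (bd << x :: u >> : {freeg (seq V) / k}).
    rewrite bdU; apply: (supp_inW _ (supp_bd_seq (u := x :: u))) => v [[vn] vu].
    have vxu := mem_subseq vu; split; first exact: narrow_sub uC vxu.
    by split=> //; rewrite -vn un.
  have [||d ds bd_d] := rho'P (h x) (lin phi (bd << x :: u >>)).
  - apply: supp_in_lin faces => v [vC [vn vxu]].
    have [_ ] := phiP v vC (eq_leq vn).
    apply: supp_inW => w [wv wK wrho]; split=> //; first by rewrite wv.
    case: v vC vn vxu wv wrho => [|y v] vC vn vxu wv wrho z zw.
      by move/size0nil: wv zw => ->.
    rewrite addnC; apply: leq_trans (gd_tri S_gen (h x) (h y) z) _.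
    apply: leq_add; last by apply: wrho => //; exact: mem_head.
    by apply: uC; [exact: mem_head|apply: vxu; exact: mem_head].
  - rewrite lin_comp (eq_lin (F' := fun v => lin phi (bd << v >>)) _ faces).
      by rewrite lin_bd bd_bd linear0.
    by move=> v [vC [vn _]]; have [] := phiP v vC (eq_leq vn).
  exists d => _; split=> //; apply: supp_inW ds => v [vn vK vrho].
  split=> //; [by right|move=> z y zv yu].
  rewrite addnC; apply: leq_trans (gd_tri S_gen (h y) (h x) z) _.
  by apply: leq_add; [apply: uC => //; exact: mem_head|exact: vrho].
have [psi psiP] := choice goodP.
pose phi' u := if size u == n.+1 then psi u else phi u.
exists (maxn rho (rho' + C)), phi'; split=> [//|u uC].
have phi'E : lin phi' (bd << u >>) = lin phi (bd << u >>) :> Ch G \/ ~ (size u <= n.+1)%N.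
  have [un|] := leqP (size u) n.+1; last by right.
  left; rewrite bdU; apply: (eq_lin _ (supp_bd_seq (u := u))) => v [uv _].
  by rewrite /phi' ltn_eqF// -ltnS -uv ltnS.
move=> un; case: phi'E => // ->; rewrite /phi'; case: eqP => [un1|un1].
  have [-> ds] := psiP u (conj uC un1); split=> //.
  apply: supp_inW ds => v [vn vK vrho]; split=> //; first by rewrite un1.
  by move=> x y xv yu; apply: leq_trans (vrho x y xv yu) _; exact: leq_maxr.
have un' : (size u <= n)%N by move: un; rewrite leq_eqVlt => /orP[/eqP|].
have [-> ds] := phiP u uC un'; split=> //; apply: supp_inW ds => v [vn vK vrho].
split=> // x y xv yu; apply: leq_trans (vrho x y xv yu) _; exact: leq_maxl.
Qed.

End Phi.
End Filling.

Lemma ultra_finite (U : set_system nat) (T : choiceType) (A : set T)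
    (f : nat -> T) : UltraFilter U -> finite_set A -> U [set m | A (f m)] ->
  exists a, U [set m | f m = a].
Proof.
move=> UF /finite_seqP[r ->] Ur; apply: contrapT => /forallNP nU.
have nU' a : U [set m | f m <> a].
  by have [/nU|] := in_ultra_setVsetC [set m | f m = a] UF.
have : U [set m | f m \in r /\ forall a, a \in r -> f m <> a].
  apply: filterI => //; elim: (r) => [|a r' IHr].
    by apply: filterS filterT.
  apply: filterS (filterI (nU' a) IHr) => m [/= fa fr] b.
  by rewrite inE => /orP[/eqP ->|/fr].
by move=> /filter_ex[m [fr /(_ _ fr)]].
Qed.

(* Compactness of [T -> k] for the product topology. *)
Lemma cluster_fun (T : eqType) (k : finType) (c : nat -> T -> k) :
  exists c' : T -> k, forall (r : seq T) (N : nat),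
    exists2 m, (N <= m)%N & forall x, x \in r -> c' x = c m x.
Proof.
have [U [UF cofin]] := ultraFilterLemma (F := \oo) _.
have UP x : exists a, U [set m | c m x = a].
  apply: (ultra_finite (A := setT)) => //; first exact: finite_finset.
  exact: filterT.
have [c' c'P] := choice UP; exists c' => r N.
have : U [set m | (N <= m)%N /\ forall x, x \in r -> c' x = c m x].
  elim: r => [|x r IHr].
    by apply: filterS (cofin _ (nbhs_infty_ge N)) => m Nm; split.
  apply: filterS (filterI (c'P x) IHr) => m [/= cx [Nm cr]]; split=> // y.
  by rewrite inE => /orP[/eqP -> //|/cr].
by move=> /filter_ex[m [Nm cm]]; exists m.
Qed.

(** * Filling a locally finite cycle *)

Section LocallyFiniteCycle.
Context {R : realType} {G : groupType} (S : seq G) (S_gen : generates S).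
Context (t : {posnum R}) {k : finFieldType} (i : nat).
Local Notation len := (word_length S).
Local Notation gd := (gd S).
Local Notation K := (rips S t).
Hypothesis P_contr : contractible R (realization R K).
Hypothesis lim0 : trivial_homology_at_infinity S t k i.

Context {V : countType} (h : V -> G) (j : G -> V).
Hypothesis hj : cancel j h.
Hypothesis h_fin : forall n, finite_set [set v | (len (h v) <= n)%N].
Local Notation Ch V := {freeg (seq V) / k}.

Variables (C : nat) (s : i.+2.-tuple V -> k).
Hypothesis s_alt : forall (p : 'S_i.+2) u,
  s [tuple tnth u (p l) | l < i.+2] = (-1) ^+ p * s u.
Hypothesis s_supp : forall u, s u != 0 -> uniq u /\ narrow S h C u.
Hypothesis s_cycle : chain_bd s = \0.

Let lt (x y : V) := (choice.pickle x < choice.pickle y)%N.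

Let lt_trans : transitive lt. Proof. by move=> x y z; exact: ltn_trans. Qed.
Let lt_irr : irreflexive lt. Proof. by move=> x; exact: ltnn. Qed.

Definition meets m (u : seq V) : bool := has (fun x => (len (h x) <= m)%N) u.

(* The increasing tuples contain each simplex once. *)
Definition trunc_fun m (w : seq V) : k :=
  if insub w is Some u then
    if sorted lt (u : i.+2.-tuple V) && meets m u then s u else 0
  else 0.

Lemma trunc_fun_neq0 m w : trunc_fun m w != 0 ->
  [/\ size w = i.+2, narrow S h C w, sorted lt w & meets m w].
Proof.
rewrite /trunc_fun; case: insubP => [u _ <-|_]; last by rewrite eqxx.
case: ifP => [/andP[su mu]|_]; last by rewrite eqxx.
by move=> /s_supp[_ uC]; rewrite size_tuple.
Qed.

Lemma trunc_exists m : exists c : Ch V, forall w, coeff w c = trunc_fun m w.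
Proof.
apply: freeg_of_fun.
have := finite_letters i.+2 (h_fin (m + C)).
apply: sub_finite_set => w /= /trunc_fun_neq0[wi wC _ /hasP[y yw ym]].
split=> // x xw; rewrite -(gd1 S_gen).
apply: leq_trans (gd_tri S_gen _ (h y) _) _; rewrite addnC gd1//.
by apply: leq_add => //; exact: wC.
Qed.

Definition trunc m : Ch V := sval (cid (trunc_exists m)).

Lemma coeff_trunc m w : coeff w (trunc m) = trunc_fun m w.
Proof. by rewrite /trunc; case: cid. Qed.

Lemma supp_trunc m : supp_in (fun w => [/\ size w = i.+2, narrow S h C w,
  sorted lt w & meets m w]) (trunc m).
Proof. by move=> w; rewrite coeff_trunc => /trunc_fun_neq0. Qed.

(** Both sides are alternating, so it is enough to compare them on the increasing rearrangement of
    [u], where [altc_sorted] applies. *)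
Lemma altc_trunc m (u : i.+2.-tuple V) :
  altc (trunc m) u = if meets m u then s u else 0.
Proof.
have [uu|nu] := boolP (uniq u); last first.
  have s0 : s u = 0 by apply: contraNeq nu => /s_supp[].
  rewrite s0 if_same; apply: contraNeq nu.
  by case/(altc_neq0 (@supp_in_dom _ _ _)).
pose le (x y : V) := (choice.pickle x <= choice.pickle y)%N.
have le_tot : total le by move=> x y; exact: leq_total.
have srt : sorted lt (sort le u).
  have su : sorted le (sort le u) by exact: sort_sorted.
  have uu' : uniq (sort le u) by rewrite sort_uniq.
  elim: (sort le u) su uu' => // x r IHr /=; case: r IHr => // y r IHr /=.
  move=> /andP[xy yr] /andP[]; rewrite inE negb_or => /andP[nxy _] ur.
  apply/andP; split; last exact: IHr.
  rewrite /lt ltn_neqAle; apply/andP; split; last exact: xy.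
  apply: contra nxy => /eqP pxy.
  by apply/eqP/(pcan_inj choice.pickleK).
have /tuple_permP[p pE] : perm_eq (sort le u) u by rewrite perm_sort.
pose u' := [tuple tnth u (p l) | l < i.+2].
have u's : sorted lt u' by rewrite -pE.
have mu : meets m u' = meets m u.
  by apply: perm_has; rewrite -pE perm_sort.
have : altc (trunc m) u' = if meets m u' then s u' else 0.
  rewrite (altc_sorted lt_trans lt_irr _ u's); last first.
    by apply: supp_inW (supp_trunc (m := m)) => w [].
  by rewrite coeff_trunc /trunc_fun valK u's.
rewrite mu /u' altc_perm s_alt; case: (meets m u).
  by move/(congr1 (fun a => (-1) ^+ p * a)); rewrite !signrMK.
by move/(congr1 (fun a => (-1) ^+ p * a)); rewrite !signrMK mulr0.
Qed.

(** If a simplex meets the ball, so do all its cofaces; the truncation keeps them all, and the cycle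
    condition on [s] makes the coefficient vanish. *)
Lemma supp_bd_trunc m : supp_in (fun w => [/\ size w = i.+1,
  narrow S h C w & ~~ meets m w]) (bd (trunc m)).
Proof.
have bs : supp_in (fun w => [/\ size w = i.+1, narrow S h C w & sorted lt w])
    (bd (trunc m)).
  apply: supp_bd (supp_trunc (m := m)) => u v [ui uC us _] uv vu; split.
  - by move: uv; rewrite ui => -[].
  - by apply: narrow_sub uC _; exact: mem_subseq.
  - exact: subseq_sorted vu us.
move=> w wb; have [/eqP wi wC ws] := bs w wb; split=> //; first exact/eqP.
apply: contraNN wb => mw; pose v := Tuple wi.
have -> : w = tval v by [].
rewrite -(altc_sorted (v := v) lt_trans lt_irr) ?ws//; last first.
  by apply: supp_inW bs => u [].
rewrite -chain_bd_altc /chain_bd.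
rewrite (eq_fsbigr (fun x => s [tuple of x :: v])) => [|x _]; last first.
  by rewrite altc_trunc {1}/meets /= -/(meets m w) mw orbT.
by have /(congr1 (fun f => f v)) := s_cycle; rewrite /chain_bd => ->.
Qed.

Lemma supp_truncB m m' : (m <= m')%N ->
  supp_in (fun w => [/\ size w = i.+2, narrow S h C w & ~~ meets m w])
    (trunc m' - trunc m).
Proof.
move=> mm' w; rewrite coeffB !coeff_trunc => wB.
have mW : meets m w -> meets m' w.
  by move=> /hasP[x xw xm]; apply/hasP; exists x => //; exact: leq_trans mm'.
have nm : ~~ meets m w.
  apply: contraNN wB => mw; rewrite subr_eq0 /trunc_fun.
  case: insubP => // u _ uw; move: mw (mW mw); rewrite -uw => -> ->.
  by rewrite !andbT.
have w0 : trunc_fun m w = 0.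
  by apply: contraNeq nm => /trunc_fun_neq0[].
by rewrite w0 subr0 in wB; have [] := trunc_fun_neq0 wB.
Qed.

Lemma far_of_near m r x y : (m + r < len x)%N -> (gd x y <= r)%N ->
  (m < len y)%N.
Proof.
move=> mx xy; rewrite -(ltn_add2r r); apply: leq_trans mx _.
rewrite -(gd1 S_gen x); apply: leq_trans (gd_tri S_gen _ y _) _.
by rewrite addnC gd1// leq_add2l.
Qed.

Lemma rips_ballP m x : ~ (word_dist R S x 1%g <= m%:R) <-> (m < len x)%N.
Proof.
rewrite /word_dist mulg1 len_inv// ler_nat ltnNge; split; first by move/negP.
exact: negP.
Qed.

(* Up to a boundary, [s] agrees on any ball with a chain that is far away: push
   a truncation of [s] to the Rips complex, where its boundary is a thread of
   cycles at infinity. *)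
Lemma fill_trunc : exists T', forall m, exists c : Ch V,
  supp_in (fun u => size u = i.+3 /\ narrow S h T' u) c /\
  forall v : i.+2.-tuple V, meets m v -> altc (bd c) v = s v.
Proof.
have [rho [phi [phi0 phiP]]] := phi_exists (k := k) S_gen P_contr h C i.+2.
have [N N0 dimK] := rips_dim S_gen t.
pose tn := rips_scale t; pose rr := maxn rho C.
pose P u := narrow S h C u /\ (size u <= i.+2)%N.
have P_sub u v : P u -> subseq v u -> P v.
  move=> [uC ui] vu; split; first by apply: narrow_sub uC _; exact: mem_subseq.
  exact: leq_trans (size_subseq vu) ui.
have bd_phi c : supp_in P c -> bd (lin phi c) = lin phi (bd c).
  move=> cP; rewrite lin_comp -lin_bd; apply: (eq_lin _ cP) => u [uC ui].
  by have [] := phiP u uC ui.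
pose W m := [set x | word_dist R S x 1%g <= m%:R].
have phi_far q m c : (q.+1 <= i.+2)%N ->
    supp_in (fun w => [/\ size w = q.+1, narrow S h C w & ~~ meets (m + rho) w]) c ->
    supp_in (fun u => [/\ size u = q.+1, spx K u & forall x, x \in u -> ~ W m x])
      (lin phi c).
  move=> qi; apply: supp_in_lin => u [uq uC um].
  have [|_] := phiP u uC; first by rewrite uq.
  apply: supp_inW => v [vu vK vrho]; rewrite uq in vu; split=> //.
    by case: vK => // v0; rewrite v0 in vu.
  move=> x xv; apply/rips_ballP; case: u uq uC um vu vrho => // y u uq uC um vu vrho.
  have yu := mem_head y u; apply: (@far_of_near _ rho (h y)); last exact: vrho.
  by rewrite ltnNge; apply: contra um => ym; apply/hasP; exists y.
(* The shift by [rho] pays for the displacement of [phi]: the image of [b m] avoids the ball of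
   radius m. *)
pose b m := bd (trunc (m + rho)).
pose beta m := lin phi (b m).
pose eps m := lin phi (trunc (m.+1 + rho) - trunc (m + rho)).
have truncP m : supp_in P (trunc m).
  by apply: supp_inW (supp_trunc (m := m)) => u [ui uC _ _]; split; rewrite ?ui.
have bP m : supp_in P (b m).
  by apply: supp_inW (supp_bd_trunc (m := m + rho)) => u [ui uC _]; split; rewrite ?ui.
have betaE m : beta m = bd (lin phi (trunc (m + rho))) by rewrite bd_phi.
have betas m := phi_far i m _ (leqW (leqnn _)) (supp_bd_trunc (m := m + rho)).
have bd_beta m : bd (beta m) = 0 by rewrite betaE bd_bd.
have epss m := phi_far i.+1 m _ (leqnn _)
  (supp_truncB (leq_add (leqnSn m) (leqnn rho))).
have bd_eps m : beta m.+1 - beta m = bd (eps m).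
  by rewrite !betaE /eps !linearB.
have WS m : W m `<=` W m.+1.
  by move=> x /le_trans; apply; rewrite ler_nat.
have wP := thread_acyclic N0 dimK WS lim0 betas bd_beta epss bd_eps.
pose a u := mapc j (phi u).
have a0 : a [::] = << [::] >> by rewrite /a phi0 mapcU.
have bd_a u : P u -> bd (a u) = lin a (bd << u >>).
  move=> [uC ui]; rewrite bd_mapc; have [-> _] := phiP u uC ui.
  exact: lin_comp.
pose L (u : seq V) (x : V) := exists2 y, y \in u & (gd (h y) (h x) <= rr)%N.
have L_self u x : P u -> x \in u -> L u x.
  by move=> _ xu; exists x => //; rewrite gdxx.
have L_sub u v x : P u -> subseq v u -> L v x -> L u x.
  by move=> _ vu [y yv yx]; exists y => //; exact: (mem_subseq vu).
have a_supp u : P u ->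
    supp_in (fun v => size v = size u /\ forall x, x \in v -> L u x) (a u).
  move=> [uC ui]; have [_ us] := phiP u uC ui.
  apply: supp_mapc us => v [vu _ vrho]; split; first by rewrite size_map.
  move=> x /mapP[z zv ->]; case: u {uC ui} vu vrho => [|y u] vu vrho.
    by rewrite (size0nil vu) in zv.
  exists y; rewrite ?mem_head// hj; apply: leq_trans (vrho z y zv (mem_head _ _)) _.
  exact: leq_maxl.
have homot_s := supp_homot P_sub L_self L_sub a_supp.
have bd_h := bd_homot P_sub a0 bd_a.
(* The homotopy spreads a simplex of diameter [C] by [rr] at both ends, and simplices of the Rips
   complex have diameter at most [tn]; neither depends on m. In [M], [tn] is kept for the vertices
   of [w], known only to share a simplex with a vertex outside the ball, and [rr] for the homotopy
   on [b M]. *)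
exists (maxn (rr + C + rr) tn) => m; pose M := (m + tn + rr)%N.
have [w ws bw] := wP M.
have ws' : supp_in (fun u => size u = i.+2 /\ spx K u) w.
  by apply: supp_inW ws => u [].
pose y := lin phi (trunc (M + rho)) - w.
have ys : supp_in (fun u => size u = i.+2 /\ spx K u) y.
  apply: supp_inB => //; apply: supp_in_lin (supp_trunc (m := M + rho)) => u [ui uC _ _].
  have [|_] := phiP u uC; first by rewrite ui.
  apply: supp_inW => v [vu vK _]; rewrite ui in vu; split=> //.
  by case: vK => // v0; rewrite v0 in vu.
have by0 : bd y = 0 by rewrite linearB /= bw bd_phi ?subrr.
have [u us bu] := contractible_acyclic N0 dimK P_contr ys by0.
exists (lin (homot a) (trunc (M + rho)) + mapc j u); split.
  apply: supp_inD.
    apply: supp_in_lin (supp_trunc (m := M + rho)) => x [xi xC _ _].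
    have Px : P x by split; rewrite ?xi.
    apply: supp_inW (homot_s x Px) => v [vx vL]; split; first by rewrite vx xi.
    move=> z z' /vL[z1 z1x z1z] /vL[z2 z2x z2z]; apply: leq_trans (leq_maxl _ _).
    apply: leq_trans (gd_tri S_gen _ (h z2) _) _; apply: leq_add => //.
    apply: leq_trans (gd_tri S_gen _ (h z1) _) _; rewrite gdC//.
    by apply: leq_add => //; exact: xC.
  apply: supp_mapc us => v [vi vK]; split; first by rewrite size_map.
  move=> z z' /mapP[x xv ->] /mapP[x' x'v ->]; rewrite !hj.
  by apply: leq_trans (leq_maxr _ _); exact: (rips_close vK).
move=> v mv.
have aE : lin a (trunc (M + rho)) = mapc j (lin phi (trunc (M + rho))).
  by apply/esym; exact: lin_comp.
(* The image of the truncation cancels between the homotopy formula and [bd u]. The two corrections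
   that remain avoid the ball of radius m. *)
have -> : bd (lin (homot a) (trunc (M + rho)) + mapc j u) =
    trunc (M + rho) - mapc j w - lin (homot a) (b M).
  rewrite linearD /= bd_h// bd_mapc bu aE linearB /=.
  by apply/eqP/freeg_eqP => x; rewrite !(coeffD, coeffN) /b; ring.
rewrite !altcB altc_trunc.
have -> : meets (M + rho) v.
  case/hasP: mv => x xv xm; apply/hasP; exists x => //.
  by apply: leq_trans xm _; rewrite /M -!addnA leq_addr.
have far0 (c : Ch V) (Q : seq V -> Prop) : supp_in Q c ->
    (forall u x, Q u -> x \in u -> (m < len (h x))%N) -> altc c v = 0.
  move=> cQ Qfar; apply/eqP; apply: contraTT mv => cv.
  have [_ [z [Qz _ zv]]] := altc_neq0 cQ cv.
  by apply/hasPn => x xv; rewrite -ltnNge; apply: Qfar Qz _; rewrite zv.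
have ws2 : supp_in (fun v : seq V => forall x, x \in v -> (m < len (h x))%N) (mapc j w).
  apply: supp_mapc ws => z [_ _ zW] x /mapP[x' x'z ->]; rewrite hj.
  have [f [fK x'f [y' y'f /rips_ballP y'M]]] := zW x' x'z.
  apply: (@far_of_near _ tn y').
    by apply: leq_trans y'M; rewrite ltnS /M leq_addr.
  apply: (@rips_close _ _ _ t (enum_fset f)) => //.
  rewrite /spx (_ : [fset _ in _]%fset = f)//.
  by apply/fsetP => x2; rewrite !inE.
have hs2 : supp_in (fun v : seq V => forall x, x \in v -> (m < len (h x))%N)
    (lin (homot a) (b M)).
  apply: supp_in_lin (supp_bd_trunc (m := M + rho)) => z [zi zC zm].
  have Pz : P z by split; rewrite ?zi.
  apply: supp_inW (homot_s z Pz) => v' [_ v'L] x /v'L[y' y'z y'x].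
  apply: (@far_of_near _ rr (h y')) y'x; rewrite ltnNge; apply: contra zm => y'm.
  apply/hasP; exists y' => //; apply: leq_trans y'm _.
  by rewrite /M; lia.
rewrite (far0 _ _ ws2) => [|u' x Qu' xu']; last exact: Qu'.
rewrite (far0 _ _ hs2) => [|u' x Qu' xu']; last exact: Qu'.
by rewrite !subr0.
Qed.

(** Each condition at a given tuple involves finitely many values of [c], which agree with those of
    some [cs m] with m as large as desired. For the boundary at [v] this rests on [T'] being the
    same for all m: every coface has its extra vertex in the fixed finite list [r]. *)
Lemma locally_finite_cycle_bounds : exists T' (c : i.+3.-tuple V -> k),
  [/\ forall u, c u != 0 -> uniq u /\ narrow S h T' u,
      forall (p : 'S_i.+3) u,
        c [tuple tnth u (p l) | l < i.+3] = (-1) ^+ p * c u &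
      chain_bd c = s].
Proof.
have [T' T'P] := fill_trunc; have [cs csP] := choice T'P.
have [c cP] := cluster_fun (fun m => altc (cs m) : i.+3.-tuple V -> k).
have cs_supp m (u : i.+3.-tuple V) : altc (cs m) u != 0 ->
    uniq u /\ narrow S h T' u.
  have [csm _] := csP m => /(altc_neq0 csm)[uu [v [[_ vT] _ vu]]]; split=> //.
  by move=> x y xu yu; apply: vT; rewrite vu.
have c_supp u : c u != 0 -> uniq u /\ narrow S h T' u.
  by have [m _ ->] := cP [:: u] 0%N; [exact: cs_supp|exact: mem_head].
exists T', c; split=> //.
  move=> p u; have [m _ cm] := cP [:: u; [tuple tnth u (p l) | l < i.+3]] 0%N.
  by rewrite !cm ?altc_perm// !inE eqxx ?orbT.
apply/funext => v; pose v0 := thead v.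
have /finite_seqP[r0 r0E] := h_fin (len (h v0) + T').
pose r := undup r0.
have rP x : narrow S h T' (x :: v) -> x \in r.
  move=> vT; rewrite mem_undup.
  suff : [set v | (len (h v) <= len (h v0) + T')%N] x by rewrite r0E.
  rewrite /= -(gd1 S_gen) -(gd1 S_gen (h v0)) addnC.
  apply: leq_trans (gd_tri S_gen _ (h v0) _) _; rewrite leq_add2r.
  by apply: vT; rewrite ?mem_head// inE mem_tnth orbT.
have [m mv cm] := cP [seq [tuple of x :: v] | x <- r] (len (h v0)).
have mm : meets m v by apply/hasP; exists v0; rewrite ?mem_tnth.
have [csm csb] := csP m; rewrite -(csb v mm) -chain_bd_altc /chain_bd.
rewrite (fsbigTE [fset x in r]%fset); last first.
  by move=> x; rewrite !inE => xr; apply: contraNeq xr => /c_supp[_ /rP].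
rewrite (fsbigTE [fset x in r]%fset); last first.
  by move=> x; rewrite !inE => xr; apply: contraNeq xr => /cs_supp[_ /rP].
rewrite !big_seq; apply: eq_bigr => x; rewrite !inE => xr.
by apply: cm; exact: map_f.
Qed.

End LocallyFiniteCycle.

(** * The Gromov boundary *)

Section GromovBoundary.
Context {R : realType} {G : groupType} (S : seq G) (S_gen : generates S).
Local Notation len := (word_length S).
Local Notation gd := (gd S).
Local Notation d := (word_dist R S).
Local Notation bdG := (boundary d 1%g).
Local Notation gp := (gromov_product d 1%g).

Lemma gpE x y : gp x y = ((len x)%:R + (len y)%:R - (gd x y)%:R) / 2.
Proof. by rewrite /gromov_product /word_dist !mulg1 !len_inv. Qed.

Lemma gpC x y : gp x y = gp y x.
Proof. by rewrite !gpE gdC//; congr (_ / 2); ring. Qed.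

Lemma gpxx x : gp x x = (len x)%:R.
Proof. by rewrite gpE gdxx//; field. Qed.

Lemma gp_ge0 x y : 0 <= gp x y.
Proof.
have : (gd x y <= len x + len y)%N.
  by rewrite -(gd1 S_gen x) -(gd1 S_gen y) (gdC S_gen y); exact: gd_tri.
by rewrite gpE -(ler_nat R) natrD; lra.
Qed.

(** The bound on n stands under the quantifier on [p] so that [choice] gives a total function. *)
Lemma prefixP g n : exists p, (n <= len g)%N -> len p = n /\ gp p g = n%:R.
Proof.
have [ng|] := leqP n (len g); last by exists g.
have [p [pn pg]] := prefix_exists S_gen ng; exists p => _; split=> //.
by rewrite gpE pg pn natrB//; field.
Qed.

Variable delta : R.
Hypothesis gp_hyp : forall x y z, Num.min (gp x y) (gp y z) - delta <= gp x z.

Lemma gp_tri r x y z : r <= gp x y -> r <= gp y z -> r - delta <= gp x z.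
Proof.
move=> xy yz; apply: le_trans (gp_hyp x y z).
by rewrite lerD2r le_min xy.
Qed.

Lemma delta_ge0 : 0 <= delta.
Proof. by have := gp_hyp 1%g 1%g 1%g; rewrite minxx; lra. Qed.

Lemma rep_exists (xi : bdG) : exists x, xi x.
Proof. by case: xi => b /= [x xinf ->]; exists x; split. Qed.

Definition rep (xi : bdG) : nat -> G := sval (cid (rep_exists xi)).

Lemma repP (xi : bdG) : xi (rep xi). Proof. by rewrite /rep; case: cid. Qed.

Lemma rep_infty (xi : bdG) : to_infinity d 1%g (rep xi).
Proof.
have := repP xi; case: xi => b bP; rewrite /rep /=; case: cid => y /=.
by case: (bP) => x xinf bE; rewrite bE => -[].
Qed.

Lemma asymptotic_class (xi : bdG) x y : xi x -> xi y -> asymptotic d 1%g x y.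
Proof.
case: xi => b /= [z zinf ->] [xinf zx] [yinf zy] r.
have [N1 xN1] := zx (r + delta); have [N2 yN2] := zy (r + delta).
exists (maxn N1 N2) => m n; rewrite !geq_max => /andP[m1 m2] /andP[n1 n2].
rewrite -[leLHS](addrK delta); apply: (gp_tri (y := z (maxn N1 N2))).
  by rewrite gpC; apply: xN1; rewrite ?leq_maxl.
by apply: yN2; rewrite ?leq_maxr.
Qed.

(* Another choice of representatives changes [r] by a multiple of [delta]. *)
Definition near_pt (g : G) (xi : bdG) (r : R) : Prop :=
  exists N, forall m, (N <= m)%N -> r <= gp g (rep xi m).

Definition near_bd (xi eta : bdG) (r : R) : Prop :=
  eventually_close d 1%g (rep xi) (rep eta) r.

Lemma near_ptW g xi r s : s <= r -> near_pt g xi r -> near_pt g xi s.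
Proof. by move=> sr [N NP]; exists N => m /NP; exact: le_trans. Qed.

Lemma near_bdW xi eta r s : s <= r -> near_bd xi eta r -> near_bd xi eta s.
Proof. by move=> sr [N NP]; exists N => m n mN /(NP _ _ mN); exact: le_trans. Qed.

Lemma near_pt0 g xi : near_pt g xi 0.
Proof. by exists 0%N => m _; exact: gp_ge0. Qed.

Lemma near_bd0 xi eta : near_bd xi eta 0.
Proof. by exists 0%N => m n _ _; exact: gp_ge0. Qed.

Lemma near_bdC xi eta r : near_bd xi eta r -> near_bd eta xi r.
Proof. by move=> [N NP]; exists N => m n mN nN; rewrite gpC; exact: NP. Qed.

Lemma near_bd_refl xi r : near_bd xi xi r.
Proof. exact: rep_infty. Qed.

Lemma near_bd_pt g xi eta r : near_pt g xi r -> near_pt g eta r ->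
  near_bd xi eta (r - delta).
Proof.
move=> [N1 N1P] [N2 N2P]; exists (maxn N1 N2) => m n.
rewrite !geq_max => /andP[mN1 _] /andP[_ nN2].
by apply: (gp_tri (y := g)); [rewrite gpC; exact: N1P|exact: N2P].
Qed.

Lemma near_bd_trans xi eta zeta r : near_bd xi eta r -> near_bd eta zeta r ->
  near_bd xi zeta (r - delta).
Proof.
move=> [N1 N1P] [N2 N2P]; exists (maxn N1 N2) => m n.
rewrite !geq_max => /andP[mN1 _] /andP[_ nN2].
apply: (gp_tri (y := rep eta (maxn N1 N2))).
  by apply: N1P; rewrite ?leq_maxl.
by apply: N2P; rewrite ?leq_maxr.
Qed.

Lemma near_pt_bd g xi eta r : near_pt g xi r -> near_bd xi eta r ->
  near_pt g eta (r - delta).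
Proof.
move=> [N1 N1P] [N2 N2P]; exists N2 => n nN2.
apply: (gp_tri (y := rep xi (maxn N1 N2))).
  by apply: N1P; rewrite leq_maxl.
by apply: N2P; rewrite ?leq_maxr.
Qed.

Lemma near_pt_gp g g' xi r : r <= gp g g' -> near_pt g xi r ->
  near_pt g' xi (r - delta).
Proof.
move=> gg' [N NP]; exists N => m /NP; apply: gp_tri.
by rewrite gpC.
Qed.

Lemma gp_near_pt g g' xi r : near_pt g xi r -> near_pt g' xi r ->
  r - delta <= gp g g'.
Proof.
move=> [N1 N1P] [N2 N2P]; apply: (gp_tri (y := rep xi (maxn N1 N2))).
  by apply: N1P; rewrite leq_maxl.
by rewrite gpC; apply: N2P; rewrite leq_maxr.
Qed.

(** One [delta] is lost for each of the two changes of representative. *)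
Lemma boundary_nbhd_near xi eta r : boundary_nbhd xi r eta ->
  near_bd xi eta (r - delta - delta).
Proof.
move=> [x [y [xix etay [N NP]]]].
have [N1 N1P] := asymptotic_class (repP xi) xix r.
have [N2 N2P] := asymptotic_class etay (repP eta) r.
pose M := maxn N (maxn N1 N2).
have [NM N1M N2M] : [/\ (N <= M)%N, (N1 <= M)%N & (N2 <= M)%N].
  by rewrite /M; split; lia.
exists M => m n Mm Mn; have d0 := delta_ge0.
apply: (gp_tri (y := y M)).
  apply: (gp_tri (y := x M)); last exact: NP.
  by apply: N1P => //; lia.
by apply: le_trans (N2P M n N2M _); [lra|lia].
Qed.

Lemma near_boundary_nbhd xi eta r : near_bd xi eta r -> boundary_nbhd xi r eta.
Proof. by move=> xe; exists (rep xi), (rep eta); split=> //; exact: repP. Qed.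

Lemma nbhs_near xi (U : set bdG) : nbhs xi U ->
  exists r, forall eta, near_bd xi eta r -> U eta.
Proof.
rewrite nbhsE => -[W [oW Wxi] WU]; have [r rW] := oW _ Wxi.
by exists r => eta /near_boundary_nbhd/rW/WU.
Qed.

(** The set itself need not be open. Its points that have all their own close neighbours in it form
    an open set, since [near_bd_trans] loses only a [delta]. *)
Lemma near_nbhs (xi : bdG) r : nbhs xi [set eta | near_bd xi eta r].
Proof.
have d0 := delta_ge0.
rewrite nbhsE; exists [set eta | exists s, forall zeta, near_bd eta zeta s ->
  near_bd xi zeta r]; last first.
  by move=> eta [s sP]; apply: sP; exact: near_bd_refl.
split; last by exists r.
move=> eta [s sP]; exists (s + delta + delta + delta) => eta' /boundary_nbhd_near eta'e.
exists (s + delta) => zeta ez; apply: sP; rewrite -[s](addrK delta).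
by apply: (near_bd_trans (eta := eta')) => //; apply: near_bdW eta'e; lra.
Qed.

Lemma ray_exists xi n : exists p, len p = n /\ near_pt p xi (n%:R - delta).
Proof.
have [N NP] := rep_infty xi n%:R.
have [p pP] := prefixP (rep xi N) n; have [|pn pg] := pP.
  by have := NP N N (leqnn _) (leqnn _); rewrite gpxx ler_nat.
exists p; split=> //; exists N => m Nm; apply: (gp_tri (y := rep xi N)).
  by rewrite pg.
exact: NP.
Qed.

Lemma nat_above (r : R) : exists N : nat, r <= N%:R.
Proof. by exists (Num.truncn r).+1; apply: ltW; exact: truncnS_gt. Qed.

Section Compactness.
Variable U : set_system nat.
Hypotheses (UF : UltraFilter U) (U_oo : forall N, U [set m | (N <= m)%N]).

(** Balls are finite, so along the ultrafilter the prefix of length n of [g j] is a fixed [y n]. Any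
    two of the [y n] are prefixes of a common [g j], hence close, and [y] represents the limit. *)
Lemma limit_point (g : nat -> G) : (forall n, U [set j | (n <= len (g j))%N]) ->
  exists xi : bdG, forall r, U [set j | near_pt (g j) xi r].
Proof.
move=> g_oo; have d0 := delta_ge0.
have [pr prP] := choice (fun gn : G * nat => prefixP gn.1 gn.2).
have Upr n : exists a, U [set j | pr (g j, n) = a].
  apply: (ultra_finite UF (ball_finite S_gen n)).
  by apply: filterS (g_oo n) => j /= nj; have [/= -> _] := prP (g j, n) nj.
have [y yP] := choice Upr.
have Uy n : U [set j | gp (y n) (g j) = n%:R].
  apply: filterS (filterI (yP n) (g_oo n)) => j /= [<- nj].
  by have [] := prP (g j, n) nj.
have yinf : to_infinity d 1%g y.
  move=> r; have [N rN] := nat_above (r + delta); exists N => m n mN nN.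
  have [j /= [jm jn]] := filter_ex (filterI (Uy m) (Uy n)).
  rewrite -[leLHS](addrK delta); apply: (gp_tri (y := g j)).
    by rewrite jm (le_trans rN)// ler_nat.
  by rewrite gpC jn (le_trans rN)// ler_nat.
pose xi : bdG := Boundary (ex_intro2 _ _ y yinf erefl).
exists xi => r; have xiy : xi y by split.
have [N1 N1P] := asymptotic_class xiy (repP xi) (r + delta).
have [N rN] := nat_above (r + delta).
apply: filterS (Uy (maxn N N1)) => j /= jy; exists N1 => m mN1.
rewrite -[leLHS](addrK delta); apply: (gp_tri (y := y (maxn N N1))).
  by rewrite gpC jy (le_trans rN)// ler_nat leq_maxl.
by apply: N1P => //; exact: leq_maxr.
Qed.

Lemma limit_boundary (a : nat -> bdG) :
  exists xi : bdG, forall r, U [set j | near_bd xi (a j) r].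
Proof.
have [g gP] := choice (fun j => ray_exists (a j) j).
have [n|xi xiP] := @limit_point g.
  by apply: filterS (U_oo n) => j /= nj; have [-> _] := gP j.
exists xi => r; have [N rN] := nat_above (r + delta + delta).
apply: filterS (filterI (U_oo N) (xiP (r + delta))) => j /= [Nj gxi].
rewrite -[r](addrK delta); apply: (near_bd_pt gxi).
have [_] := gP j; apply: near_ptW.
by move: Nj; rewrite -(ler_nat R); lra.
Qed.

End Compactness.

Lemma ultra_oo : exists U : set_system nat, UltraFilter U /\
  forall N, U [set m | (N <= m)%N].
Proof.
have [U [UF Uoo]] := ultraFilterLemma (F := \oo) _.
by exists U; split=> // N; apply: Uoo; exact: nbhs_infty_ge.
Qed.

Section Metric.
Variables (X : metricType R) (f : X -> bdG) (f' : bdG -> X).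
Hypotheses (fK : cancel f f') (f'K : cancel f' f).
Hypotheses (f_cont : continuous f) (f'_cont : continuous f').

Lemma near_mdist xi (e : R) : 0 < e -> exists r, forall a, near_bd xi (f a) r ->
  mdist (f' xi) a < e.
Proof.
move=> e0; have [r rP] := nbhs_near (f'_cont (nbhsx_ballx (f' xi) e e0)).
by exists r => a /rP /=; rewrite fK ballEmdist.
Qed.

Lemma mdist_near xi r : exists2 e : R, 0 < e &
  forall a, mdist (f' xi) a < e -> near_bd xi (f a) r.
Proof.
have : nbhs (f (f' xi)) [set eta | near_bd xi eta r].
  by rewrite f'K; exact: near_nbhs.
move=> /f_cont/nbhs_ballP[e e0 eP]; exists e => // a xa; apply: eP.
by rewrite ballEmdist.
Qed.

(** Counterexamples at scale 1/(j+1) would accumulate, along an ultrafilter, at a point where the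
    continuity of [f] fails. [mdist_unif] is the same argument for [f']. *)
Lemma near_bd_unif r : exists2 e : R, 0 < e &
  forall a b, mdist a b < e -> near_bd (f a) (f b) r.
Proof.
apply: contrapT => nP.
have abP (j : nat) : exists ab : X * X, mdist ab.1 ab.2 < j.+1%:R^-1 /\
    ~ near_bd (f ab.1) (f ab.2) r.
  apply: contrapT => /forallNP nab; apply: nP; exists j.+1%:R^-1.
    by rewrite invr_gt0.
  by move=> a b ab; apply: contrapT => nn; apply: (nab (a, b)).
have [ab {}abP] := choice abP; have [U [UF Uoo]] := ultra_oo.
have [xi xiP] := limit_boundary UF Uoo (fun j => f (ab j).1).
have [e e0 eP] := mdist_near xi (r + delta).
have e20 : 0 < e / 2 by rewrite divr_gt0.
have [s sP] := near_mdist xi e20.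
have [N Ne] := nat_above (2 / e).
have UN := Uoo N; have Ur := xiP (r + delta); have Us := xiP s.
have [j /= [[jN jr] js]] := filter_ex (filterI (filterI UN Ur) Us).
have [jab] := abP j; apply; rewrite -[r](addrK delta).
apply: near_bd_trans (near_bdC jr) _; apply: eP.
apply: le_lt_trans (metric_triangle _ (ab j).1 _) _.
rewrite [ltRHS]splitr; apply: ltrD; first exact: sP.
apply: lt_trans jab _.
rewrite -[e / 2]invrK ltf_pV2 ?posrE ?invr_gt0// invf_div.
by apply: le_lt_trans Ne _; rewrite ltr_nat ltnS.
Qed.

Lemma mdist_unif (e : R) : 0 < e -> exists r,
  forall a b, near_bd (f a) (f b) r -> mdist a b < e.
Proof.
move=> e0; apply: contrapT => nP.
have abP (j : nat) : exists ab : X * X, near_bd (f ab.1) (f ab.2) j%:R /\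
    ~ mdist ab.1 ab.2 < e.
  apply: contrapT => /forallNP nab; apply: nP; exists j%:R => a b ab.
  by apply: contrapT => nn; apply: (nab (a, b)).
have [ab {}abP] := choice abP; have [U [UF Uoo]] := ultra_oo.
have [xi xiP] := limit_boundary UF Uoo (fun j => f (ab j).1).
have e20 : 0 < e / 2 by rewrite divr_gt0.
have [s sP] := near_mdist xi e20; have d0 := delta_ge0.
have [N sN] := nat_above (s + delta).
have UN := Uoo N; have Us := xiP (s + delta).
have [j /= [jN js]] := filter_ex (filterI UN Us).
have [jab] := abP j; apply.
apply: le_lt_trans (metric_triangle _ (f' xi) _) _.
rewrite [ltRHS]splitr; apply: ltrD.
  by rewrite metric_sym; apply: sP; apply: near_bdW js; lra.
apply: sP; rewrite -[s](addrK delta); apply: near_bd_trans js _.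
by apply: near_bdW jab; apply: le_trans sN _; rewrite ler_nat.
Qed.

End Metric.

Lemma unbounded_seq (A : set G) : ~ finite_set A ->
  exists g : nat -> G, forall j, A (g j) /\ (j < len (g j))%N.
Proof.
move=> Ainf; suff gP (j : nat) : exists g, A g /\ (j < len g)%N.
  by have [g {}gP] := choice gP; exists g.
apply: contrapT => /forallNP nA; apply: Ainf.
have := ball_finite S_gen j; apply: sub_finite_set => g Ag /=.
by rewrite leqNgt; apply/negP => jg; apply: (nA g).
Qed.

(** [psi g] is taken as near to [g] as boundary points get, up to level [len g]. Infinitely many
    exceptions would contain a sequence accumulating at some [xi], which is itself near enough to
    one of them, against the choice of [psi]. *)
Lemma boundary_shadow (xi0 : bdG) : exists psi : G -> bdG,
  forall N : nat, finite_set [set g | ~ near_pt g (psi g) N%:R].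
Proof.
(* The restriction to n at most [len g] leaves finitely many levels, so there is a highest one
   attained. *)
have psiP g : exists xi, forall n : nat, (n <= len g)%N ->
    (exists eta, near_pt g eta n%:R) -> near_pt g xi n%:R.
  pose P n := `[< exists eta, near_pt g eta n%:R >].
  suff H m : exists xi, forall n, (n <= m)%N ->
    (exists eta, near_pt g eta n%:R) -> near_pt g xi n%:R by exact: H.
  elim: m => [|m [xi xiP]].
    by exists xi0 => n; rewrite leqn0 => /eqP -> _; exact: near_pt0.
  have [[eta etaP]|neta] := pselect (exists eta, near_pt g eta m.+1%:R).
    exists eta => n nm _; apply: near_ptW etaP; by rewrite ler_nat.
  exists xi => n; rewrite leq_eqVlt => /orP[/eqP ->|]; first by move/neta.
  exact: xiP.
have [psi {}psiP] := choice psiP; exists psi => N.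
apply: contrapT => /unbounded_seq[g gP]; have [U [UF Uoo]] := ultra_oo.
have [n|xi xiP] := limit_point UF (g := g).
  by apply: filterS (Uoo n) => j /= nj; have [_ /ltnW] := gP j; exact: leq_trans.
have [j /= [jN jxi]] := filter_ex (filterI (Uoo N) (xiP N%:R)).
have [ngj jg] := gP j; apply: ngj; apply: psiP; last by exists xi.
exact: leq_trans jN (ltnW jg).
Qed.

End GromovBoundary.

(** * Pulled-back complexes *)

Lemma finite_fsets (T : choiceType) (A : set T) : finite_set A ->
  finite_set [set s : {fset T} | forall x, x \in s -> A x].
Proof.
move=> /finite_fsetP[F ->]; have := finite_fset (fpowerset F).
apply: sub_finite_set => s sF /=; rewrite fpowersetE.
by apply/fsubsetP => x /sF.
Qed.

Lemma slow_function (V : countType) (K : simplicial_complex V) (F : nat -> set V) :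
  locally_finite K -> (forall N, finite_set (F N)) ->
  exists n : V -> nat,
    [/\ forall N, finite_set [set v | (n v <= N)%N],
        forall s x y, K s -> x \in s -> y \in s -> (n y <= (n x).+1)%N &
        forall v N, (N < n v)%N -> ~ F N v].
Proof.
move=> lfK Ff.
pose nbr (W : set V) := [set y | exists s x, [/\ K s, x \in s, y \in s & W x]].
(* [n v] will be the first stage that contains [v]. Neighbours are added so that [n] grows by at
   most 1 along edges, [F] so that [n] is at most N on [F N], and an initial piece of the
   enumeration so that every vertex is reached. *)
pose W := fix W N : set V := if N is M.+1 then
  (W M `|` nbr (W M)) `|` (F M.+1 `|` [set v | (choice.pickle v <= M)%N]) else F 0%N.
have Wf N : finite_set (W N).
  elim: N => [|N IHN] /=; first exact: Ff.
  rewrite !finite_setU; split; split=> //.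
    have : finite_set (\bigcup_(x in W N)
        \bigcup_(s in [set s | K s /\ x \in s]) [set` s]).
      apply: bigcup_finite => // x _; apply: bigcup_finite; first exact: lfK.
      by move=> s _; exact: finite_fset.
    apply: sub_finite_set => y [s [x [Ks xs ys Wx]]].
    by exists x => //; exists s.
  have pick_inj : {in @choice.pickle V @^-1` `I_N.+1 &, injective (@choice.pickle V)}.
    by move=> x y _ _; exact: (pcan_inj choice.pickleK).
  exact: finite_preimage pick_inj (finite_II N.+1).
have WS N : W N `<=` W N.+1 by move=> v Wv; left; left.
have Wmono N M : (N <= M)%N -> W N `<=` W M.
  by move=> /subnKC <-; elim: (M - N)%N => [|m IHm]; rewrite ?addn0// addnS;
    exact: subset_trans IHm (WS _).
have Wex v : exists N, `[< W N v >].
  by exists (choice.pickle v).+1; apply/asboolP; right; right => /=.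
pose n v := ex_minn (Wex v).
have nW v : W (n v) v by rewrite /n; case: ex_minnP => m /asboolP.
have n_le v N : W N v -> (n v <= N)%N.
  by move=> WNv; rewrite /n; case: ex_minnP => m _; apply; exact/asboolP.
exists n; split.
- move=> N; refine (sub_finite_set _ (Wf N)) => v nvN.
  exact: (Wmono _ _ nvN v (nW v)).
- move=> s x y Ks xs ys; apply: n_le; left; right.
  by exists s, x; split.
- move=> v N; rewrite ltnNge => /negP nv Fv; apply: nv; apply: n_le.
  by case: N Fv => [//|N] Fv; right; left.
Qed.

Section ChainImage.
Context {V W : choiceType} {k : nzRingType} (j : V -> W).
Hypothesis j_inj : injective j.

Lemma map_tuple_inj q : injective (map_tuple (n := q) j).
Proof.
by move=> u v /(congr1 (@tval _ _)) /= /(inj_map j_inj) uv; exact: val_inj.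
Qed.

Lemma chain_imageE q (s : q.+1.-tuple V -> k) v :
  chain_image j s (map_tuple j v) = s v.
Proof.
rewrite /chain_image (_ : [set _ | _] = [set v]) ?fsbig_set1//.
by apply/seteqP; split=> [u /= /map_tuple_inj//|u /= ->].
Qed.

Lemma chain_image_out q (s : q.+1.-tuple V -> k) u :
  (forall v, map_tuple j v <> u) -> chain_image j s u = 0.
Proof.
move=> uj; rewrite /chain_image (_ : [set _ | _] = set0) ?fsbig_set0//.
by apply/seteqP; split=> [v /= /uj//|v].
Qed.

Lemma chain_image_neq0 q (s : q.+1.-tuple V -> k) u : chain_image j s u != 0 ->
  exists2 v, u = map_tuple j v & s v != 0.
Proof.
move=> su; have [[v vu]|nu] := pselect (exists v, map_tuple j v = u).
  by exists v => //; rewrite -(chain_imageE s v) vu.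
by rewrite chain_image_out ?eqxx// in su; apply/forallNP.
Qed.

Lemma chain_image_alt q (s : q.+1.-tuple V -> k) :
  (forall (p : 'S_q.+1) u, s [tuple tnth u (p l) | l < q.+1] = (-1) ^+ p * s u) ->
  forall (p : 'S_q.+1) u, chain_image j s [tuple tnth u (p l) | l < q.+1] =
    (-1) ^+ p * chain_image j s u.
Proof.
move=> s_alt p u; have mapp (p' : 'S_q.+1) v :
    [tuple tnth (map_tuple j v) (p' l) | l < q.+1] =
    map_tuple j [tuple tnth v (p' l) | l < q.+1].
  apply: eq_from_tnth => l.
  by rewrite [RHS]tnth_map [LHS]tnth_mktuple [LHS]tnth_map tnth_mktuple.
have [[v <-]|nu] := pselect (exists v, map_tuple j v = u).
  by rewrite mapp !chain_imageE.
rewrite !chain_image_out ?mulr0//; first exact/forallNP.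
move=> v vu; apply: nu; exists [tuple tnth v (p^-1%g l) | l < q.+1].
rewrite -mapp vu; apply: eq_from_tnth => l.
by rewrite !tnth_mktuple permKV.
Qed.

Lemma chain_bd_image q (s : q.+2.-tuple V -> k) :
  chain_bd s = \0 -> chain_bd (chain_image j s) = \0.
Proof.
move=> bs; apply/funext => u; rewrite /chain_bd.
have [[v vu]|nu] := pselect (exists v, map_tuple j v = u); last first.
  rewrite fsbig1// => w _; apply: chain_image_out => v /(congr1 (@tval _ _)) vu.
  apply: nu; exists [tuple of behead v]; apply: val_inj => /=.
  by rewrite -behead_map [map _ _]vu.
have consE x : [tuple of j x :: u] = map_tuple j [tuple of x :: v].
  by apply: val_inj; rewrite /= -vu.
rewrite -(fsbig_widen (j @` setT)) => [|//|w /= [_ nw]]; last first.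
  apply: chain_image_out => v' /(congr1 (@tval _ _)) /= vw; apply: nw.
  by exists (thead v') => //; move: vw; rewrite [v']tuple_eta /= => -[].
rewrite fsbig_image => [|x y _ _ /j_inj//].
under eq_fsbigr do rewrite consE chain_imageE.
by have /(congr1 (fun f => f v)) := bs.
Qed.

End ChainImage.

(** A sum over all vertices takes the default value 0 when infinitely many terms are nonzero, so
    additivity rests on a finite set that carries both sums. *)
Lemma chain_bdB (V : choiceType) (k : nzRingType) q (s s' : q.+2.-tuple V -> k) :
  (forall u : q.+1.-tuple V, exists2 A, finite_set A & forall w : V, ~ A w ->
    s [tuple of w :: u] = 0 /\ s' [tuple of w :: u] = 0) ->
  chain_bd (s \- s') = chain_bd s \- chain_bd s'.
Proof.
move=> sA; apply/funext => u; have [A /finite_fsetP[F ->] AP] := sA u.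
rewrite /chain_bd /= !(fsbigTE F) ?sumrB// => w /negP /AP[sw s'w] //.
by rewrite sw s'w subrr.
Qed.

Section Pullback.
Context {R : realType} {G : groupType} (S : seq G) (S_gen : generates S).
Local Notation len := (word_length S).
Local Notation gd := (gd S).
Context {V : countType} (h : V -> G) (T : nat).
Hypothesis h_fin : forall n, finite_set [set v | (len (h v) <= n)%N].

Definition pb_simplex (s : {fset V}) : Prop := s != fset0 /\
  forall x y, x \in s -> y \in s -> (gd (h x) (h y) <= T)%N.

Lemma pb_simplex_neq0 s : pb_simplex s -> s != fset0. Proof. by case. Qed.

Lemma pb_simplex1 v : pb_simplex [fset v]%fset.
Proof.
split; first by apply/fset0Pn; exists v; rewrite inE.
by move=> x y /fset1P -> /fset1P ->; rewrite gdxx.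
Qed.

Lemma pb_simplexS (s s' : {fset V}) :
  pb_simplex s -> (s' `<=` s)%fset -> s' != fset0 -> pb_simplex s'.
Proof.
by move=> [_ sT] /fsubsetP s's s'0; split=> // x y /s's xs /s's ys; exact: sT.
Qed.

(* The pull-back along [h] of the Rips complex of scale [T]. *)
Definition pb := SimplicialComplex pb_simplex_neq0 pb_simplex1 pb_simplexS.

Lemma near_vertices_finite (A : set V) : finite_set A ->
  finite_set [set w | exists2 v, A v & (gd (h v) (h w) <= T)%N].
Proof.
move=> Af; have [n nP] := @finite_bound _ A (fun v n => (len (h v) <= n)%N) Af
  (fun x _ => ex_intro _ (len (h x)) (fun m => id)).
refine (sub_finite_set _ (h_fin (n + T))) => w [v Av vw] /=.
rewrite -(gd1 S_gen); apply: leq_trans (gd_tri S_gen _ (h v) _) _.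
by rewrite addnC gd1// gdC// leq_add// nP.
Qed.

Lemma pb_meet_finite (A : set V) : finite_set A ->
  finite_set [set s | pb s /\ exists2 v, v \in s & A v].
Proof.
move=> /near_vertices_finite/finite_fsets.
by apply: sub_finite_set => s [[_ sT] [v vs Av]] w ws; exists v => //; exact: sT.
Qed.

Lemma pb_locally_finite : locally_finite pb.
Proof.
move=> v; refine (sub_finite_set _ (pb_meet_finite (finite_set1 v))) => s [Ks vs].
by split=> //; exists v.
Qed.

End Pullback.

(** The vertices of a regular chain form a [countType], while [G] is only a group; this provides an
    enumeration. *)
Lemma countable_pickle (G : groupType) (S : seq G) : generates S ->
  exists (f : G -> nat) (g : nat -> option G), pcancel f g.
Proof.
move=> S_gen.
have : countable [set: G].
  apply: (@sub_countable _ _ _ (\bigcup_n [set g | (word_length S g <= n)%N])).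
    by apply: subset_card_le => g _; exists (word_length S g) => /=.
  apply: bigcup_countable => // n _; apply: finite_set_countable.
  exact: ball_finite.
move=> /countable_injP[f f_inj].
have gP n : exists og : option G, forall g, f g = n -> og = Some g.
  have [[g fg]|nfg] := pselect (exists g, f g = n).
    exists (Some g) => g' fg'; congr Some.
    by apply: f_inj; rewrite ?inE// fg fg'.
  by exists None => g fg; case: nfg; exists g.
by have [g {}gP] := choice gP; exists f, g => x; exact: gP.
Qed.

(** * Passing between regular chains and the group *)

Section Charts.
Context {R : realType} {G : groupType} (S : seq G) (S_gen : generates S).
Local Notation len := (word_length S).
Local Notation gd := (gd S).
Local Notation d := (word_dist R S).
Local Notation bdG := (boundary d 1%g).
Variable delta : R.
Hypothesis gp_hyp : forall x y z, Num.min (gromov_product d 1%g x y)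
  (gromov_product d 1%g y z) - delta <= gromov_product d 1%g x z.
Variables (X : metricType R) (f : X -> bdG) (f' : bdG -> X).
Hypotheses (fK : cancel f f') (f'K : cancel f' f).
Hypotheses (f_cont : continuous f) (f'_cont : continuous f').

(** Away from a finite set, adjacent vertices have Gromov product at least N, because of a length
    above N + T and a distance of at most T, and each is near its own image. One [delta] is lost in
    carrying the image of [v] over to [w], another in comparing it there with that of [w]. *)
Lemma pb_regular (V : countType) (h : V -> G) (T : nat) (e : V -> X) :
  (forall n, finite_set [set v | (len (h v) <= n)%N]) ->
  (forall N : nat, finite_set [set v | ~ near_pt (h v) (f (e v)) N%:R]) ->
  forall eps : R, 0 < eps -> finite_set [set s : {fset V} | pb S h T s /\
    ~ (forall v w, v \in s -> w \in s -> mdist (e v) (e w) < eps)].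
Proof.
move=> h_fin e_near eps eps0.
have [r rP] := mdist_unif S_gen gp_hyp fK f'_cont eps0.
have [N rN] := nat_above (r + delta + delta).
have Bf := conj (e_near N) (h_fin (N + T)%N); rewrite -finite_setU in Bf.
have := pb_meet_finite S_gen T h_fin Bf.
apply: sub_finite_set => s [sT ns]; split=> //; apply: contrapT => nB.
apply: ns => v w vs ws; apply: rP.
have [vN vl] : near_pt (h v) (f (e v)) N%:R /\ (N + T < len (h v))%N.
  split; first by apply: contrapT => nv; apply: nB; exists v => //; left.
  by rewrite ltnNge; apply/negP => nv; apply: nB; exists v => //; right.
have wN : near_pt (h w) (f (e w)) N%:R.
  by apply: contrapT => nw; apply: nB; exists w => //; left.
have [_ /(_ v w vs ws) vwT] := sT.
have gpN : N%:R <= gromov_product d 1%g (h v) (h w).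
  have : (len (h v) <= gd (h v) (h w) + len (h w))%N.
    by rewrite -(gd1 S_gen) -(gd1 S_gen (h w)); exact: gd_tri.
  rewrite gpE//; move: vwT vl.
  by rewrite -(ltr_nat R) -!(ler_nat R) !natrD; lra.
have wNv := near_pt_gp S_gen gp_hyp gpN vN.
have d0 := delta_ge0 gp_hyp.
have : near_bd (f (e v)) (f (e w)) (N%:R - delta - delta).
  by apply: (near_bd_pt S_gen gp_hyp wNv); apply: near_ptW wN; lra.
by apply: near_bdW; lra.
Qed.

(* Push the vertices of a regular chain from the boundary into the group, at
   depths varying by at most 1 along each edge. *)
Lemma regular_chart (k : nzRingType) q (z : regular_chain X k q) :
  exists (h : vert z -> G) (C : nat),
    [/\ forall n, finite_set [set v | (len (h v) <= n)%N],
        forall N : nat, finite_set [set v | ~ near_pt (h v) (f (vmap v)) N%:R] &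
        forall s x y, cplx z s -> x \in s -> y \in s -> (gd (h x) (h y) <= C)%N].
Proof.
(* These are the vertices of simplices whose image is not small at level N. [slow_function] keeps
   their depth at most N, so a simplex at a vertex of depth n > 0 has an image small at level n -
   1. *)
pose F (N : nat) : set (vert z) := [set v | exists2 s, v \in s & cplx z s /\
  ~ (forall x y, x \in s -> y \in s -> near_bd (f (vmap x)) (f (vmap y)) N%:R)].
have Ff N : finite_set (F N).
  have [e e0 eP] := near_bd_unif S_gen gp_hyp fK f'K f_cont f'_cont N%:R.
  have : finite_set (\bigcup_(s in [set s | cplx z s /\
      ~ (forall v w, v \in s -> w \in s -> mdist (vmap v) (vmap w) < e)]) [set` s]).
    apply: bigcup_finite; first exact: vmap_regular.
    by move=> s _; exact: finite_fset.
  apply: sub_finite_set => v [s vs [Ks ns]]; exists s => //; split=> // se.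
  by apply: ns => x y xs ys; apply: eP; exact: se.
have [n [n_fin n_slow nF]] := slow_function (@cplx_lf _ _ _ _ z) Ff.
have [h hP] := choice (fun v => ray_exists S_gen gp_hyp (f (vmap v)) (n v)).
(* The two elements have Gromov product at least n x - 1 - 3 delta and lengths n x and at most n x +
   1; the distance is the sum of the lengths minus twice the product. *)
have [C CP] := nat_above (3 + 6 * delta); have d0 := delta_ge0 gp_hyp.
exists h, C; split.
- move=> N; have := n_fin N; apply: sub_finite_set => v /=.
  by have [-> _] := hP v.
- move=> N; have [M NM] := nat_above (N%:R + delta).
  have := n_fin M; apply: sub_finite_set => v /= nv.
  rewrite leqNgt; apply/negP => Mn; apply: nv.
  have [_] := hP v; apply: near_ptW.
  by move: Mn; rewrite -(ltr_nat R); lra.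
move=> s x y Ks xs ys; have [lx nx] := hP x; have [ly ny] := hP y.
pose r := (n x)%:R - 1 - delta : R.
have xy : near_bd (f (vmap x)) (f (vmap y)) r.
  case E : (n x) => [|m].
    by apply: near_bdW (near_bd0 S_gen _ _); rewrite /r E; lra.
  have mx : (m < n x)%N by rewrite E.
  have nbd : near_bd (f (vmap x)) (f (vmap y)) m%:R.
    apply: contrapT => nbd; apply: (nF x m mx); exists s => //; split=> //.
    by move=> sP; apply: nbd; exact: sP.
  by apply: near_bdW nbd; rewrite /r E -natr1; lra.
have nyx : (n x <= (n y).+1)%N by exact: n_slow ys xs.
have nxy : (n y <= (n x).+1)%N by exact: n_slow xs ys.
have hx : near_pt (h x) (f (vmap y)) (r - delta).
  by apply: near_pt_bd xy => //; apply: near_ptW nx; rewrite /r; lra.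
have hy : near_pt (h y) (f (vmap y)) (r - delta).
  apply: near_ptW ny; move: nyx; rewrite /r -(ler_nat R) -natr1; lra.
have := gp_near_pt S_gen gp_hyp hx hy; rewrite gpE// lx ly => gp_le.
rewrite -(ler_nat R); move: nxy; rewrite -(ler_nat R) -natr1.
by move: gp_le; rewrite /r; lra.
Qed.

End Charts.

Lemma finite_sum (A B : choiceType) (P : set (A + B)) :
  finite_set (inl @^-1` P) -> finite_set (inr @^-1` P) -> finite_set P.
Proof.
move=> Af Bf; have := conj (finite_image (@inl A B) Af) (finite_image (@inr A B) Bf).
rewrite -finite_setU; apply: sub_finite_set => -[a|b] Pv.
  by left; exists a.
by right; exists b.
Qed.

Theorem theorem6 (R : realType) (G : groupType) (S : seq G)
    (S_gen : generates S) (G_hyp : hyperbolic (word_dist R S))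
    (t : {posnum R}%R) (P_contr : contractible R (realization R (rips S t)))
    (X : metricType R) (X_bd : homeomorphic X (boundary (word_dist R S) 1%g))
    (k : finFieldType) (i : nat) :
  trivial_homology_at_infinity S t k i ->
  trivial_steenrod_homology X k i.
Proof.
move=> lim0 z1 z2 bz1 bz2.
have [delta hyp] := G_hyp; have [f [f' [fK f'K f_cont f'_cont]]] := X_bd.
have gp_hyp := hyp 1%g.
(* If the boundary is empty, [psi] has no possible values; but then the cycles have no vertices and
   the zero chain does. *)
have [[x0 _]|X0] := pselect (exists x0 : X, True); last first.
  have no1 (v : vert z1) : False by apply: X0; exists (vmap v).
  have no2 (v : vert z2) : False by apply: X0; exists (vmap v).
  pose c : regular_chain X k i.+2 := @RegularChain R X k i.+2 (vert z1) (cplx z1)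
    (@cplx_lf _ _ _ _ z1) (@vmap _ _ _ _ z1) (@vmap_regular _ _ _ _ z1) (fun=> 0)
    (conj (fun u _ => False_ind _ (no1 (thead u)))
          (fun _ u => False_ind _ (no1 (thead u)))).
  exists c, id, (fun v => False_rect _ (no2 v)); split.
  - split=> // s Ks; rewrite (_ : (id @` s)%fset = s)//.
    by apply/fsetP => x; case: (no1 x).
  - split; [by move=> v; case: (no2 v)| |by move=> v; case: (no2 v)].
    by move=> s /(simplex_neq0)/fset0Pn[v]; case: (no2 v).
  - by apply/funext => u; case: (no1 (thead u)).
have [h1 [C1 [h1_fin h1_near h1C]]] :=
  regular_chart S_gen gp_hyp fK f'K f_cont f'_cont z1.
have [h2 [C2 [h2_fin h2_near h2C]]] :=
  regular_chart S_gen gp_hyp fK f'K f_cont f'_cont z2.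
have [psi psi_near] := boundary_shadow S_gen gp_hyp (f x0).
have [pk [up pkK]] := countable_pickle S_gen.
(* The group elements are vertices as well, to hold the chains of the Rips complex; [psi] supplies
   their images in the boundary. *)
pose V : countType := ((vert z1 + vert z2) + pcan_type pkK)%type.
pose h (v : V) : G := match v with
  | inl (inl a) => h1 a | inl (inr b) => h2 b | inr g => g end.
pose e (v : V) : X := match v with
  | inl (inl a) => vmap a | inl (inr b) => vmap b | inr g => f' (psi g) end.
pose j (g : G) : V := inr g.
pose j1 (a : vert z1) : V := inl (inl a).
pose j2 (b : vert z2) : V := inl (inr b).
have j1_inj : injective j1 by move=> a b [].
have j2_inj : injective j2 by move=> a b [].
have h_fin n : finite_set [set v | (word_length S (h v) <= n)%N].
  apply: finite_sum; last exact: ball_finite.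
  by apply: finite_sum; [exact: h1_fin|exact: h2_fin].
have e_near (N : nat) : finite_set [set v | ~ near_pt (h v) (f (e v)) N%:R].
  apply: finite_sum.
    by apply: finite_sum; [exact: h1_near|exact: h2_near].
  have := psi_near N; apply: sub_finite_set => g /=.
  by rewrite f'K.
pose C := maxn C1 C2.
pose s1 := chain_image j1 (@chn _ _ _ _ z1).
pose s2 := chain_image j2 (@chn _ _ _ _ z2).
have s1_supp u : s1 u != 0 -> uniq u /\ narrow S h C u.
  move=> /(chain_image_neq0 j1_inj)[v -> v0].
  have [uv Kv] := (chnP z1).1 v v0; split; first by rewrite map_inj_uniq.
  move=> x y /mapP[a av ->] /mapP[b bv ->]; apply: leq_trans (leq_maxl _ _).
  by apply: (h1C _ a b Kv); rewrite inE.
have s2_supp u : s2 u != 0 -> uniq u /\ narrow S h C u.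
  move=> /(chain_image_neq0 j2_inj)[v -> v0].
  have [uv Kv] := (chnP z2).1 v v0; split; first by rewrite map_inj_uniq.
  move=> x y /mapP[a av ->] /mapP[b bv ->]; apply: leq_trans (leq_maxr _ _).
  by apply: (h2C _ a b Kv); rewrite inE.
pose s := s1 \- s2.
have s_supp u : s u != 0 -> uniq u /\ narrow S h C u.
  have [s1u|/s1_supp//] := eqVneq (s1 u) 0.
  have [s2u|/s2_supp//] := eqVneq (s2 u) 0.
  by rewrite /s /= s1u s2u subrr eqxx.
have s_alt (p : 'S_i.+2) u :
    s [tuple tnth u (p l) | l < i.+2] = (-1) ^+ p * s u.
  rewrite /s /= mulrBr; congr (_ - _); apply: chain_image_alt => //.
    exact: (chnP z1).2.
  exact: (chnP z2).2.
have s_cycle : chain_bd s = \0.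
  rewrite chain_bdB.
    rewrite (chain_bd_image j1_inj bz1) (chain_bd_image j2_inj bz2).
    by apply/funext => u /=; rewrite subrr.
  move=> u; have uf : finite_set [set` (u : seq V)] by exact: finite_seq.
  exists [set w | exists2 v, v \in (u : seq V) &
      (gd S (h v) (h w) <= C)%N].
    exact: (near_vertices_finite S_gen C h_fin uf).
  move=> w nw; have far (s' : i.+2.-tuple V -> k) :
      (forall u, s' u != 0 -> uniq u /\ narrow S h C u) ->
      s' [tuple of w :: u] = 0.
    move=> s'_supp; apply/eqP; apply: contra_notT nw => /s'_supp[_ nar].
    exists (thead u); first exact: mem_tnth.
    by apply: nar; rewrite ?mem_head// inE mem_tnth orbT.
  by split; exact: far.
have hj : cancel j h by [].
have [T' [c [c_supp c_alt bc]]] :=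
  locally_finite_cycle_bounds S_gen P_contr lim0 hj h_fin s_alt s_supp s_cycle.
(* [T'] accommodates the filling, [C] the complexes of [z1] and [z2], which must embed as
   subcomplexes. *)
pose T := maxn T' C.
have c_chain : is_chain (pb S h T) c.
  split=> // u /c_supp[uu nar]; split=> //; split.
    by apply/fset0Pn; exists (thead u); rewrite !inE mem_tnth.
  move=> x y; rewrite !inE => xu yu.
  by apply: leq_trans (nar x y xu yu) _; exact: leq_maxl.
have K_lf : locally_finite (pb S h T) by exact: pb_locally_finite.
pose c' : regular_chain X k i.+2 := @RegularChain R X k i.+2 V (pb S h T)
  K_lf e
  (pb_regular S_gen gp_hyp fK f'_cont T h_fin e_near) c c_chain.
exists c', j1, j2; split=> //.
- split=> // s' Ks; split=> [|x y /imfsetP[a /= as' ->] /imfsetP[b /= bs' ->]].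
    have /fset0Pn[a as'] := simplex_neq0 Ks.
    by apply/fset0Pn; exists (j1 a); apply/imfsetP; exists a.
  apply: leq_trans (h1C s' a b Ks as' bs') _.
  by apply: leq_trans (leq_maxl C1 C2) _; exact: leq_maxr.
- split=> // s' Ks; split=> [|x y /imfsetP[a /= as' ->] /imfsetP[b /= bs' ->]].
    have /fset0Pn[a as'] := simplex_neq0 Ks.
    by apply/fset0Pn; exists (j2 a); apply/imfsetP; exists a.
  apply: leq_trans (h2C s' a b Ks as' bs') _.
  by apply: leq_trans (leq_maxr C1 C2) _; exact: leq_maxr.
Qed.
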